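(* Consider the spatially periodic nonlinear Schrödinger equation $$iu_t-(u_{xx}+u_{yy})-f(|u|^2)u=0,$$ for $(t,x,y)\in(0,\infty)\times[0,K_1]\times[0,K_2]$, with $u$ being $K_1$-periodic in $x$ and $K_2$-periodic in $y$, and standing waves $u=e^{-i\omega t}\varphi(x)$ with $\varphi$ real-valued. (1) (Quadratic focusing case, $f(z)=\sqrt z$.) Let $\omega>0$, $c\in(-\tfrac13\omega^3,0)$, let $\varphi_0>\varphi_1>0$ be the positive solutions of $\tfrac23\rho^3-\omega\rho^2-c=0$, and put $$\alpha^2=\frac{4\varphi_0+2\varphi_1-3\omega}{12}\ (\alpha>0),\qquad \kappa^2=\frac{2\varphi_0-2\varphi_1}{4\varphi_0+2\varphi_1-3\omega},\qquad T=\frac{2K(\kappa)}{\alpha},\qquad K_1=T.$$ The equation admits cnoidal standing waves, with $\varphi$ of constant sign (either everywhere positive or everywhere negative) and $$|\varphi(x)|=\varphi_1+(\varphi_0-\varphi_1)\,\mathrm{cn}^2(\alpha x;\kappa).$$ For every such solution (that is, for all values of the parameter $\kappa\in(0,1)$) there exists $K_2>0$, depending on the specific solution, such that the solution is spectrally unstable and linearly unstable with respect to perturbations that are $T$-periodic in $x$ and $K_2$-periodic in $y$. (2) (Cubic focusing case, $f(z)=z$.) Let $\omega>0$, $c\in(-\tfrac12\omega^2,0)$, let $\varphi_0>\varphi_1>0$ be the positive roots of $\tfrac12\rho^4-\omega\rho^2-c=0$, and put $$\kappa^2=\frac{\varphi_0^2-\varphi_1^2}{\varphi_0^2}=\frac{2\varphi_0^2-2\omega}{\varphi_0^2},\qquad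 \alpha=\frac{\varphi_0}{\sqrt2},\qquad T=\frac{2K(\kappa)}{\alpha},\qquad K_1=T.$$ The equation supports dnoidal standing waves with (up to translation) $\varphi(x)=\mp\varphi_0\,\mathrm{dn}(\alpha x;\kappa)$. For every such solution (that is, for all values of the parameter $\kappa\in(0,1)$) there exists $K_2>0$, depending on the specific solution, such that the solution is spectrally unstable and linearly unstable with respect to perturbations that are $T$-periodic in $x$ and $K_2$-periodic in $y$.
   Context: $\mathrm{cn}(\cdot;\kappa)$, $\mathrm{dn}(\cdot;\kappa)$ are Jacobi elliptic functions of modulus $\kappa$, and $K(\kappa)$ is the complete elliptic integral of the first kind, $K(\kappa)=\int_0^1\frac{dz}{\sqrt{(1-z^2)(1-\kappa^2z^2)}}$. Standing waves $u=e^{-i\omega t}\varphi(x)$ satisfy $\omega\varphi-\varphi''-f(\varphi^2)\varphi=0$. Linearized problem. Write $u=e^{-i\omega t}(\varphi+v(t,x,y))$ with $v=v_1+iv_2$, $v_1,v_2$ real-valued, and drop terms of higher order in $v$. This gives $$iv_t+\omega v-(v_{xx}+v_{yy})-f(\varphi^2)v-2f'(\varphi^2)\varphi^2\,\mathrm{Re}\,v=0,$$ that is, $\partial_t\binom{v_1}{v_2}=\mathcal{A}\binom{v_1}{v_2}$ with $$\mathcal{A}\binom{v_1}{v_2}=\binom{-(\mathcal{L}_+-\partial_y^2)v_2}{(\mathcal{L}_--\partial_y^2)v_1},$$ $$\mathcal{L}_+=-\partial_x^2+\omega-f(\varphi^2),\qquad \mathcal{L}_-=-\partial_x^2+\omega-f(\varphi^2)-2f'(\varphi^2)\varphi^2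 .$$ In the quadratic case $f(z)=\sqrt z$ these are $\mathcal{L}_+=-\partial_x^2+\omega-|\varphi|$ and $\mathcal{L}_-=-\partial_x^2+\omega-2|\varphi|$; in the cubic case $f(z)=z$ they are $\mathcal{L}_+=-\partial_x^2+\omega-\varphi^2$ and $\mathcal{L}_-=-\partial_x^2+\omega-3\varphi^2$. The operator $\mathcal{A}$ is considered (after complexification) on $X=L^2\times L^2$ of functions that are $K_1$-periodic in $x$ and $K_2$-periodic in $y$, with domain the corresponding periodic $H^2\times H^2$. It generates a $C_0$ semigroup $e^{t\mathcal{A}}$. The wave is spectrally stable if $\sigma(\mathcal{A})\subset\{\lambda\in\mathbb{C}:\mathrm{Re}\,\lambda\le 0\}$, and spectrally unstable otherwise. It is linearly stable if the growth bound of $e^{t\mathcal{A}}$ is non-positive (equivalently, every solution of the linearized equation with initial data in $X$ satisfies $\lim_{t\to\infty}e^{-\delta t}\|v(t,\cdot)\|=0$ for every $\delta>0$), and linearly unstable otherwise. *)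

(* Defs.v *)
From HB Require Import structures.
From mathcomp Require Import all_boot all_order all_algebra.
From mathcomp Require Import all_classical all_reals all_analysis.
From mathcomp Require Export complex.
Set Implicit Arguments.
Unset Strict Implicit.
Unset Printing Implicit Defensive.
Import Order.TTheory GRing.Theory Num.Theory.
Import numFieldNormedType.Exports.
Local Open Scope classical_set_scope.
Local Open Scope ring_scope.

Section JacobiElliptic.
Context {R : realType}.
Implicit Types k u p : R.

(* The integrand takes the value 0 at the singular point z = 1. *)
Definition ellipticK k : R :=
  \int[lebesgue_measure]_(z in `[0, 1])
    (Num.sqrt ((1 - z ^+ 2) * (1 - k ^+ 2 * z ^+ 2)))^-1.

Let integrand k (t : R) : R := (Num.sqrt (1 - k ^+ 2 * sin t ^+ 2))^-1.

(* F(p; k), the integral from 0 to p, oriented when p < 0 *)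
Definition ellipticF k p : R :=
  if 0 <= p then \int[lebesgue_measure]_(t in `[0, p]) integrand k t
  else - \int[lebesgue_measure]_(t in `[p, 0]) integrand k t.

(* For 0 <= k < 1, F(-; k) is an increasing bijection of R and the amplitude is
   its inverse. *)
Definition jacobi_am k u : R := xget 0 [set p | ellipticF k p = u].

Definition jacobi_cn k u : R := cos (jacobi_am k u).

Definition jacobi_dn k u : R :=
  Num.sqrt (1 - k ^+ 2 * sin (jacobi_am k u) ^+ 2).

End JacobiElliptic.

Section NLS.
Context {R : realType}.

Definition cderivable (h : R -> R[i]) (t : R) : Prop :=
  derivable (fun s => complex.Re (h s)) t 1 /\
  derivable (fun s => complex.Im (h s)) t 1.

Definition cderive (h : R -> R[i]) (t : R) : R[i] :=
  Complex (derive1 (fun s => complex.Re (h s)) t)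
          (derive1 (fun s => complex.Im (h s)) t).

Definition cderivable2 (h : R -> R[i]) : Prop :=
  (forall s, cderivable h s) /\ (forall s, cderivable (cderive h) s).

(* Functions on the torus are represented by doubly periodic functions on the
   plane. *)
Definition nls_solution (f : R -> R) (K1 K2 : R) (u : R -> R -> R -> R[i])
    : Prop :=
  (forall t x y, u t (x + K1) y = u t x y /\ u t x (y + K2) = u t x y) /\
  forall t x y, 0 < t ->
    [/\ cderivable (fun s => u s x y) t,
        cderivable2 (fun r => u t r y), cderivable2 (fun r => u t x r)
      & 'i%C * cderive (fun s => u s x y) t
        - (cderive (cderive (fun r => u t r y)) x
           + cderive (cderive (fun r => u t x r)) y)
        - (f (complex.Re (u t x y) ^+ 2 + complex.Im (u t x y) ^+ 2))%:C%C
          * u t x y = 0].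

Definition standing_wave (omega : R) (phi : R -> R) (t x y : R) : R[i] :=
  Complex (cos (- (omega * t))) (sin (- (omega * t))) * (phi x)%:C%C.

End NLS.

(* V is a real vector space with seminorm N, whose elements are identified when
   their difference has seminorm 0, and A is the graph of a linear operator on V.
   A pair (u, w) : V * V is the element u + i w of the complexification. *)
Section OperatorStability.
Context {R : realType} {V : lmodType R}.
Variables (N : V -> R) (A : V -> V -> Prop).

Definition cscale (z : R[i]) (v : V * V) : V * V :=
  (complex.Re z *: v.1 - complex.Im z *: v.2,
   complex.Im z *: v.1 + complex.Re z *: v.2).

Definition cnorm (v : V * V) : R := Num.sqrt (N v.1 ^+ 2 + N v.2 ^+ 2).

Definition cgraph (v w : V * V) : Prop := A v.1 w.1 /\ A v.2 w.2.

(* z - A is a bijection from the domain onto the space, with bounded inverse;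
   the last clause also gives injectivity. *)
Definition resolvent_set : set R[i] :=
  [set z | (forall g, exists v w, cgraph v w /\ cnorm (cscale z v - w - g) = 0) /\
           exists C : R, forall v w, cgraph v w ->
             cnorm v <= C * cnorm (cscale z v - w)].

Definition spectrum : set R[i] := ~` resolvent_set.

Definition spectrally_stable : Prop :=
  spectrum `<=` [set z | complex.Re z <= 0].

Definition spectrally_unstable : Prop := ~ spectrally_stable.

(* Only the values at t >= 0 matter. *)
Record C0_semigroup (S : R -> V * V -> V * V) : Prop := {
  semigroup_linear : forall t, 0 <= t -> forall z u v,
    cnorm (S t (cscale z u + v) - (cscale z (S t u) + S t v)) = 0 ;
  semigroup_bounded : forall t, 0 <= t ->
    exists M : R, forall v, cnorm (S t v) <= M * cnorm v ;
  semigroup_0 : forall v, cnorm (S 0 v - v) = 0 ;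
  semigroup_add : forall s t, 0 <= s -> 0 <= t -> forall v,
    cnorm (S (s + t) v - S s (S t v)) = 0 ;
  semigroup_continuous : forall v, cnorm (S t v - v) @[t --> 0^'+] --> (0 : R)
}.

Definition generates (S : R -> V * V -> V * V) : Prop :=
  forall v w, cgraph v w <->
    cnorm (t^-1 *: (S t v - v) - w) @[t --> 0^'+] --> (0 : R).

Definition growth_bound (S : R -> V * V -> V * V) : \bar R :=
  ereal_inf [set b%:E | b in [set b : R | exists M : R, forall t, 0 <= t ->
    forall v, cnorm (S t v) <= M * expR (b * t) * cnorm v]].

Definition linearly_stable : Prop :=
  exists S, [/\ C0_semigroup S, generates S & (growth_bound S <= 0)%E].

Let nonneg : set R := [set s | 0 <= s].

(* Mild solution of v' = A v on [0, +oo): with w the integral of v from 0,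
   v(t) = v(0) + A w(t). *)
Definition linear_solution (v : R -> V * V) : Prop :=
  exists w : R -> V * V, cnorm (w 0) = 0 /\
    forall t, 0 <= t ->
      [/\ cnorm (v s - v t) @[s --> within nonneg (nbhs t)] --> (0 : R),
          cnorm ((s - t)^-1 *: (w s - w t) - v t)
            @[s --> within nonneg t^'] --> (0 : R)
        & cgraph (w t) (v t - v 0)].

Definition linearly_stable_solutions : Prop :=
  forall v, linear_solution v -> forall delta : R, 0 < delta ->
    expR (- (delta * t)) * cnorm (v t) @[t --> +oo] --> (0 : R).

(* The two notions of stability are equivalent when A generates a C_0
   semigroup.  Asserting the failure of both makes instability imply the
   existence of a solution that does not decay. *)
Definition linearly_unstable : Prop :=
  ~ linearly_stable /\ ~ linearly_stable_solutions.

End OperatorStability.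

(* Functions on the torus (R / K1 Z) x (R / K2 Z) are represented by their
   values on the period cell; periodicity enters through the test functions. *)
Section PeriodicOperator.
Context {R : realType}.
Variables (K1 K2 : R).

Local Notation plane := (measurableTypeR R * measurableTypeR R)%type.

Definition cell : set plane := `[0, K1] `*` `[0, K2].

Lemma measurable_cell : measurable cell.
Proof. by apply: measurableX; exact: measurable_itv. Qed.

Definition cell_measure : {measure set plane -> \bar R} :=
  @mrestr _ _ R cell (lebesgue_measure \x lebesgue_measure)%E measurable_cell.

Local Notation L2 := (LfunType cell_measure (lee1n 2)).

Definition L2norm (v : L2 * L2) : R :=
  Num.sqrt (fine ('N[cell_measure]_2[EFin \o v.1])%E ^+ 2
            + fine ('N[cell_measure]_2[EFin \o v.2])%E ^+ 2).

Inductive direction := dirx | diry.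

Definition axis (d : direction) : R * R :=
  match d with dirx => (1, 0) | diry => (0, 1) end.

Definition pderive (s : seq direction) (g : R * R -> R) : R * R -> R :=
  foldr (fun d h => 'D_(axis d) h) g s.

Definition smooth (g : R * R -> R) : Prop :=
  forall s, continuous (pderive s g) /\
            forall p d, derivable (pderive s g) p (axis d).

Definition test_function (psi : R * R -> R) : Prop :=
  smooth psi /\
  forall x y, psi (x + K1, y) = psi (x, y) /\ psi (x, y + K2) = psi (x, y).

Definition weak_derivative (s : seq direction) (v w : L2) : Prop :=
  forall psi, test_function psi ->
    \int[cell_measure]_p (v p * pderive s psi p)
    = (-1) ^+ size s * \int[cell_measure]_p (w p * psi p).

Definition in_H2 (v : L2) : Prop :=
  forall s, (size s <= 2)%N -> exists w, weak_derivative s v w.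

(* graph of v |-> - v_xx - v_yy + V(x) v, with domain the periodic H^2 *)
Definition schroedinger (V : R -> R) (v g : L2) : Prop :=
  in_H2 v /\ exists vxx vyy : L2,
    [/\ weak_derivative [:: dirx; dirx] v vxx,
        weak_derivative [:: diry; diry] v vyy
      & {ae cell_measure, forall p,
           g p = - vxx p - vyy p + V p.1 * v p}].

Definition potential_plus (f : R -> R) (omega : R) (phi : R -> R) (x : R) : R :=
  omega - f (phi x ^+ 2).

Definition potential_minus (f : R -> R) (omega : R) (phi : R -> R) (x : R) : R :=
  omega - f (phi x ^+ 2) - 2 * derive1 f (phi x ^+ 2) * phi x ^+ 2.

(* (v1, v2) |-> (- (L_+ - d_y^2) v2, (L_- - d_y^2) v1) *)
Definition linearization (f : R -> R) (omega : R) (phi : R -> R)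
    (v g : L2 * L2) : Prop :=
  schroedinger (potential_plus f omega phi) v.2 (- g.1) /\
  schroedinger (potential_minus f omega phi) v.1 g.2.

End PeriodicOperator.

Definition spectrally_unstable_wave {R : realType} (f : R -> R) (omega : R)
    (phi : R -> R) (K1 K2 : R) : Prop :=
  spectrally_unstable (@L2norm R K1 K2) (@linearization R K1 K2 f omega phi).

Definition linearly_unstable_wave {R : realType} (f : R -> R) (omega : R)
    (phi : R -> R) (K1 K2 : R) : Prop :=
  linearly_unstable (@L2norm R K1 K2) (@linearization R K1 K2 f omega phi).

(* Main.v *)
Require Import Defs.
From mathcomp Require Import all_boot all_order all_algebra.
From mathcomp Require Import all_classical all_reals all_analysis.
From mathcomp Require Import measurable_realfun ring lra.
Set Implicit Arguments.
Unset Strict Implicit.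
Unset Printing Implicit Defensive.
Import Order.TTheory GRing.Theory Num.Theory.
Import numFieldNormedType.Exports.
Local Open Scope classical_set_scope.
Local Open Scope ring_scope.

(** Both waves satisfy L_+ phi = 0 with phi of constant sign, so L_+ is
    nonnegative, whereas L_- has a positive eigenfunction chi with a negative
    eigenvalue - nu2, since L_- phi' = 0 and phi' changes sign. A perturbation
    exp(lam t) (v1(x), v2(x)) cos(q y), with mu = q^2, grows at the rate lam > 0
    when
      v1'' = (Vm + mu) v1 - lam v2,   v2'' = (Vp + mu) v2 + lam v1,
    where Vm and Vp are the potentials of L_- and L_+. For lam = 0 this system
    decouples and has the periodic solution (chi, 0) at mu = nu2. The claim is
    that this solution continues to small lam > 0, for some mu near nu2.

    The continuation is done by shooting, not by perturbation theory of
    operators. The potentials are even and periodic of period 2h, so a solution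
    whose derivatives vanish at 0 and at h is periodic. The condition at h is the
    vanishing of a determinant of order two, a continuous function of lam and
    mu. For lam = 0 it is the product of the shooting functions of L_- + mu and
    L_+ + mu. A Wronskian with chi shows that the first changes sign at nu2
    (minus_shooting_sign), and an energy identity with phi that the second has no
    zero for mu > 0 (plus_shooting_neq0). Hence for small lam > 0 the determinant
    still changes sign in mu, and the intermediate value theorem applies
    (shooting). Existence, uniqueness and continuous dependence for linear systems
    come from Picard iteration (linear_ode_exists) and an energy estimate
    (gronwall).

    The number K2 = 2 pi / q then makes (v1 cos(q y), v2 cos(q y)) an eigenvector
    of the linearization on the torus, in the weak sense of the definitions
    (tensor_schroedinger, wave_unstable). An eigenvalue lam > 0 belongs to the
    spectrum; exp(lam t) times the eigenvector is a solution that does not decay;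
    and a semigroup with growth bound below lam cannot have it in the domain of
    its generator with this eigenvalue (eigenvector_unstable).

    It remains to know the waves. In terms of D(x) = dn(alpha x; kappa), the
    inverse of an elliptic integral, everything is polynomial: phi is
    proportional to D in the cubic case and |phi| is affine in D^2 in the
    quadratic case, and chi is D^2 + b, respectively D (D^2 + b), for a suitable
    constant b (dnoidal_unstable, cnoidal_unstable). *)

(** * Derivatives and primitives *)

Section Calculus.
Context {R : realType}.
Implicit Types (f g h : R -> R) (a b c x y : R).

(** The rules of derivation in pointwise form: stated for fun y => f y * g y
    and not for products of functions, they compose into one proof term, and
    der_eq leaves the comparison of the derivative that they compute with the
    expected one to ring. *)
Lemma der_eq f x a b : is_derive x 1 f a -> a = b -> is_derive x 1 f b.
Proof. by move=> + <-. Qed.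

Lemma derD f g x a b : is_derive x 1 f a -> is_derive x 1 g b ->
  is_derive x 1 (fun y => f y + g y) (a + b).
Proof. exact: is_deriveD. Qed.

Lemma derB f g x a b : is_derive x 1 f a -> is_derive x 1 g b ->
  is_derive x 1 (fun y => f y - g y) (a - b).
Proof. exact: is_deriveB. Qed.

Lemma derN f x a : is_derive x 1 f a -> is_derive x 1 (fun y => - f y) (- a).
Proof. exact: is_deriveN. Qed.

Lemma derM f g x a b : is_derive x 1 f a -> is_derive x 1 g b ->
  is_derive x 1 (fun y => f y * g y) (a * g x + f x * b).
Proof.
move=> fa gb; apply: (@der_eq (fun y => f y * g y) x _ _ (is_deriveM fa gb)).
by rewrite addrC /GRing.scale /= [g x * a]mulrC.
Qed.

Lemma derC c x : is_derive x 1 (fun=> c) 0.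
Proof. exact: is_derive_cst. Qed.

Lemma derI x : is_derive x 1 (fun y : R => y) 1.
Proof. exact: is_derive_id. Qed.

Lemma derZ f x a c : is_derive x 1 f a -> is_derive x 1 (fun y => c * f y) (c * a).
Proof.
by move=> fa; apply: der_eq (derM (derC c x) fa) _; rewrite mul0r add0r.
Qed.

Lemma der_comp f g x a b : is_derive (g x) 1 f a -> is_derive x 1 g b ->
  is_derive x 1 (fun y => f (g y)) (a * b).
Proof. exact: is_derive1_comp. Qed.

Lemma derX f x a n : is_derive x 1 f a ->
  is_derive x 1 (fun y => f y ^+ n) (n%:R * f x ^+ n.-1 * a).
Proof.
move=> fa; have -> : (fun y => f y ^+ n) = f ^+ n by rewrite exprfctE.
exact: is_deriveX.
Qed.

Lemma der_affine f x a k c : is_derive (k * x + c) 1 f a ->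
  is_derive x 1 (fun y => f (k * y + c)) (k * a).
Proof.
move=> fa; have H : is_derive x 1 (fun y => k * y + c) (k * 1 + 0).
  exact: (derD (derZ k (derI x)) (derC c x)).
apply: (der_eq (der_comp (g := fun y => k * y + c) fa H)).
by rewrite mulr1 addr0 mulrC.
Qed.

Lemma der_cont f x a : is_derive x 1 f a -> {for x, continuous f}.
Proof.
by move=> fa; apply/differentiable_continuous/derivable1_diffP; case: fa.
Qed.

Lemma der_continuous f g : (forall x, is_derive x 1 f (g x)) -> continuous f.
Proof. by move=> fg x; apply: der_cont (fg x). Qed.

Lemma der_within f g (A : set R) : (forall x, is_derive x 1 f (g x)) ->
  {within A, continuous f}.
Proof. by move=> fg; apply: continuous_subspaceT => x; apply: der_cont (fg x). Qed.

Lemma der_derive1 f x a : is_derive x 1 f a -> derive1 f x = a.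
Proof. by move=> fa; rewrite derive1E; apply: derive_val. Qed.

Lemma der_ge0_le f g a b : (forall x, is_derive x 1 f (g x)) -> a <= b ->
  (forall x, a <= x <= b -> 0 <= g x) -> f a <= f b.
Proof.
move=> fg ab g0.
have [c] := @MVT_segment R f g a b ab (fun z _ => fg z) (der_within fg).
rewrite in_itv /= => cab E; rewrite -subr_ge0 E mulr_ge0 ?subr_ge0//.
exact: g0.
Qed.

Lemma der_gt0_lt f g a b : (forall x, is_derive x 1 f (g x)) -> a < b ->
  (forall x, a < x < b -> 0 < g x) -> f a < f b.
Proof.
move=> fg ab g0.
have [c] := @MVT R f g a b ab (fun z _ => fg z) (der_within fg).
rewrite in_itv /= => cab E; rewrite -subr_gt0 E mulr_gt0 ?subr_gt0//.
exact: g0.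
Qed.

Lemma der0_cst f : (forall x, is_derive x 1 f 0) -> forall x y, f x = f y.
Proof. by move=> f0 x y; apply: is_derive_0_is_cst. Qed.

Lemma der_ext f g x a : f =1 g -> is_derive x 1 f a -> is_derive x 1 g a.
Proof. by move=> /funext ->. Qed.

(** The sign convention is the one of ellipticF, so that the elliptic
    integral and the integrals of the Picard iteration share
    oriented_integral_der. *)
Definition oriented_integral f x : R :=
  if 0 <= x then \int[lebesgue_measure]_(t in `[0, x]) f t
  else - \int[lebesgue_measure]_(t in `[x, 0]) f t.

Lemma itv_integrable f a b : continuous f ->
  lebesgue_measure.-integrable `[a, b] (EFin \o f).
Proof.
move=> cf; apply: continuous_compact_integrable; first exact: segment_compact.
exact: continuous_subspaceT.
Qed.

(** Near x the oriented integral differs by a constant from the integral that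
    starts at a point a below both x and 0. The fundamental theorem applies
    to the latter, whatever the sign of x. *)
Lemma oriented_integral_der f : continuous f -> forall x, is_derive x 1 (oriented_integral f) (f x).
Proof.
move=> cf x.
set a := - (`|x| + 1); set u := `|x| + 2.
pose G y : R := \int[lebesgue_measure]_(t in `[a, y]) f t.
have [x1 x2] : - `|x| <= x /\ x <= `|x|.
  by split; [rewrite lerNl -normrN ler_norm | rewrite ler_norm].
have x0 : 0 <= `|x| by [].
have ax : a < x by rewrite /a; lra.
have xu : x < u by rewrite /u; lra.
have [dG G'] : derivable G x 1 /\ derive1 G x = f x.
  apply: (@continuous_FTC1_closed _ f a x u xu _ ax (cf x)).
  exact: itv_integrable.
have E y : a < y -> oriented_integral f y = G y - G 0.
  move=> ay; rewrite /oriented_integral; case: ifPn => y0.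
    rewrite /G Rintegral_itvB ?bnd_simp//; [|exact: itv_integrable|].
      rewrite Rintegral_itv_obnd_cbnd //.
      apply: integrableS (itv_integrable 0 y cf) => //.
      exact: subset_itv_oc_cc.
    by rewrite /a oppr_le0 addr_ge0.
  rewrite -opprB; congr (- _).
  rewrite /G Rintegral_itvB ?bnd_simp//; [|exact: itv_integrable|exact: ltW|].
    rewrite Rintegral_itv_obnd_cbnd //.
    apply: integrableS (itv_integrable y 0 cf) => //.
    exact: subset_itv_oc_cc.
  by rewrite ltW // ltNge.
have dG2 : is_derive x 1 (fun y => G y - G 0) (f x).
  have H : is_derive x 1 G (f x) by apply: DeriveDef dG _; rewrite -derive1E.
  by apply: (der_eq (derB H (derC (G 0) x))); rewrite subr0.
apply: near_eq_is_derive dG2.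
near=> y; rewrite E//; near: y.
exact: lt_nbhsr.
Unshelve. all: by end_near. Qed.

Lemma oriented_integral0 f : oriented_integral f 0 = 0.
Proof. by rewrite /oriented_integral lexx set_itv1 Rintegral_set1. Qed.

End Calculus.

(** * Existence for linear systems of differential equations *)

Section ODE.
Context {R : realType}.
Implicit Types (f g h : R -> R) (a b c x y : R).

Lemma der_sum (I : finType) (f g : I -> R -> R) x :
  (forall i, is_derive x 1 (f i) (g i x)) ->
  is_derive x 1 (fun y => \sum_i f i y) (\sum_i g i x).
Proof.
move=> fg; elim: (index_enum I) => [|i s IH].
  under eq_fun do rewrite big_nil.
  rewrite big_nil; exact: derC.
under eq_fun do rewrite big_cons.
by rewrite big_cons; apply: derD.
Qed.

Lemma weighted_primitive_bound_ge0 (g g' : R -> R) (K c : R) : 0 < c -> 0 <= K -> g 0 = 0 ->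
  (forall x, is_derive x 1 g (g' x)) ->
  (forall x, 0 <= x -> `|g' x| <= K * (c * expR (c * x))) ->
  forall x, 0 <= x -> `|g x| <= K * expR (c * x).
Proof.
move=> c0 K0 g0 dg bg x x0.
have dE y : is_derive y 1 (fun y => K * expR (c * y)) (K * (c * expR (c * y))).
  apply: derZ; apply: (der_eq (@der_comp _ expR (fun y => c * y) y _ _ (is_derive_expR _) (derZ c (derI y)))).
  by rewrite mulr1 mulrC.
have e0 : K * expR (c * 0) = K by rewrite mulr0 expR0 mulr1.
rewrite ler_norml; apply/andP; split.
  have : K * expR (c * 0) + g 0 <= K * expR (c * x) + g x.
    apply: (der_ge0_le (f := fun y => K * expR (c * y) + g y)
        (fun y => derD (dE y) (dg y)) x0) => y /andP[y0 _].
    by move: (bg y y0); rewrite ler_norml => /andP[+ _]; rewrite -subr_ge0 opprK addrC.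
  by rewrite e0 g0; lra.
have : K * expR (c * 0) - g 0 <= K * expR (c * x) - g x.
  apply: (der_ge0_le (f := fun y => K * expR (c * y) - g y)
      (fun y => derB (dE y) (dg y)) x0) => y /andP[y0 _].
  by move: (bg y y0); rewrite ler_norml => /andP[_ +]; rewrite subr_ge0.
by rewrite e0 g0; lra.
Qed.

Lemma der_opp_arg f a x : is_derive (- x) 1 f a ->
  is_derive x 1 (fun y => f (- y)) (- a).
Proof.
move=> fa; apply: (der_eq (@der_comp _ f (fun y => - y) x _ _ fa (derN (derI x)))).
by rewrite mulrN1.
Qed.

(** The weight expR (c * |x|) makes taking primitives a contraction of ratio
    c^-1 on the whole line, so that the Picard iteration needs no compact
    interval. *)
Lemma weighted_primitive_bound (g g' : R -> R) (K c : R) : 0 < c -> 0 <= K -> g 0 = 0 ->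
  (forall x, is_derive x 1 g (g' x)) ->
  (forall x, `|g' x| <= K * (c * expR (c * `|x|))) ->
  forall x, `|g x| <= K * expR (c * `|x|).
Proof.
move=> c0 K0 g0 dg bg x; have [x0|x0] := leP 0 x.
  rewrite (ger0_norm x0); apply: (weighted_primitive_bound_ge0 c0 K0 g0 dg) => // y y0.
  by move: (bg y); rewrite (ger0_norm y0).
rewrite (ltr0_norm x0) -{1}[x]opprK.
apply: (@weighted_primitive_bound_ge0 (fun y => g (- y)) (fun y => - g' (- y))) => //.
- by rewrite oppr0.
- by move=> y; apply: der_opp_arg.
- by move=> y y0; move: (bg (- y)); rewrite !normrN (ger0_norm y0).
- by rewrite oppr_ge0 ltW.
Qed.

(** A Cauchy sequence that comes with error bounds: the limit is the supremum
    of the lower bounds s k - e k. *)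
Lemma nested_limit (s e : nat -> R) :
  (forall k m, `|s (k + m)%N - s k| <= e k) ->
  exists l, forall k, `|l - s k| <= e k.
Proof.
move=> H.
have e0 k : 0 <= e k by apply: le_trans (H k 0%N).
have K k m : s k - e k <= s m + e m.
  have [km|/ltnW mk] := leqP k m.
    move: (H k (m - k)%N); rewrite subnKC // ler_norml => /andP[h1 h2].
    by have := e0 m; lra.
  move: (H m (k - m)%N); rewrite subnKC // ler_norml => /andP[h1 h2].
  by have := e0 k; lra.
pose A := [set s k - e k | k in [set: nat]].
have A0 : A !=set0 by exists (s 0%N - e 0%N); exists 0%N.
exists (sup A) => k; rewrite ler_norml; apply/andP; split.
  have : s k - e k <= sup A; last lra.
  apply: ub_le_sup; last by exists k.
  by exists (s 0%N + e 0%N) => _ [m _ <-]; exact: K.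
have : sup A <= s k + e k; last lra.
by apply: ge_sup => // _ [m _ <-]; exact: K.
Qed.

Lemma eq0_of_le_halfpow (a b : R) : (forall n, `|a| <= b / 2 ^+ n) -> a = 0.
Proof.
move=> H; apply/eqP; rewrite -normr_eq0; apply/negPn/negP => a0.
have a1 : 0 < `|a| by rewrite lt_def a0 /=.
have := H 0%N; rewrite expr0 divr1 => ab.
have b0 : 0 < b by apply: lt_le_trans ab.
pose n := Num.bound (b / `|a|).
have nb : b / `|a| < n%:R.
  by apply: archi_boundP; rewrite divr_ge0 ?ltW.
have := H n; rewrite ler_pdivlMr ?exprn_gt0// leNgt => /negP; apply.
rewrite ltr_pdivrMr // in nb.
rewrite (lt_le_trans nb)// mulrC ler_wpM2l//.
by rewrite -natrX ler_nat ltnW // ltn_expl.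
Qed.

Section Picard.
Variables (I : finType) (A : I -> I -> R -> R) (L : R).
Hypotheses (A_cont : forall i j, continuous (A i j)).
Hypotheses (L0 : 0 <= L) (A_bnd : forall i j x, `|A i j x| <= L).
Variable y0 : I -> R.

(** C exceeds the norm of the coefficient matrix, so with the weight expR (2
    C |x|) a Picard step has ratio 1/2. *)
Let C : R := #|I|%:R * L + 1.
Let C0 : 0 < C. Proof. by rewrite /C; apply: ltr_wpDl => //; apply: mulr_ge0. Qed.
Let B : R := \sum_i `|y0 i|.
Let B0 : 0 <= B. Proof. exact: sumr_ge0. Qed.
Let E x : R := expR (C * 2 * `|x|).

Lemma sum_coef_bound (w : I -> R) i x K : 0 <= K -> (forall j, `|w j| <= K) ->
  `|\sum_j A i j x * w j| <= C * K.
Proof.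
move=> K0 wK; apply: le_trans (ler_norm_sum _ _ _) _.
have -> : C * K = (\sum_(j : I) L * K) + K.
  rewrite sumr_const /C mulrDl mul1r; congr (_ + _).
  by rewrite -[(L * K) *+ _]mulr_natl mulrA.
apply: ler_wpDr => //; apply: ler_sum => j _.
by rewrite normrM ler_pM.
Qed.

Fixpoint picard (n : nat) : I -> R -> R :=
  if n is n'.+1 then fun i x => y0 i + oriented_integral (fun t => \sum_j A i j t * picard n' j t) x
  else fun i _ => y0 i.

Lemma coef_cont (w : I -> R -> R) i : (forall j, continuous (w j)) ->
  continuous (fun t => \sum_j A i j t * w j t).
Proof.
move=> cw; elim: (index_enum I) => [|j s IH].
  under eq_fun do rewrite big_nil.
  by move=> x; exact: cvg_cst.
under eq_fun do rewrite big_cons.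
by move=> x; apply: cvgD; [apply: cvgM; [exact: A_cont|exact: cw]|exact: IH].
Qed.

Lemma picard_cont n i : continuous (picard n i).
Proof.
elim: n i => [|n IH] i /=; first by move=> x; exact: cvg_cst.
move=> x; apply: cvgD; first exact: cvg_cst.
have H := der_continuous (oriented_integral_der (@coef_cont _ i IH)).
exact: H.
Qed.

Lemma picard_map_contracts (w w' : I -> R -> R) i K : 0 <= K ->
  (forall j, continuous (w j)) -> (forall j, continuous (w' j)) ->
  (forall j x, `|w j x - w' j x| <= K * E x) ->
  forall x, `|oriented_integral (fun t => \sum_j A i j t * w j t) x
             - oriented_integral (fun t => \sum_j A i j t * w' j t) x| <= K / 2 * E x.
Proof.
move=> K0 cw cw' H x.
apply: (@weighted_primitive_bound (fun x => oriented_integral (fun t => \sum_j A i j t * w j t) x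
             - oriented_integral (fun t => \sum_j A i j t * w' j t) x)
   (fun t => (\sum_j A i j t * w j t) - \sum_j A i j t * w' j t) (K / 2) (C * 2)).
- by rewrite mulr_gt0.
- by rewrite divr_ge0.
- by rewrite !oriented_integral0 subrr.
- by move=> z; apply: derB; apply: oriented_integral_der; apply: coef_cont.
- move=> z; rewrite -sumrB.
  under eq_bigr do rewrite -mulrBr.
  apply: le_trans (sum_coef_bound _ _ _ (fun j => H j z)) _.
    by rewrite mulr_ge0 ?expR_ge0.
  rewrite /E le_eqVlt; apply/orP; left; apply/eqP.
  by field.
Qed.

Lemma E_ge1 x : 1 <= E x.
Proof. by rewrite /E -expR0 ler_expR !mulr_ge0 // ltW. Qed.

Lemma picard_step n i x : `|picard n.+1 i x - picard n i x| <= B / 2 ^+ n * E x.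
Proof.
elim: n i x => [|n IH] i x.
  rewrite expr0 divr1 /= addrAC subrr add0r.
  have H : `|oriented_integral (fun t => \sum_j A i j t * y0 j) x| <= B / 2 * E x.
    apply: (@weighted_primitive_bound _ (fun t => \sum_j A i j t * y0 j) (B / 2) (C * 2)).
    - by rewrite mulr_gt0.
    - by rewrite divr_ge0.
    - by rewrite oriented_integral0.
    - move=> z; apply: oriented_integral_der; apply: (coef_cont (w := fun j _ => y0 j)) => j y.
      exact: cvg_cst.
    - move=> z; apply: (@le_trans _ _ (C * B)).
        apply: sum_coef_bound => // j.
        by rewrite /B (bigD1 j) //= lerDl sumr_ge0.
      have := E_ge1 z; rewrite -/(E z) => E1.
      have -> : B / 2 * (C * 2 * E z) = C * B * E z by field.
      by rewrite ler_peMr // mulr_ge0 // ltW.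
  apply: le_trans H _; apply: ler_wpM2r; first exact: expR_ge0.
  by rewrite ler_pdivrMr // ler_peMr // ler1n.
have := @picard_map_contracts (picard n.+1) (picard n) i (B / 2 ^+ n) _ (@picard_cont n.+1) (@picard_cont n) IH x.
rewrite exprSr invfM mulrA => /(_ _)/wrap[]; first by rewrite divr_ge0 // exprn_ge0.
by rewrite [X in _ -> X]/= opprD addrACA subrr add0r.
Qed.

Lemma picard_cauchy i x n m :
  `|picard (n + m) i x - picard n i x| <= 2 * B / 2 ^+ n * E x.
Proof.
have F k : `|picard (n + k) i x - picard n i x|
    <= 2 * B / 2 ^+ n * E x - 2 * B / 2 ^+ (n + k) * E x.
  elim: k => [|k IH]; first by rewrite addn0 !subrr normr0.
  have -> : picard (n + k.+1) i x - picard n i x =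
     (picard (n + k.+1) i x - picard (n + k) i x) + (picard (n + k) i x - picard n i x).
    by rewrite subrKA.
  apply: le_trans (ler_normD _ _) _.
  rewrite addnS; have := picard_step (n + k) i x; move: IH.
  rewrite exprSr invfM; move: (2 ^+ (n + k))^-1 => q; move: (2^+ n)^-1 => r.
  set u := `|_|; set v := `|_|.
  lra.
apply: le_trans (F m) _; rewrite gerBl.
by rewrite !mulr_ge0 ?expR_ge0 // invr_ge0 exprn_ge0.
Qed.

(** The Picard iterates converge, each step halving the error for the weight
    E. Their limit Y is continuous, being locally a uniform limit, so A Y has
    a primitive; comparing it with the iterates shows that it is Y - y0. *)
Theorem linear_ode_exists : exists Y : I -> R -> R,
  (forall i, Y i 0 = y0 i) /\
  forall i x, is_derive x 1 (Y i) (\sum_j A i j x * Y j x).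
Proof.
have [Y HY] : exists Y : I -> R -> R, forall i x n,
    `|Y i x - picard n i x| <= 2 * B / 2 ^+ n * E x.
  have ex i x := @nested_limit (fun n => picard n i x) _ (fun n m => picard_cauchy i x n m).
  exists (fun i x => projT1 (cid (ex i x))) => i x n.
  exact: (projT2 (cid (ex i x))).
have cY i : continuous (Y i).
  move=> x; apply/cvgrPdist_lt => eps eps0.
  pose M := expR (C * 2 * (`|x| + 1)).
  have M0 : 0 < M by exact: expR_gt0.
  have [n Hn] : exists n, 2 * B / 2 ^+ n * M < eps / 3.
    apply: contrapT => /forallNP H.
    suff : eps = 0 by move: eps0 => /[swap] ->; rewrite ltxx.
    apply: (@eq0_of_le_halfpow _ (3 * (2 * B * M))) => n; rewrite gtr0_norm //.
    by move: (H n) => /negP; rewrite -leNgt; move: (2 ^+ n)^-1 => q; lra.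
  have bE y : `|y| <= `|x| + 1 -> 2 * B / 2 ^+ n * E y < eps / 3.
    move=> yx; apply: le_lt_trans Hn; apply: ler_wpM2l.
      by rewrite divr_ge0 ?mulr_ge0 // exprn_ge0.
    by rewrite ler_expR ler_wpM2l // mulr_ge0 // ltW.
  have /cvgrPdist_lt/(_ (eps / 3)) := @picard_cont n i x.
  move=> /(_ _)/wrap[]; first by rewrite divr_gt0.
  move=> near_p; near=> y.
  have h1 : `|picard n i x - picard n i y| < eps / 3 by near: y; exact: near_p.
  have h2 := le_lt_trans (HY i x n) (bE x _).
  have h3 := le_lt_trans (HY i y n) (bE y _).
  have xx : `|x| <= `|x| + 1 by rewrite lerDl.
  have xy : `|x - y| < 1.
    near: y; exact: (@nbhsx_ballx _ _ (x : R) 1 ltr01).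
  have yx : `|y| <= `|x| + 1.
    have -> : y = x - (x - y) by rewrite subKr.
    by rewrite (le_trans (ler_normB _ _))// lerD2l ltW.
  move: h1 (h2 xx) (h3 yx); rewrite !ltr_norml => /andP[a1 a2] /andP[a3 a4] /andP[a5 a6].
  by apply/andP; split; lra.
have E0 : E 0 = 1 by rewrite /E normr0 mulr0 expR0.
have eqY i x : y0 i + oriented_integral (fun t => \sum_j A i j t * Y j t) x = Y i x.
  apply/eqP; rewrite -subr_eq0; apply/eqP.
  apply: (@eq0_of_le_halfpow _ (2 * B * E x)) => n.
  have s1 := @picard_map_contracts Y (picard n) i (2 * B / 2 ^+ n) _ cY (@picard_cont n) (fun j z => HY j z n) x.
  have s2 := HY i x n.+1.
  have nn : 0 <= 2 * B / 2 ^+ n by rewrite divr_ge0 ?mulr_ge0 // exprn_ge0.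
  move: (s1 nn) s2; rewrite /= exprSr invfM.
  move: (2 ^+ n)^-1 => q.
  move: (oriented_integral _ x) (oriented_integral _ x) (Y i x) => u v w.
  rewrite !ler_norml => /andP[a1 a2] /andP[a3 a4].
  by apply/andP; split; lra.
exists Y; split.
  move=> i; rewrite -eqY oriented_integral0 addr0 //.
move=> i x; have /funext <- := eqY i.
apply: (der_eq (derD (derC (y0 i) x) (oriented_integral_der (@coef_cont _ i cY) x))).
by rewrite add0r.
Unshelve. all: by end_near. Qed.

End Picard.
End ODE.

(** * Energy estimate, uniqueness and dependence on the coefficients *)

Section Gronwall.
Context {R : realType}.
Variables (I : finType) (L : R).
Hypothesis (L0 : 0 <= L).
Implicit Types (A : I -> I -> R -> R) (W F : I -> R -> R).

Let c : R := 2 * (#|I|%:R * L) + 1.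

(** The energy E, the sum of the squares of the W i, satisfies E' <= c E +
    #|I| eps^2 on [0, X], which makes E x expR (- c x) - #|I| eps^2 x
    nonincreasing. *)
Lemma gronwall A W F (eps X : R) :
  (forall i j x, `|A i j x| <= L) ->
  (forall i (x : R), is_derive x 1 (W i) (\sum_j A i j x * W j x + F i x)) ->
  (forall i, W i 0 = 0) ->
  (forall i x, 0 <= x <= X -> `|F i x| <= eps) ->
  forall i x, 0 <= x <= X ->
    W i x ^+ 2 <= eps ^+ 2 * (#|I|%:R * X * expR (c * X)).
Proof.
move=> AL dW W0 FE i x /andP[x0 xX].
have c0 : 0 <= c by rewrite /c addr_ge0 // !mulr_ge0.
pose E y := \sum_i W i y ^+ 2.
pose E' y := \sum_i 2 * W i y * (\sum_j A i j y * W j y + F i y).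
have dE (y : R) : is_derive y 1 E (E' y).
  apply: (@der_sum _ _ (fun i y => W i y ^+ 2)
    (fun i y => 2 * W i y * (\sum_j A i j y * W j y + F i y))) => k.
  by apply: (der_eq (derX 2 (dW k y))); rewrite expr1.
have bE y : 0 <= y <= X -> E' y <= c * E y + #|I|%:R * eps ^+ 2.
  move=> yX.
  have b1 k : 2 * W k y * (\sum_j A k j y * W j y + F k y) <=
      \sum_j L * (W k y ^+ 2 + W j y ^+ 2) + (W k y ^+ 2 + eps ^+ 2).
    rewrite mulrDr; apply: lerD; last first.
      have h1 : F k y ^+ 2 <= eps ^+ 2.
        rewrite -[F k y ^+ 2]real_normK ?num_real // lerXn2r ?nnegrE ?FE //.
        exact: le_trans (FE k y yX).
      have := sqr_ge0 (W k y - F k y); rewrite sqrrB; move: h1.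
      move: (F k y ^+ 2) (W k y ^+ 2) (eps ^+ 2) => u v w.
      by rewrite -mulr_natl mulrA; lra.
    rewrite mulr_sumr; apply: ler_sum => j _.
    have h : `|2 * (W k y * W j y)| <= W k y ^+ 2 + W j y ^+ 2.
      have := sqr_ge0 (W k y - W j y); have := sqr_ge0 (W k y + W j y).
      rewrite sqrrB sqrrD ler_norml -mulr_natl.
      move: (W k y * W j y) (W k y ^+ 2) (W j y ^+ 2) => u v w h1 h2.
      by apply/andP; split; lra.
    have -> : 2 * W k y * (A k j y * W j y) = A k j y * (2 * (W k y * W j y)) by ring.
    apply: le_trans (ler_norm _) _; rewrite normrM.
    by apply: ler_pM.
  apply: le_trans (ler_sum _ (fun k _ => b1 k)) _.
  rewrite big_split /= big_split /= sumr_const.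
  under eq_bigr do rewrite -mulr_sumr big_split /= sumr_const.
  rewrite -mulr_sumr big_split /= sumr_const sumrMnl -/(E y).
  rewrite /c le_eqVlt; apply/orP; left; apply/eqP.
  have nat (z : R) : z *+ #|I| = #|I|%:R * z by rewrite mulr_natl.
  rewrite (nat (E y)) (nat (eps ^+ 2)).
  by move: #|I|%:R => N; ring.
pose H y := E y * expR (- c * y) - #|I|%:R * eps ^+ 2 * y.
have dexp (y : R) : is_derive y 1 (fun y => expR (- c * y)) (- c * expR (- c * y)).
  apply: (der_eq (@der_comp _ expR (fun y => - c * y) y _ _ (is_derive_expR _) (derZ (- c) (derI y)))).
  by rewrite mulr1 mulrC.
have dH (y : R) : is_derive y 1 H ((E' y * expR (- c * y) + E y * (- c * expR (- c * y)))
    - #|I|%:R * eps ^+ 2 * 1).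
  exact: (derB (derM (dE y) (dexp y)) (derZ _ (derI y))).
have E0 y : 0 <= E y by apply: sumr_ge0 => k _; exact: sqr_ge0.
have : - H 0 <= - H x.
  apply: (der_ge0_le (fun y => derN (dH y)) x0) => y /andP[y0 yx].
  have yX : 0 <= y <= X by rewrite y0 (le_trans yx).
  have e1 : expR (- c * y) <= 1.
    by rewrite -expR0 ler_expR mulNr oppr_le0 mulr_ge0.
  have e0 : 0 < expR (- c * y) := expR_gt0 _.
  have N0 : 0 <= #|I|%:R * eps ^+ 2 by rewrite mulr_ge0 ?sqr_ge0.
  move: e1 e0 N0 (bE y yX); move: (expR _) (_ * eps ^+ 2) (E' y) => e N e' e1 e0 N0 b.
  have : (e' - c * E y) * e <= N * e by apply: ler_wpM2r; [exact: ltW | rewrite lerBlDl].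
  have : N * e <= N by rewrite ler_piMr.
  lra.
rewrite /H !mulr0 expR0 mulr1.
have -> : E 0 = 0 by rewrite /E big1 // => k _; rewrite W0 expr0n.
rewrite !subr0 oppr0 oppr_ge0 subr_le0 => h.
have : E x <= #|I|%:R * eps ^+ 2 * x * expR (c * x).
  have -> : E x = E x * expR (- c * x) * expR (c * x).
    by rewrite -mulrA -expRD mulNr addNr expR0 mulr1.
  by rewrite ler_wpM2r ?expR_ge0.
move=> h2; apply: le_trans (le_trans h2 _).
  by rewrite /E (bigD1 i) //= lerDl sumr_ge0 // => k _; exact: sqr_ge0.
have -> : eps ^+ 2 * (#|I|%:R * X * expR (c * X)) = #|I|%:R * eps ^+ 2 * X * expR (c * X) by ring.
have X0 := le_trans x0 xX.
have N0 : 0 <= #|I|%:R * eps ^+ 2 by rewrite mulr_ge0 ?sqr_ge0.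
apply: ler_pM; [exact: mulr_ge0 | exact: expR_ge0 | exact: ler_wpM2l |].
by rewrite ler_expR; apply: ler_wpM2l.
Qed.

(** The energy estimate without forcing, used forwards from x0 (s = 1 in the
    proof) and, after a reflection, backwards (s = -1). *)
Lemma linear_ode_zero A W x0 :
  (forall i j x, `|A i j x| <= L) ->
  (forall i (x : R), is_derive x 1 (W i) (\sum_j A i j x * W j x)) ->
  (forall i, W i x0 = 0) -> forall i x, W i x = 0.
Proof.
move=> AL dW W0.
suff H (s : R) i t : `|s| = 1 -> 0 <= t -> W i (s * t + x0) = 0.
  move=> i x; have [xx|xx] := leP x0 x.
    by have := H 1 i (x - x0); rewrite mul1r subrK; apply; rewrite ?normr1 ?subr_ge0.
  have := H (-1) i (x0 - x); rewrite mulN1r opprB subrK; apply.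
    by rewrite normrN1.
  by rewrite subr_ge0 ltW.
move=> s1 t0.
have h := @gronwall (fun i j t => s * A i j (s * t + x0)) (fun i t => W i (s * t + x0))
  (fun _ _ => 0) 0 t _ _ _ _ i t.
apply/eqP; rewrite -sqrf_eq0; apply/eqP/le_anti.
rewrite sqr_ge0 andbT -[leRHS](mul0r (#|I|%:R * t * expR (c * t))).
rewrite -[X in _ <= X * _](expr0n _ 2); apply: h.
- by move=> k j z; rewrite normrM s1 mul1r.
- move=> k z; apply: (der_eq (der_affine (dW k (s * z + x0)))).
  by rewrite addr0 mulr_sumr; apply: eq_bigr => j _; rewrite mulrA.
- by move=> k; rewrite mulr0 add0r.
- by move=> *; rewrite normr0.
- by rewrite t0 lexx.
Qed.

Let G (X : R) : R := Num.sqrt (#|I|%:R * X * expR (c * X)).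

Lemma gronwall_norm A W F (eps X : R) :
  (forall i j x, `|A i j x| <= L) ->
  (forall i (x : R), is_derive x 1 (W i) (\sum_j A i j x * W j x + F i x)) ->
  (forall i, W i 0 = 0) -> 0 <= eps ->
  (forall i x, 0 <= x <= X -> `|F i x| <= eps) ->
  forall i x, 0 <= x <= X -> `|W i x| <= eps * G X.
Proof.
move=> AL dW W0 eps0 FE i x xX.
have X0 : 0 <= X by case/andP: xX => x0; exact: le_trans.
have g0 : 0 <= #|I|%:R * X * expR (c * X) by rewrite !mulr_ge0 ?expR_ge0.
rewrite -(@ler_pXn2r _ 2) ?nnegrE ?mulr_ge0 ?sqrtr_ge0 //.
rewrite real_normK ?num_real // exprMn sqr_sqrtr //.
exact: (gronwall AL dW W0 FE).
Qed.

Lemma sum_norm_bound (a w : I -> R) d q : 0 <= d -> 0 <= q ->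
  (forall j, `|a j| <= d) -> (forall j, `|w j| <= q) ->
  `|\sum_j a j * w j| <= #|I|%:R * d * q.
Proof.
move=> d0 q0 ad wq; apply: le_trans (ler_norm_sum _ _ _) _.
have -> : #|I|%:R * d * q = \sum_(j : I) d * q.
  by rewrite sumr_const -[(d * q) *+ _]mulr_natl mulrA.
by apply: ler_sum => j _; rewrite normrM ler_pM.
Qed.

Definition lipschitz_const (X : R) : R :=
  #|I|%:R * (1 + #|I|%:R * L * G X) * G X.

(** Y - Y' solves the first system with the forcing (A - A') Y'. A first
    energy estimate, for Y' - Y' 0, bounds Y' on [0, X], and a second one
    bounds Y - Y'. *)
Lemma linear_ode_lipschitz A A' Y Y' (d X : R) :
  (forall i j x, `|A i j x| <= L) -> (forall i j x, `|A' i j x| <= L) ->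
  0 <= d -> (forall i j x, `|A i j x - A' i j x| <= d) ->
  (forall i (x : R), is_derive x 1 (Y i) (\sum_j A i j x * Y j x)) ->
  (forall i (x : R), is_derive x 1 (Y' i) (\sum_j A' i j x * Y' j x)) ->
  (forall i, Y i 0 = Y' i 0) -> (forall i, `|Y i 0| <= 1) ->
  forall i x, 0 <= x <= X -> `|Y i x - Y' i x| <= lipschitz_const X * d.
Proof.
move=> AL AL' d0 Ad dY dY' Y0 Y1 i x xX.
have NL : 0 <= #|I|%:R * L * 1 by rewrite !mulr_ge0.
have G0 : 0 <= G X by exact: sqrtr_ge0.
have Yb j z : 0 <= z <= X -> `|Y' j z| <= 1 + #|I|%:R * L * G X.
  move=> zX; have -> : Y' j z = Y' j 0 + (Y' j z - Y' j 0) by rewrite addrCA subrr addr0.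
  apply: le_trans (ler_normD _ _) _; apply: lerD; first by rewrite -Y0.
  rewrite -[#|I|%:R * L]mulr1.
  apply: (@gronwall_norm A' (fun j z => Y' j z - Y' j 0)
     (fun k z => \sum_j A' k j z * Y' j 0) _ X AL' _ _ NL _ j z zX).
  - move=> k t; apply: (der_eq (derB (dY' k t) (derC (Y' k 0) t))).
    rewrite subr0 -big_split /=; apply: eq_bigr => l _; ring.
  - by move=> k; rewrite subrr.
  - move=> k t _; apply: sum_norm_bound => // l; by rewrite -Y0.
have Q0 : 0 <= 1 + #|I|%:R * L * G X by rewrite addr_ge0 ?mulr_ge0.
have -> : lipschitz_const X * d = #|I|%:R * d * (1 + #|I|%:R * L * G X) * G X.
  by rewrite /lipschitz_const; ring.
apply: (@gronwall_norm A (fun j z => Y j z - Y' j z)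
     (fun k z => \sum_j (A k j z - A' k j z) * Y' j z) _ X AL _ _ _ _ i x xX).
- move=> k t; apply: (der_eq (derB (dY k t) (dY' k t))).
  rewrite -big_split -sumrB /=; apply: eq_bigr => l _; ring.
- by move=> k; rewrite Y0 subrr.
- by rewrite !mulr_ge0.
- by move=> k t tX; apply: sum_norm_bound => // l; exact: Yb.
Qed.

End Gronwall.

(** * The shooting problem *)

Section Shooting.
Context {R : realType}.

Lemma sum_bool2 (F : bool * bool -> R) : \sum_i F i =
  F (true, true) + F (true, false) + (F (false, true) + F (false, false)).
Proof.
rewrite (eq_bigr (fun p => F (p.1, p.2))); last by case.
by rewrite -(pair_bigA _ (fun i j => F (i, j))) /= big_bool /= !big_bool.
Qed.

Lemma locally_lipschitz_cont (f : R -> R) :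
  (forall P : R, exists K, forall a b, `|a| <= P -> `|b| <= P -> `|f a - f b| <= K * `|a - b|) ->
  continuous f.
Proof.
move=> H x; apply/cvgrPdist_lt => e e0.
have [K HK] := H (`|x| + 1).
pose K' := `|K| + 1.
have K0 : 0 < K' by rewrite /K' ltr_wpDl.
have d0 : 0 < Num.min 1 (e / K') by rewrite lt_min ltr01 divr_gt0.
near=> y.
have : `|x - y| < Num.min 1 (e / K') by near: y; exact: (@nbhsx_ballx _ _ (x : R) _ d0).
rewrite lt_min => /andP[xy1 xye].
have xx : `|x| <= `|x| + 1 by rewrite lerDl.
have yx : `|y| <= `|x| + 1.
  have -> : y = x - (x - y) by rewrite subKr.
  by rewrite (le_trans (ler_normB _ _))// lerD2l ltW.
apply: le_lt_trans (HK x y xx yx) _.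
apply: (@le_lt_trans _ _ (K' * `|x - y|)).
  by rewrite ler_wpM2r // (le_trans (ler_norm K)) // lerDl.
by rewrite mulrC -ltr_pdivlMr.
Unshelve. all: by end_near. Qed.

Variables (Vm Vp : R -> R) (M : R).
Hypotheses (Vm_cont : continuous Vm) (Vp_cont : continuous Vp).
Hypotheses (M0 : 0 <= M) (Vm_bnd : forall x, `|Vm x| <= M) (Vp_bnd : forall x, `|Vp x| <= M).

Local Notation I := (bool * bool)%type.

(** The index (b, true) stands for the value and (b, false) for the
    derivative of v1 when b = true and of v2 when b = false. *)
Definition coef (lam mu : R) (i j : I) (x : R) : R :=
  match i, j with
  | (b, true), (b', false) => (b == b')%:R
  | (true, false), (true, true) => Vm x + mu
  | (true, false), (false, true) => - lam
  | (false, false), (false, true) => Vp x + mu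
  | (false, false), (true, true) => lam
  | _, _ => 0
  end.

(** The equations v1'' = (Vm + mu) v1 - lam v2 and v2'' = (Vp + mu) v2 + lam
    v1: they say that (v1 cos (q y), v2 cos (q y)), with q^2 = mu, is an
    eigenvector of the linearization for the eigenvalue lam. *)
Definition system (lam mu : R) (Y : I -> R -> R) := forall i (x : R),
  is_derive x 1 (Y i) (\sum_j coef lam mu i j x * Y j x).

Lemma systemP lam mu Y : system lam mu Y <->
  forall x : R, [/\ is_derive x 1 (Y (true, true)) (Y (true, false) x),
    is_derive x 1 (Y (true, false)) ((Vm x + mu) * Y (true, true) x - lam * Y (false, true) x),
    is_derive x 1 (Y (false, true)) (Y (false, false) x) &
    is_derive x 1 (Y (false, false)) ((Vp x + mu) * Y (false, true) x + lam * Y (true, true) x)].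
Proof.
split=> [H x|H [[] []] x].
- split.
  + by apply: (der_eq (H (true, true) x)); rewrite sum_bool2 /=; ring.
  + by apply: (der_eq (H (true, false) x)); rewrite sum_bool2 /=; ring.
  + by apply: (der_eq (H (false, true) x)); rewrite sum_bool2 /=; ring.
  + by apply: (der_eq (H (false, false) x)); rewrite sum_bool2 /=; ring.
- by have [h _ _ _] := H x; apply: (der_eq h); rewrite sum_bool2 /=; ring.
- by have [_ h _ _] := H x; apply: (der_eq h); rewrite sum_bool2 /=; ring.
- by have [_ _ h _] := H x; apply: (der_eq h); rewrite sum_bool2 /=; ring.
- by have [_ _ _ h] := H x; apply: (der_eq h); rewrite sum_bool2 /=; ring.
Qed.

Definition coef_bound (P : R) : R := M + P + 1.

Lemma coef_bounded lam mu P i j x : `|lam| <= P -> `|mu| <= P ->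
  `|coef lam mu i j x| <= coef_bound P.
Proof.
move=> lP mP; have P0 : 0 <= P by apply: le_trans lP.
have M0' := M0.
have m1 := Vm_bnd x; have p1 := Vp_bnd x.
have n1 := ler_normD (Vm x) mu; have n2 := ler_normD (Vp x) mu.
case: i j => [[] []] [[] []]; rewrite /coef_bound /= ?normrN ?normr0 ?normr1; lra.
Qed.

Lemma coef_bound_ge0 P : 0 <= P -> 0 <= coef_bound P.
Proof. by rewrite /coef_bound; move: M0; lra. Qed.

Lemma coef_continuous lam mu i j : continuous (coef lam mu i j).
Proof.
case: i j => [[] []] [[] []] x; try exact: cvg_cst.
  by apply: cvgD; [exact: Vm_cont|exact: cvg_cst].
by apply: cvgD; [exact: Vp_cont|exact: cvg_cst].
Qed.

Lemma coef_diff_bound lam mu lam' mu' i j x :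
  `|coef lam mu i j x - coef lam' mu' i j x| <= `|lam - lam'| + `|mu - mu'|.
Proof.
have h1 : 0 <= `|lam - lam'| by []. have h2 : 0 <= `|mu - mu'| by [].
have h3 : `|lam - lam'| = `|lam' - lam| := distrC _ _.
case: i j => [[] []] [[] []]; rewrite /= ?subrr ?normr0 ?addr_ge0 //;
  rewrite ?opprK ?[Vm x + mu]addrC ?[Vp x + mu]addrC ?opprD ?addrA ?addrNK ?subrK.
all: rewrite ?[- lam + lam']addrC; try lra.
all: rewrite addrAC (_ : _ - _ = mu - mu'); [lra | ring].
Qed.

Lemma system_exists lam mu (y0 : I -> R) :
  exists Y, (forall i, Y i 0 = y0 i) /\ system lam mu Y.
Proof.
pose P := Num.max `|lam| `|mu|.
have lP : `|lam| <= P by rewrite le_max lexx.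
have mP : `|mu| <= P by rewrite le_max lexx orbT.
apply: (@linear_ode_exists _ _ (coef lam mu) (coef_bound P)).
- exact: coef_continuous.
- by apply: coef_bound_ge0; apply: le_trans lP.
- by move=> i j x; exact: coef_bounded.
Qed.

Lemma system_zero lam mu Y x0 : system lam mu Y -> (forall i, Y i x0 = 0) ->
  forall i x, Y i x = 0.
Proof.
pose P := Num.max `|lam| `|mu|.
have lP : `|lam| <= P by rewrite le_max lexx.
have mP : `|mu| <= P by rewrite le_max lexx orbT.
move=> sY Y0; apply: (@linear_ode_zero _ _ (coef_bound P) _ (coef lam mu) Y x0) => //.
  by apply: coef_bound_ge0; apply: le_trans lP.
by move=> i j x; exact: coef_bounded.
Qed.

Lemma system_lin lam mu Y Z a b : system lam mu Y -> system lam mu Z ->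
  system lam mu (fun i x => a * Y i x + b * Z i x).
Proof.
move=> sY sZ i x; apply: (der_eq (derD (derZ a (sY i x)) (derZ b (sZ i x)))).
rewrite !mulr_sumr -big_split /=; apply: eq_bigr => j _; ring.
Qed.

Lemma system_unique lam mu Y Z x0 : system lam mu Y -> system lam mu Z ->
  (forall i, Y i x0 = Z i x0) -> forall i x, Y i x = Z i x.
Proof.
move=> sY sZ YZ i x.
have := system_zero (x0 := x0) (system_lin 1 (-1) sY sZ) _ i x.
move=> /(_ _)/wrap[]; first by move=> j; rewrite YZ; ring.
by move=> H; apply/eqP; rewrite -subr_eq0; apply/eqP; rewrite -[RHS]H; ring.
Qed.

Definition flip (i : I) : R := if i.2 then 1 else -1.

Lemma system_reflect lam mu Y s : (forall x, Vm (s - x) = Vm x) ->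
  (forall x, Vp (s - x) = Vp x) ->
  system lam mu Y -> system lam mu (fun i x => flip i * Y i (s - x)).
Proof.
move=> es ep sY; apply/systemP => x.
have [h1 h2 h3 h4] := (systemP lam mu Y).1 sY (s - x).
have H (f : R -> R) (a : R) : is_derive (s - x) 1 f a -> is_derive x 1 (fun y => f (s - y)) (- a).
  move=> fa; apply: (der_eq (der_comp (g := fun y => s - y) fa (derB (derC s x) (derI x)))).
  by rewrite sub0r mulrN1.
rewrite /flip /=; split.
- by apply: (der_eq (derZ 1 (H _ _ h1))); ring.
- by apply: (der_eq (derZ (-1) (H _ _ h2))); rewrite es; ring.
- by apply: (der_eq (derZ 1 (H _ _ h3))); ring.
- by apply: (der_eq (derZ (-1) (H _ _ h4))); rewrite ep; ring.
Qed.

(** The reflection of a solution at a common symmetry point of the potentials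
    is a solution; both have the same data there when the derivatives vanish.
    Being symmetric about 0 and about h makes a solution 2h-periodic. *)
Lemma system_symmetric lam mu Y s : (forall x, Vm (s - x) = Vm x) ->
  (forall x, Vp (s - x) = Vp x) ->
  system lam mu Y -> (forall b, Y (b, false) (s / 2) = 0) ->
  forall i x, Y i (s - x) = flip i * Y i x.
Proof.
move=> es ep sY Y0 i x.
have E : s - s / 2 = s / 2 by field.
rewrite (@system_unique lam mu Y _ (s / 2) sY (system_reflect es ep sY)).
  by rewrite opprB addrCA subrr addr0.
by case=> [b []]; rewrite /flip /= E ?mul1r // Y0 mulr0.
Qed.

(** A basis of the solutions whose derivatives vanish at 0: the value of
    component k starts at 1 and the other at 0. *)
Definition basis_solution (lam mu : R) (k : bool) : I -> R -> R :=
  projT1 (cid (system_exists lam mu (fun i => (i == (k, true))%:R))).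

Lemma basis_solution0 lam mu k i : basis_solution lam mu k i 0 = (i == (k, true))%:R.
Proof. by rewrite /basis_solution; case: cid => Y [/= -> _]. Qed.

Lemma basis_solution_system lam mu k : system lam mu (basis_solution lam mu k).
Proof. by rewrite /basis_solution; case: cid => Y []. Qed.

Lemma basis_solution_lipschitz P X : 0 <= P -> exists K, 0 <= K /\ forall k i x lam mu lam' mu',
  `|lam| <= P -> `|mu| <= P -> `|lam'| <= P -> `|mu'| <= P -> 0 <= x <= X ->
  `|basis_solution lam mu k i x - basis_solution lam' mu' k i x| <=
    K * (`|lam - lam'| + `|mu - mu'|).
Proof.
move=> P0; exists `|lipschitz_const (I : finType) (coef_bound P) X|; split=> //.
move=> k i x lam mu lam' mu' h1 h2 h3 h4 xX.
apply: (@le_trans _ _ (lipschitz_const (I : finType) (coef_bound P) X * (`|lam - lam'| + `|mu - mu'|))).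
  apply: (@linear_ode_lipschitz _ _ (coef_bound P) (coef_bound_ge0 P0) (coef lam mu) (coef lam' mu')).
  - by move=> *; exact: coef_bounded.
  - by move=> *; exact: coef_bounded.
  - by rewrite addr_ge0.
  - by move=> *; exact: coef_diff_bound.
  - exact: basis_solution_system.
  - exact: basis_solution_system.
  - by move=> j; rewrite !basis_solution0.
  - by move=> j; rewrite basis_solution0; case: eqP; rewrite ?normr1 ?normr0.
  - exact: xX.
by rewrite ler_wpM2r ?addr_ge0 // ler_norm.
Qed.

Lemma basis_solution_cont_mu lam k i x : 0 <= x ->
  continuous (fun mu => basis_solution lam mu k i x).
Proof.
move=> x0; apply: locally_lipschitz_cont => P.
have [K [_ HK]] := @basis_solution_lipschitz (`|lam| + `|P|) x (addr_ge0 (normr_ge0 _) (normr_ge0 _)).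
exists K => a b aP bP; have := HK k i x lam a lam b.
have lamP : `|lam| <= `|lam| + `|P| by rewrite lerDl.
have bnd z : `|z| <= P -> `|z| <= `|lam| + `|P|.
  by move=> zP; apply: le_trans zP _; rewrite (le_trans (ler_norm P)) // lerDr.
by rewrite subrr normr0 add0r; apply => //; rewrite ?x0 ?lexx ?bnd.
Qed.

Lemma basis_solution_cont_lam mu k i x : 0 <= x ->
  continuous (fun lam => basis_solution lam mu k i x).
Proof.
move=> x0; apply: locally_lipschitz_cont => P.
have [K [_ HK]] := @basis_solution_lipschitz (`|mu| + `|P|) x (addr_ge0 (normr_ge0 _) (normr_ge0 _)).
exists K => a b aP bP; have := HK k i x a mu b mu.
have lamP : `|mu| <= `|mu| + `|P| by rewrite lerDl.
have bnd z : `|z| <= P -> `|z| <= `|mu| + `|P|.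
  by move=> zP; apply: le_trans zP _; rewrite (le_trans (ler_norm P)) // lerDr.
by rewrite subrr normr0 addr0; apply => //; rewrite ?x0 ?lexx ?bnd.
Qed.

(** The component that starts at 0 solves a homogeneous scalar equation, as
    the coupling carries the factor lam = 0. *)
Lemma decoupled mu k b x : basis_solution 0 mu k (~~ k, b) x = 0.
Proof.
pose Y := basis_solution 0 mu k.
pose Z (i : I) x : R := if i.1 == k then 0 else Y i x.
have sZ : system 0 mu Z.
  apply/systemP => z; have [h1 h2 h3 h4] := (systemP 0 mu Y).1 (basis_solution_system 0 mu k) z.
  rewrite /Z; case: (k) => /=; split; try by apply: (der_eq (derC 0 z)); rewrite ?mulr0 ?mul0r ?subrr ?addr0.
  - exact: h3.
  - by apply: (der_eq h4); rewrite !mul0r.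
  - exact: h1.
  - by apply: (der_eq h2); rewrite !mul0r.
have Zx : Z (~~ k, b) x = 0.
  apply: (system_zero (x0 := 0) sZ) => -[a b']; rewrite /Z /Y /= basis_solution0.
  by case: eqVneq => // ak; rewrite xpair_eqE (negbTE ak).
by move: Zx; rewrite /Z /Y; case: (k).
Qed.

Variables (h : R).
Hypothesis h0 : 0 < h.

Section PlusOperator.
Variables (p p' : R -> R).
Hypotheses (p_gt0 : forall x, 0 < p x) (dp : forall x : R, is_derive x 1 p (p' x)).
Hypothesis (dp' : forall x : R, is_derive x 1 p' (Vp x * p x)).
Hypotheses (p'0 : p' 0 = 0) (p'h : p' h = 0).

(** With u = v2, w = u' and q = p' / p, the function u w - u^2 q vanishes at
    0, and its derivative (w - u q)^2 + mu u^2 is positive because u and w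
    have no common zero. So it is positive at h, where q = 0. *)
Lemma plus_shooting_neq0 mu : 0 < mu -> basis_solution 0 mu false (false, false) h != 0.
Proof.
move=> mu0; pose Y := basis_solution 0 mu false.
have sY : system 0 mu Y := basis_solution_system 0 mu false.
have dY z := (systemP 0 mu Y).1 sY z.
pose u := Y (false, true); pose w := Y (false, false).
pose q x := p' x * (p x)^-1.
have dq (x : R) : is_derive x 1 q (Vp x - q x ^+ 2).
  have pn : p x != 0 by rewrite gt_eqF.
  apply: (der_eq (derM (dp' x) (is_deriveV pn (dp x)))).
  rewrite /q /GRing.scale /=; field.
  by rewrite pn.
pose Q x := u x * w x - u x ^+ 2 * q x.
have dQ (x : R) : is_derive x 1 Q ((w x - u x * q x) ^+ 2 + mu * u x ^+ 2).
  have [_ _ du dw] := dY x.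
  apply: (der_eq (derB (derM du dw) (derM (derX 2 du) (dq x)))).
  by rewrite -/(u x) -/(w x) mul0r; ring.
have Q'0 x : 0 < (w x - u x * q x) ^+ 2 + mu * u x ^+ 2.
  have h1 : 0 <= mu * u x ^+ 2 by rewrite mulr_ge0 ?sqr_ge0 // ltW.
  rewrite lt_def addr_ge0 ?sqr_ge0 // andbT.
  rewrite paddr_eq0 ?sqr_ge0 //.
  apply/negP => /andP[e1]; rewrite mulf_eq0 (gt_eqF mu0) /= sqrf_eq0 => /eqP e2.
  move: e1; rewrite e2 mul0r subr0 sqrf_eq0 => /eqP e1.
  suff : Y (false, true) 0 = 0.
    by rewrite /Y basis_solution0 eqxx => /eqP; rewrite oner_eq0.
  apply: (system_zero (x0 := x) sY); case=> [[] []] //; exact: (@decoupled mu false).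
have : Q 0 < Q h by apply: (der_gt0_lt dQ h0).
rewrite /Q /q p'0 p'h !mul0r !mulr0 !subr0.
have -> : w 0 = 0 by rewrite /w /Y basis_solution0.
rewrite mulr0; apply: contraTN => /eqP wh; have -> : w h = 0 := wh.
by rewrite mulr0 ltxx.
Qed.

End PlusOperator.

Section MinusOperator.
Variables (chi chi' : R -> R) (nu2 m : R).
Hypotheses (m0 : 0 < m) (chi_ge : forall x, m <= chi x).
Hypothesis (dchi : forall x : R, is_derive x 1 chi (chi' x)).
Hypothesis (dchi' : forall x : R, is_derive x 1 chi' ((Vm x + nu2) * chi x)).
Hypotheses (chi'0 : chi' 0 = 0) (chi'h : chi' h = 0).

Let chi_gt0 x : 0 < chi x. Proof. exact: lt_le_trans m0 (chi_ge x). Qed.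

Lemma ground_state_basis x : basis_solution 0 nu2 true (true, true) x = chi x / chi 0.
Proof.
pose Z (i : I) x : R := match i with
  | (true, true) => (chi 0)^-1 * chi x | (true, false) => (chi 0)^-1 * chi' x | _ => 0 end.
have sZ : system 0 nu2 Z.
  apply/systemP => z; rewrite /Z /=; split.
  - exact: derZ.
  - by apply: (der_eq (derZ (chi 0)^-1 (dchi' z))); ring.
  - exact: derC.
  - by apply: (der_eq (derC 0 z)); ring.
rewrite (system_unique (x0 := 0) (basis_solution_system 0 nu2 true) sZ) /Z.
  by rewrite mulrC.
case=> [[] []]; rewrite basis_solution0 //=.
  by rewrite mulVf // gt_eqF.
by rewrite chi'0 mulr0.
Qed.

(** At mu = nu2 the basis solution is chi / chi 0, bounded below by a
    positive constant, so for mu near nu2 it is still positive on [0, h].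
    Hence the Wronskian u' chi - u chi', which vanishes at 0 and has the
    derivative (mu - nu2) u chi, has the sign of mu - nu2 at h. *)
Lemma minus_shooting_sign : exists2 e, 0 < e & forall mu, 0 < `|mu - nu2| < e ->
  0 < (mu - nu2) * basis_solution 0 mu true (true, false) h.
Proof.
pose P := `|nu2| + 1.
have P0 : 0 <= P by rewrite addr_ge0.
have [K [K0 HK]] := @basis_solution_lipschitz P h P0.
pose d := m / chi 0 / (K + 1).
have d0 : 0 < d by rewrite !divr_gt0 // ltr_wpDl.
exists (Num.min 1 d); first by rewrite lt_min ltr01.
move=> mu /andP[mun]; rewrite lt_min => /andP[mu1 mud].
pose Y := basis_solution 0 mu true.
have sY : system 0 mu Y := basis_solution_system 0 mu true.
have u_gt0 x : 0 <= x <= h -> 0 < Y (true, true) x.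
  move=> xh.
  have := HK true (true, true) x 0 mu 0 nu2; rewrite subrr normr0 add0r => /(_ P0 _ P0 _ xh).
  move=> /(_ _)/wrap[].
    by rewrite -[mu](subrK nu2) (le_trans (ler_normD _ _)) // addrC lerD2l ltW.
  move=> /(_ _)/wrap[]; first by rewrite /P lerDl.
  rewrite ground_state_basis -/(Y _ x) ler_norml => /andP[+ _].
  have : m / chi 0 <= chi x / chi 0 by rewrite ler_wpM2r // invr_ge0 ltW.
  have : K * `|mu - nu2| < m / chi 0.
    apply: (@le_lt_trans _ _ ((K + 1) * `|mu - nu2|)).
      by rewrite ler_wpM2r // lerDl.
    by rewrite mulrC -ltr_pdivlMr // ltr_wpDl.
  lra.
pose W x := Y (true, false) x * chi x - Y (true, true) x * chi' x.
have dW (x : R) : is_derive x 1 W ((mu - nu2) * (Y (true, true) x * chi x)).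
  have [h1 h2 _ _] := (systemP 0 mu Y).1 sY x.
  by apply: (der_eq (derB (derM h2 (dchi x)) (derM h1 (dchi' x)))); ring.
have W0 : W 0 = 0 by rewrite /W /Y !basis_solution0 /= chi'0 mul0r mulr0 subrr.
have Wh : W h = Y (true, false) h * chi h by rewrite /W chi'h mulr0 subr0.
have : (mu - nu2) * W 0 < (mu - nu2) * W h.
  apply: (der_gt0_lt (fun x => derZ (mu - nu2) (dW x)) h0) => x /andP[x0 xh].
  rewrite mulrA -expr2; apply: mulr_gt0.
    by rewrite -[_ ^+ 2]real_normK ?num_real // exprn_gt0.
  by rewrite mulr_gt0 // u_gt0 // !ltW.
by rewrite W0 mulr0 Wh mulrA pmulr_lgt0.
Qed.

End MinusOperator.

(** It vanishes when a nonzero combination of the basis solutions has both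
    derivatives equal to 0 at h. *)
Definition shooting_det lam mu : R :=
  basis_solution lam mu true (true, false) h * basis_solution lam mu false (false, false) h
  - basis_solution lam mu false (true, false) h * basis_solution lam mu true (false, false) h.

Lemma shooting_det0 mu : shooting_det 0 mu =
  basis_solution 0 mu true (true, false) h * basis_solution 0 mu false (false, false) h.
Proof. by rewrite /shooting_det (@decoupled mu true) mulr0 subr0. Qed.

Lemma shooting_det_cont_mu lam : continuous (shooting_det lam).
Proof.
by move=> mu; apply: cvgB; apply: cvgM; apply: basis_solution_cont_mu; exact: ltW.
Qed.

Lemma shooting_det_cont_lam mu : continuous (fun lam => shooting_det lam mu).
Proof.
by move=> lam; apply: cvgB; apply: cvgM; apply: (@basis_solution_cont_lam mu); exact: ltW.
Qed.

Lemma det2_kernel (a b c d : R) : a * d - b * c = 0 ->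
  exists s t, [/\ (s != 0) || (t != 0), s * a + t * b = 0 & s * c + t * d = 0].
Proof.
move=> H; have [a0|a0] := eqVneq a 0; last first.
  by exists (- b), a; rewrite a0 orbT; split=> //; [ring | rewrite -[RHS]H; ring].
have [b0|b0] := eqVneq b 0; last first.
  by exists (- b), a; rewrite oppr_eq0 b0; split=> //; [ring | rewrite -[RHS]H; ring].
have [d0|d0] := eqVneq d 0; last first.
  by exists (- d), c; rewrite oppr_eq0 d0 a0 b0; split=> //; ring.
have [c0|c0] := eqVneq c 0; last first.
  by exists (- d), c; rewrite c0 orbT a0 b0; split=> //; ring.
by exists 1, 0; rewrite oner_eq0 a0 c0; split=> //; ring.
Qed.

(** For lam = 0 the determinant is the product of the scalar shooting
    functions of the two operators; the first changes sign at mu = nu2 and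
    the second does not vanish. By continuity the change of sign between mu1
    < nu2 < mu2 persists for some lam > 0, and the intermediate value theorem
    in mu, for this lam, yields a zero. *)
Theorem shooting (p p' chi chi' : R -> R) (nu2 m : R) :
  (forall x, Vm (- x) = Vm x) -> (forall x, Vm (2 * h - x) = Vm x) ->
  (forall x, Vp (- x) = Vp x) -> (forall x, Vp (2 * h - x) = Vp x) ->
  (forall x, 0 < p x) -> (forall x : R, is_derive x 1 p (p' x)) ->
  (forall x : R, is_derive x 1 p' (Vp x * p x)) -> p' 0 = 0 -> p' h = 0 ->
  0 < m -> (forall x, m <= chi x) -> (forall x : R, is_derive x 1 chi (chi' x)) ->
  0 < nu2 -> (forall x : R, is_derive x 1 chi' ((Vm x + nu2) * chi x)) ->
  chi' 0 = 0 -> chi' h = 0 ->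
  exists lam mu (Y : I -> R -> R), [/\ 0 < lam, 0 < mu, system lam mu Y,
    forall i x, Y i (x + 2 * h) = Y i x & exists b, Y (b, true) 0 != 0].
Proof.
move=> Vme Vmh Vpe Vph p_gt0 dp dp' p'0 p'h m0 chi_ge dchi nu0 dchi' chi'0 chi'h.
have Dp_neq0 := plus_shooting_neq0 p_gt0 dp dp' p'0 p'h.
have [e e0 He] := minus_shooting_sign m0 chi_ge dchi dchi' chi'0 chi'h.
have [mu1 [mu2 [mu1_gt0 mu12 D12]]] : exists mu1 mu2,
    [/\ 0 < mu1, mu1 <= mu2 & shooting_det 0 mu1 * shooting_det 0 mu2 < 0].
  pose r := basis_solution 0 nu2 false (false, false) h.
  have r0 : 0 < `|r| by rewrite normr_gt0; exact: Dp_neq0.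
  have /cvgrPdist_lt/(_ _ r0) := @basis_solution_cont_mu 0 false (false, false) h (ltW h0) nu2.
  rewrite -/r => /nbhs_ballP[e' /= e'0 He'].
  pose t := Num.min (Num.min e e') nu2 / 2.
  have t0 : 0 < t by rewrite /t divr_gt0 // !lt_min e0 e'0 nu0.
  have [te [te' tn]] : t < e /\ t < e' /\ t < nu2.
    have : t * 2 <= Num.min (Num.min e e') nu2 by rewrite /t divfK.
    by rewrite !le_min => /andP[/andP[]]; move: t0; lra.
  have sgn mu : `|mu - nu2| = t -> 0 < r * basis_solution 0 mu false (false, false) h.
    move=> mt; have := He' mu; rewrite /ball /= distrC mt => /(_ te').
    move: (basis_solution _ _ _ _ _) => s.
    have [r1|r1] := ltP 0 r.
      by rewrite (gtr0_norm r1) ltr_norml => /andP[? ?]; rewrite mulr_gt0 //; lra.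
    have r2 : r < 0 by rewrite lt_neqAle r1 andbT -normr_gt0.
    by rewrite (ltr0_norm r2) ltr_norml => /andP[? ?]; rewrite nmulr_rgt0 //; lra.
  exists (nu2 - t), (nu2 + t); split; [lra|lra|].
  have n1 : `|nu2 - t - nu2| = t by rewrite addrAC subrr sub0r normrN gtr0_norm.
  have n2 : `|nu2 + t - nu2| = t by rewrite addrAC subrr add0r gtr0_norm.
  have := He (nu2 - t); have := He (nu2 + t); rewrite n1 n2 t0 te => /(_ isT) s2 /(_ isT) s1.
  have := sgn _ n2; have := sgn _ n1.
  have rr : 0 < r ^+ 2 by rewrite -[_ ^+ 2]real_normK ?num_real // exprn_gt0.
  rewrite !shooting_det0; move: s1 s2.
  rewrite (_ : nu2 - t - nu2 = - t); last ring.
  rewrite (_ : nu2 + t - nu2 = t); last ring.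
  move: (basis_solution 0 (nu2 - t) true _ h) => a1.
  move: (basis_solution 0 (nu2 + t) true _ h) => a2.
  move: (basis_solution 0 (nu2 - t) false _ h) => b1.
  move: (basis_solution 0 (nu2 + t) false _ h) => b2.
  rewrite mulNr oppr_gt0 (pmulr_rlt0 _ t0) (pmulr_rgt0 _ t0) => A1 A2 B1 B2.
  have : 0 < (r * b1) * (r * b2) by rewrite mulr_gt0.
  rewrite mulrACA -expr2 (pmulr_rgt0 _ rr) => B.
  by rewrite mulrACA nmulr_rlt0 // nmulr_rlt0.
have [lam lam0 Dlam] : exists2 lam, 0 < lam & shooting_det lam mu1 * shooting_det lam mu2 < 0.
  have : (shooting_det l mu1 * shooting_det l mu2) @[l --> (0 : R)] -->
      shooting_det 0 mu1 * shooting_det 0 mu2.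
    by apply: cvgM; [exact: (@shooting_det_cont_lam mu1)|exact: (@shooting_det_cont_lam mu2)].
  move=> /cvgrPdist_lt/(_ (- (shooting_det 0 mu1 * shooting_det 0 mu2))).
  rewrite oppr_gt0 => /(_ D12)/nbhs_ballP[e' /= e'0 He'].
  exists (e' / 2); first by rewrite divr_gt0.
  have := He' (e' / 2); rewrite /ball /= sub0r normrN gtr0_norm ?divr_gt0 //.
  move=> /(_ _)/wrap[]; first by rewrite ltr_pdivrMr // ltr_pMr // ltr1n.
  rewrite ltr_norml; lra.
have [mu muI Dmu] : exists2 mu, mu \in `[mu1, mu2] & shooting_det lam mu = 0.
  apply: IVT => //.
    by apply: continuous_subspaceT; exact: shooting_det_cont_mu.
  rewrite ge_min le_max; move: Dlam; have [D1|D1] := leP (shooting_det lam mu1) 0.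
    move=> D2 /=; rewrite leNgt; apply/orP; right.
    by rewrite leNgt; apply: contraTN D2 => D2; rewrite -leNgt mulr_le0 // ltW.
  by rewrite pmulr_rlt0 // => D2; rewrite (ltW D1) (ltW D2).
have mu0 : 0 < mu by move: muI; rewrite in_itv /= => /andP[+ _]; exact: lt_le_trans.
have [s [t [st0 e1 e2]]] := det2_kernel Dmu.
pose Y i x := s * basis_solution lam mu true i x + t * basis_solution lam mu false i x.
have sY : system lam mu Y.
  by apply: system_lin; exact: basis_solution_system.
exists lam, mu, Y; split => //.
  move=> i x.
  have Yh b : Y (b, false) (2 * h / 2) = 0.
    have -> : 2 * h / 2 = h by field.
    by case: b.
  have Y0 b : Y (b, false) (0 / 2) = 0.
    by rewrite mul0r /Y !basis_solution0 /=; case: b; rewrite /= !mulr0 addr0.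
  have S1 := system_symmetric Vmh Vph sY Yh.
  have S2 := @system_symmetric lam mu Y 0 _ _ sY Y0.
  have -> : x + 2 * h = 2 * h - - x by rewrite opprK addrC.
  rewrite S1 -[- x]sub0r S2.
  - by rewrite /flip; case: (i.2); rewrite mulrA ?mulr1 ?mulrNN ?mulr1 mul1r.
  - by move=> z; rewrite sub0r.
  - by move=> z; rewrite sub0r.
case/orP: st0 => n0; [exists true | exists false];
  by rewrite /Y !basis_solution0 /= mulr1 mulr0 ?addr0 ?add0r.
Qed.

End Shooting.

(** * Jacobi elliptic functions *)

Section Jacobi.
Context {R : realType}.
Variable k : R.
Hypotheses (k0 : 0 < k) (k1 : k < 1).
Implicit Types x y u p z : R.

Let k2_lt1 : k ^+ 2 < 1. Proof. by rewrite expr_lt1 // ltW. Qed.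

Lemma sin2_le1 x : sin x ^+ 2 <= 1.
Proof. by rewrite -[1](cos2Dsin2 x) lerDr sqr_ge0. Qed.

Lemma modulus_gt0 z : z ^+ 2 <= 1 -> 0 < 1 - k ^+ 2 * z ^+ 2.
Proof.
move=> z1; rewrite subr_gt0; apply: le_lt_trans k2_lt1.
by rewrite ler_piMr // sqr_ge0.
Qed.

Let g t : R := (Num.sqrt (1 - k ^+ 2 * sin t ^+ 2))^-1.

Lemma dn_arg_gt0 t : 0 < 1 - k ^+ 2 * sin t ^+ 2.
Proof. exact: modulus_gt0 (sin2_le1 t). Qed.

Lemma ellipticF_integrand_gt0 t : 0 < g t.
Proof. by rewrite invr_gt0 sqrtr_gt0 dn_arg_gt0. Qed.

Lemma ellipticF_integrand_ge1 t : 1 <= g t.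
Proof.
rewrite -[leLHS]invr1 lef_pV2 ?posrE ?sqrtr_gt0 ?dn_arg_gt0 //.
rewrite -[leRHS]sqrtr1 ler_sqrt // gerBl mulr_ge0 ?sqr_ge0 //.
Qed.

Lemma ellipticF_integrand_cont : continuous g.
Proof.
move=> t; apply: cvgV; first by rewrite gt_eqF // sqrtr_gt0 dn_arg_gt0.
apply: (@continuous_comp _ _ _ (fun t => 1 - k ^+ 2 * sin t ^+ 2) Num.sqrt); last exact: sqrt_continuous.
apply: cvgB; first exact: cvg_cst.
apply: cvgM; first exact: cvg_cst.
apply: (@continuous_comp _ _ _ sin (fun z => z ^+ 2)); [exact: continuous_sin | exact: exprn_continuous].
Qed.

Local Notation F := (ellipticF k).

Lemma ellipticFE p : F p = oriented_integral g p. Proof. by []. Qed.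

Lemma ellipticF_der p : is_derive p 1 F (g p).
Proof.
have -> : F = oriented_integral g by apply/funext => z; rewrite ellipticFE.
exact: oriented_integral_der ellipticF_integrand_cont p.
Qed.

Lemma ellipticF0 : F 0 = 0. Proof. by rewrite ellipticFE oriented_integral0. Qed.

Lemma ellipticF_mono : {mono F : x y / x <= y}.
Proof.
apply: le_mono => x y xy; apply: (der_gt0_lt ellipticF_der xy) => z _.
exact: ellipticF_integrand_gt0.
Qed.

Lemma ellipticF_inj : injective F.
Proof. exact: inc_inj ellipticF_mono. Qed.

Lemma ellipticF_odd p : F (- p) = - F p.
Proof.
have H x : is_derive x 1 (fun x => F (- x) + F x) 0.
  apply: (der_eq (derD (der_opp_arg (ellipticF_der (- x))) (ellipticF_der x))).
  by rewrite /g sinN sqrrN addNr.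
have := der0_cst H p 0.
by rewrite oppr0 ellipticF0 addr0 => /eqP; rewrite addr_eq0 => /eqP.
Qed.

Lemma ellipticF_ge p : 0 <= p -> p <= F p.
Proof.
move=> p0; rewrite -subr_ge0.
have H x : is_derive x 1 (fun x => F x - x) (g x - 1).
  exact: (derB (ellipticF_der x) (derI x)).
have := der_ge0_le H p0; rewrite ellipticF0 subr0; apply=> x _.
by rewrite subr_ge0 ellipticF_integrand_ge1.
Qed.

Lemma ellipticF_surj u : exists p, F p = u.
Proof.
have cF : continuous F := der_continuous ellipticF_der.
have u0 : 0 <= `|u| by [].
have Fu : `|u| <= F `|u| := ellipticF_ge u0.
have [//||//|c _ <-] := @IVT _ F (- `|u|) `|u| u.
- by rewrite (le_trans _ u0) // oppr_le0.
- exact: continuous_subspaceT.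
- rewrite ellipticF_odd ge_min le_max; apply/andP; split; apply/orP.
    left; rewrite lerNl; apply: le_trans Fu; by rewrite -normrN ler_norm.
  by right; apply: le_trans Fu; rewrite ler_norm.
by exists c.
Qed.

Local Notation am := (jacobi_am k).

Lemma jacobi_amK u : F (am u) = u.
Proof.
have [p Fp] := ellipticF_surj u.
rewrite /jacobi_am; apply: (@xgetPex _ 0 [set p | F p = u]); by exists p.
Qed.

Lemma ellipticFK p : am (F p) = p.
Proof. by apply: ellipticF_inj; rewrite jacobi_amK. Qed.

Lemma jacobi_am_der u : is_derive u 1 am (jacobi_dn k u).
Proof.
rewrite -{1}[u]jacobi_amK.
have -> : jacobi_dn k u = (g (am u))^-1 by rewrite /g invrK.
apply: (@is_derive_inverse _ F am).
- by near=> z; exact: ellipticFK.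
- by near=> z; exact: (der_continuous ellipticF_der).
- exact: ellipticF_der.
- by rewrite gt_eqF // ellipticF_integrand_gt0.
Unshelve. all: by end_near. Qed.

Lemma jacobi_am_odd u : am (- u) = - am u.
Proof. by apply: ellipticF_inj; rewrite ellipticF_odd !jacobi_amK. Qed.

(** The integrand is even and has the period pi. *)
Lemma ellipticF_pi p : F (p + pi) = F p + 2 * F (pi / 2).
Proof.
have h1 x : is_derive x 1 (fun x => F (x + pi)) (g x).
  have H := ellipticF_der (1 * x + pi).
  apply: (der_ext (f := fun x => F (1 * x + pi))); first by move=> z; rewrite mul1r.
  by apply: (der_eq (der_affine H)); rewrite !mul1r /g sinDpi sqrrN.
have H1 x : is_derive x 1 (fun x => F (x + pi) - F x) 0.
  by apply: (der_eq (derB (h1 x) (ellipticF_der x))); rewrite subrr.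
have := der0_cst H1 p (- (pi / 2)).
rewrite (_ : - (pi / 2) + pi = pi / 2); last by field.
by rewrite ellipticF_odd opprK => /eqP; rewrite subr_eq => /eqP ->; ring.
Qed.

Lemma ler_sin_pihalf :
  {in `[- (pi / 2), pi / 2] &, {mono sin : x y / x <= y :> R}}.
Proof. by move=> x y xI yI; rewrite !leNgt ltr_sin. Qed.

Lemma asin0 : asin (0 : R) = 0.
Proof.
have p0 := pi_gt0 R.
rewrite -{1}sin0 sinK // in_itv /=; apply/andP; split; lra.
Qed.

Let G z : R := (Num.sqrt ((1 - z ^+ 2) * (1 - k ^+ 2 * z ^+ 2)))^-1.

Let sqr_lt1 z : -1 < z < 1 -> z ^+ 2 < 1.
Proof. by rewrite -[_ ^+ 2]real_normK ?num_real // expr_lt1 // ltr_norml. Qed.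

Lemma ellipticK_integrand_cont z : -1 < z < 1 -> {for z, continuous G}.
Proof.
move=> /sqr_lt1 z1; apply: cvgV.
  by rewrite gt_eqF // sqrtr_gt0 mulr_gt0 ?subr_gt0 // -subr_gt0 modulus_gt0 // ltW.
apply: (@continuous_comp _ _ _ (fun z => (1 - z ^+ 2) * (1 - k ^+ 2 * z ^+ 2)) Num.sqrt); last exact: sqrt_continuous.
apply: cvgM; apply: cvgB; [exact: cvg_cst|exact: exprn_continuous|exact: cvg_cst|].
by apply: cvgM; [exact: cvg_cst|exact: exprn_continuous].
Qed.

Lemma ellipticF_asin_der z : -1 < z < 1 -> is_derive z 1 (fun z => F (asin z)) (G z).
Proof.
move=> zI; have z1 := sqr_lt1 zI.
apply: (der_eq (der_comp (g := asin) (ellipticF_der (asin z)) (is_derive1_asin zI))).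
rewrite /g asinK; last by move: zI; rewrite in_itv /= => /andP[? ?]; rewrite !ltW.
by rewrite /G sqrtrM ?subr_ge0 ?ltW // invfM mulrC.
Qed.

Lemma ellipticK_integrand_integral (b : R) : 0 < b < 1 ->
  (\int[lebesgue_measure]_(z in `[0%R, b]) (G z)%:E = (F (asin b))%:E)%E.
Proof.
move=> /andP[b0 b1].
have zI z : z \in `[0, b] -> -1 < z < 1.
  rewrite in_itv /= => /andP[z0 zb]; apply/andP; split; last exact: le_lt_trans b1.
  by apply: lt_le_trans z0; rewrite ltrN10.
rewrite (@continuous_FTC2 _ G (fun z => F (asin z)) 0 b b0).
- by rewrite asin0 ellipticF0 sube0.
- by apply: continuous_in_subspaceT => z /set_mem /zI; exact: ellipticK_integrand_cont.
- have sub : {subset `]0, b[ <= `[0, b]} by move=> z; rewrite !in_itv /= => /andP[? ?]; rewrite !ltW.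
  have d z : z \in `[0, b] -> {for z, continuous (fun z => F (asin z))}.
    by move=> /zI zI'; apply: der_cont (ellipticF_asin_der zI').
  split.
  + by move=> z /sub /zI zI'; case: (ellipticF_asin_der zI').
  + by apply: cvg_at_right_filter; apply: d; rewrite in_itv /= lexx ltW.
  + by apply: cvg_at_left_filter; apply: d; rewrite in_itv /= lexx ltW.
- move=> z; rewrite in_itv /= => /andP[z0 zb]; apply: der_derive1; apply: ellipticF_asin_der.
  by apply: zI; rewrite in_itv /= !ltW.
Qed.

(** The substitution z = sin t. On [0, b] with b < 1 the function F (asin z)
    is a primitive of the integrand; monotone convergence along b = sin (t
    n), with t n increasing to pi / 2, reaches the singular end point. *)
Lemma ellipticK_eq_F : ellipticK k = F (pi / 2).
Proof.
have pi0 := pi_gt0 R.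
rewrite /ellipticK /Rintegral -/G.
pose t (n : nat) : R := pi / 2 * (1 - n.+2%:R^-1).
have tlt n : 0 < t n < pi / 2.
  have n0 : 0 < n.+2%:R^-1 :> R by rewrite invr_gt0.
  have n1 : n.+2%:R^-1 < 1 :> R by rewrite invf_lt1 // ltr1n.
  rewrite /t; apply/andP; split; first by rewrite mulr_gt0 ?divr_gt0 // subr_gt0.
  by rewrite gtr_pMr ?divr_gt0 // gtrBl.
have tmono n m : (n <= m)%N -> t n <= t m.
  move=> nm; rewrite /t; apply: ler_wpM2l; first by rewrite divr_ge0 ?ltW.
  by rewrite lerD2l lerN2 lef_pV2 ?posrE // ler_nat.
have tcvg : t @ \oo --> pi / 2.
  rewrite -[X in _ --> X]mulr1; apply: cvgM; first exact: cvg_cst.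
  rewrite -[X in _ --> X]subr0; apply: cvgB; first exact: cvg_cst.
  have h := @cvg_harmonic R; rewrite -(cvg_shiftS (@harmonic R)) in h; exact: h.
have sinb n : 0 < sin (t n) < 1.
  have /andP[t0 t1] := tlt n; rewrite sin_gt0_pihalf /= ?t0 //.
  rewrite -[ltRHS](@sin_pihalf R) ltr_sin // in_itv /=; apply/andP; split; lra.
have tin n : t n \in `[- (pi / 2), pi / 2].
  by have /andP[t0 t1] := tlt n; rewrite in_itv /=; apply/andP; split; lra.
have sint n m : (n <= m)%N -> sin (t n) <= sin (t m).
  by move=> nm; rewrite ler_sin_pihalf // ?tin // tmono.
pose S n : set (measurableTypeR R) := `[0, sin (t n)]%classic.
have S_U : \bigcup_n S n = `[0, 1[%classic.
  apply/seteqP; split=> [z [n _]|z]; rewrite /S /= !in_itv /= => /andP[z0 z1].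
    by rewrite z0 /=; have /andP[_] := sinb n; exact: le_lt_trans.
  have zI : asin z < pi / 2 by apply: asin_ltpi2; rewrite z1 andbT; lra.
  have /cvgrPdist_lt/(_ (pi / 2 - asin z)) := tcvg.
  rewrite subr_gt0 => /(_ zI)[n _ /(_ n (leqnn n))] /=.
  have /andP[t0 t1] := tlt n.
  rewrite gtr0_norm ?subr_gt0 // ltrD2l ltrN2 => zt.
  exists n => //=; rewrite in_itv /= z0 /=.
  rewrite -[leLHS](@asinK R) ?in_itv /= ?(ltW z1) ?andbT; last lra.
  rewrite ler_sin_pihalf ?tin ?ltW // in_itv /= asin_geNpi2 ?asin_lepi2 ?(ltW z1) ?andbT //; lra.
have G0 z : 0 <= G z by rewrite invr_ge0 sqrtr_ge0.
pose Ge : measurableTypeR R -> \bar R := EFin \o G.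
have mG (D : set (measurableTypeR R)) : measurable D -> (forall z, D z -> -1 < z < 1) -> measurable_fun D Ge.
  move=> mD DI; apply/measurable_EFinP.
  have H : {within D, continuous (G : R -> R)}.
    by apply: continuous_in_subspaceT => z /set_mem /DI; exact: ellipticK_integrand_cont.
  exact: subspace_continuous_measurable_fun mD H.
have mS n : measurable_fun (S n) Ge.
  apply: mG => [|z]; [exact: measurable_itv|]; rewrite /S /= in_itv /= => /andP[z0 z1].
  have /andP[_ s1] := sinb n; apply/andP; split; [lra | exact: le_lt_trans s1].
have := @ge0_nondecreasing_set_cvg_integral _ (measurableTypeR R) R S Ge (@lebesgue_measure R) _ _ mS _.
move=> /(_ _)/wrap[].
  move=> n m nm; rewrite subsetEset => z; rewrite /S /= !in_itv /= => /andP[-> z1].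
  by rewrite (le_trans z1) // sint.
move=> /(_ _)/wrap[]; first by move=> n; exact: measurable_itv.
move=> /(_ _)/wrap[]; first by move=> n z _; rewrite lee_fin.
have mU : measurable_fun (`[(0 : R), 1[%classic : set (measurableTypeR R)) Ge.
  apply: (mG _ (measurable_itv _)).
  by move=> z; rewrite /= in_itv /= => /andP[z0 z1]; apply/andP; split; [lra|].
rewrite S_U (integral_itv_bndo_bndc mU).
under eq_fun => n do rewrite (ellipticK_integrand_integral (sinb n)) sinK ?tin //.
move=> H.
have H2 : ((F (t n))%:E @[n --> \oo] --> (F (pi / 2))%:E)%E.
  apply: cvg_EFin; first by apply: nearW.
  have cF : continuous F := der_continuous ellipticF_der.
  have h : F (t n) @[n --> \oo] --> F (pi / 2).
    by apply: continuous_cvg => //; exact: cF.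
  exact: h.
have := cvg_unique _ H H2 => -> //.
Qed.

Lemma ellipticK_gt0 : 0 < ellipticK k.
Proof.
have pi0 := pi_gt0 R.
rewrite ellipticK_eq_F; apply: lt_le_trans (ellipticF_ge _); rewrite ?divr_ge0 ?divr_gt0 ?ltW //.
Qed.

Lemma jacobi_am_period u : am (u + 2 * ellipticK k) = am u + pi.
Proof. by apply: ellipticF_inj; rewrite jacobi_amK ellipticF_pi jacobi_amK ellipticK_eq_F. Qed.


Lemma jacobi_dn_even u : jacobi_dn k (- u) = jacobi_dn k u.
Proof. by rewrite /jacobi_dn jacobi_am_odd sinN sqrrN. Qed.

Lemma jacobi_dn_period u : jacobi_dn k (u + 2 * ellipticK k) = jacobi_dn k u.
Proof. by rewrite /jacobi_dn jacobi_am_period sinDpi sqrrN. Qed.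

Definition jacobi_sn u := sin (jacobi_am k u).

Lemma jacobi_dn_gt0 u : 0 < jacobi_dn k u.
Proof. by rewrite sqrtr_gt0 dn_arg_gt0. Qed.

Lemma jacobi_dn2 u : jacobi_dn k u ^+ 2 = 1 - k ^+ 2 * jacobi_sn u ^+ 2.
Proof. by rewrite sqr_sqrtr // ltW // dn_arg_gt0. Qed.

Lemma jacobi_cn2 u : jacobi_cn k u ^+ 2 = 1 - jacobi_sn u ^+ 2.
Proof. by rewrite /jacobi_cn cos2sin2. Qed.

Lemma jacobi_sn_der u : is_derive u 1 jacobi_sn (jacobi_cn k u * jacobi_dn k u).
Proof. exact: (der_comp (is_derive_sin _) (jacobi_am_der u)). Qed.

Lemma jacobi_cn_der u : is_derive u 1 (jacobi_cn k) (- (jacobi_sn u * jacobi_dn k u)).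
Proof.
by apply: (der_eq (der_comp (is_derive_cos _) (jacobi_am_der u))); rewrite mulNr.
Qed.

Lemma jacobi_dn_der u : is_derive u 1 (jacobi_dn k) (- k ^+ 2 * (jacobi_sn u * jacobi_cn k u)).
Proof.
have d0 := jacobi_dn_gt0 u.
have H : is_derive u 1 (fun u => 1 - k ^+ 2 * jacobi_sn u ^+ 2)
   (0 - k ^+ 2 * (2 * jacobi_sn u ^+ 1 * (jacobi_cn k u * jacobi_dn k u))).
  exact: (derB (derC 1 u) (derZ (k ^+ 2) (derX 2 (jacobi_sn_der u)))).
apply: (der_eq (der_comp (g := fun u => 1 - k ^+ 2 * jacobi_sn u ^+ 2)
   (is_derive1_sqrt (dn_arg_gt0 (am u))) H)).
rewrite -/(jacobi_dn k u); field.
by rewrite gt_eqF.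
Qed.

End Jacobi.

(** * Integrals over the period cell *)

(** The complement of D is negligible for the restricted measure. *)
Lemma integral_mrestr d (T : measurableType d) (R : realType)
    (mu : {measure set T -> \bar R}) (D : set T) (mD : measurable D) (f : T -> \bar R) :
  (mrestr mu mD).-integrable setT f ->
  (\int[mrestr mu mD]_x f x = \int[mu]_x (f \_ D) x)%E.
Proof.
move=> fi.
have N0 : mrestr mu mD (~` D) = 0%E by rewrite /mrestr setICl measure0.
rewrite (negligible_integral (measurableC mD) measurableT fi N0) setTD setCK -integral_mkcond.
by apply: eq_measure_integral => A mA /setIidl Ac; rewrite /= /mrestr Ac.
Qed.

Section Plane.
Context {R : realType}.
Local Notation plane := (measurableTypeR R * measurableTypeR R)%type.

(** An open set of the plane is the union of the squares with rational centre
    and rational half-width that it contains. *)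
Lemma open_plane_measurable (O : set (R * R)) : open O -> measurable (O : set plane).
Proof.
move=> oO.
pose box (q1 q2 r : rat) : set plane :=
  `]ratr q1 - ratr r, ratr q1 + ratr r[ `*` `]ratr q2 - ratr r, ratr q2 + ratr r[.
pose F q1 q2 r : set plane := if `[< box q1 q2 r `<=` O >] then box q1 q2 r else set0.
have -> : (O : set plane) = \bigcup_q1 \bigcup_q2 \bigcup_r F q1 q2 r.
  apply/seteqP; split => [[x y] Oxy|p [q1 _ [q2 _ [r _]]]]; last first.
    by rewrite /F; case: asboolP => // + Bp; apply.
  have /nbhs_ballP[e /= e0 He] : nbhs (x, y) O by apply: open_nbhs_nbhs.
  have e3 : 0 < e / 3 by rewrite divr_gt0.
  (* A half-width r above e / 3 catches (x, y) from a centre at distance at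
     most e / 3, and r below e / 2 keeps the square in the ball of radius e. *)
  have e32 : e / 3 < e / 2 by lra.
  have [r /itvP rI] := rat_in_itvoo e32.
  have [r1 r2] : e / 3 < ratr r /\ ratr r < e / 2 by rewrite !rI.
  have xe : x - e / 3 < x + e / 3 by move: (x : R) => z; lra.
  have ye : y - e / 3 < y + e / 3 by move: (y : R) => z; lra.
  have [q1 /itvP q1I] := rat_in_itvoo xe.
  have [q2 /itvP q2I] := rat_in_itvoo ye.
  have [a1 a2] : x - e / 3 < ratr q1 /\ ratr q1 < x + e / 3 by rewrite !q1I.
  have [b1 b2] : y - e / 3 < ratr q2 /\ ratr q2 < y + e / 3 by rewrite !q2I.
  exists q1 => //; exists q2 => //; exists r => //.
  rewrite /F; case: asboolP => [_|[]].
    by split; rewrite /= in_itv /=; apply/andP; split; lra.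
  move=> [s t] [/=]; rewrite !in_itv /= => /andP[s1 s2] /andP[t1 t2].
  apply: He; split; rewrite /ball /= ltr_norml; apply/andP; split; lra.
apply: bigcupT_measurable_rat => q1; apply: bigcupT_measurable_rat => q2.
apply: bigcupT_measurable_rat => r; rewrite /F; case: ifPn => _ //.
by apply: measurableX; exact: measurable_itv.
Qed.

Lemma continuous_plane_measurable (f : R * R -> R) : continuous f ->
  measurable_fun setT (f : plane -> measurableTypeR R).
Proof.
move=> /continuousP cf; apply: (measurability _ (RGenOpens.measurableE R)).
move=> _ [_ [a [b ->] <-]]; rewrite setTI; apply: open_plane_measurable.
by apply: cf; exact: interval_open.
Qed.

Variables (K1 K2 : R).
Hypotheses (K1_gt0 : 0 < K1) (K2_gt0 : 0 < K2).
Local Notation cell := (@cell R K1 K2).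
Local Notation mu := (cell_measure K1 K2).
Local Notation leb := (@lebesgue_measure R).

Lemma lebesgue_cell : (leb \x leb)%E cell = (K1 * K2)%:E.
Proof.
have L (K : R) : 0 < K -> leb `[0, K]%classic = K%:E.
  by move=> K0; rewrite lebesgue_measure_itv /= lte_fin K0 sube0.
have -> : (leb \x leb)%E cell = (leb `[0%R, K1]%classic * leb `[0%R, K2]%classic)%E.
  by apply: product_measure1E; exact: measurable_itv.
by rewrite !L // -EFinM.
Qed.

Lemma cell_measureE A : mu A = (leb \x leb)%E (A `&` cell).
Proof. by []. Qed.

Lemma cell_measureC : mu (~` cell) = 0.
Proof. by rewrite cell_measureE setICl measure0. Qed.

Lemma cell_bounded (f : R * R -> R) : continuous f ->
  exists2 M, 0 <= M & forall p, cell p -> `|f p| <= M.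
Proof.
move=> cf.
have cc : compact (cell : set (R * R)).
  by apply: compact_setX; exact: segment_compact.
have /compact_bounded[M [Mr HM]] : compact (f @` (cell : set (R * R))).
  by apply: continuous_compact cc; apply: continuous_subspaceT.
exists (`|M| + 1); first by rewrite addr_ge0.
move=> p cp; apply: (HM (`|M| + 1)); last by exists p.
by rewrite (le_lt_trans (ler_norm M)) // ltrDl.
Qed.

Lemma cell_integrable (f : R * R -> R) : continuous f ->
  [/\ (leb \x leb)%E.-integrable cell (EFin \o f), mu.-integrable cell (EFin \o f)
    & mu.-integrable setT (EFin \o f)].
Proof.
move=> cf.
have mf := continuous_plane_measurable cf.
have mfc : measurable_fun cell (f : plane -> measurableTypeR R).
  by apply: measurable_funS mf.
have [M M0 HM] := cell_bounded cf.
have mcell := measurable_cell K1 K2.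
have bf : [bounded (f : plane -> R) x | x in cell].
  exists M; split; first exact: num_real.
  by move=> z Mz p cp; apply: le_trans (HM p cp) (ltW Mz).
have i1 : (leb \x leb)%E.-integrable cell (EFin \o f).
  have fin : ((leb \x leb)%E cell < +oo)%E by rewrite lebesgue_cell ltry.
  exact: measurable_bounded_integrable mcell fin mfc bf.
have i2 : mu.-integrable cell (EFin \o f).
  have fin : (mu cell < +oo)%E by rewrite cell_measureE setIid lebesgue_cell ltry.
  exact: measurable_bounded_integrable mcell fin mfc bf.
split=> //; apply/integrableP; split; first exact/measurable_EFinP.
have /integrableP[_] := i2; apply: le_lt_trans.
rewrite (@ge0_negligible_integral _ _ _ mu setT (~` cell)) //.
- by rewrite setTD setCK.
- exact: measurableC.
- by apply: measurableT_comp => //; exact/measurable_EFinP.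
- exact: cell_measureC.
Qed.

Lemma cell_integral (f : R * R -> R) : continuous f ->
  (\int[mu]_p (f p)%:E = \int[(leb \x leb)%E]_p ((EFin \o f) \_ cell) p)%E.
Proof.
move=> cf; have [_ _ i3] := cell_integrable cf.
exact: (integral_mrestr i3).
Qed.

(** Fubini: one vanishing iterated integral is all that integration by parts
    in x needs. *)
Lemma cell_integral_x0 (f : R * R -> R) : continuous f ->
  (forall y, (\int[leb]_(x in `[0%R, K1]) (f (x, y))%:E = 0)%E) ->
  \int[mu]_p f p = 0.
Proof.
move=> cf H; rewrite /Rintegral cell_integral //.
have [i1 _ _] := cell_integrable cf.
have mcell := measurable_cell K1 K2.
rewrite -integral21_prod_meas1; last by apply/(integrable_mkcond _ mcell).
rewrite integral0_eq // => y _.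
rewrite /fubini_G /=.
have [yI|yI] := pselect (`[0, K2]%classic y); last first.
  apply: integral0_eq => x _; rewrite patchE ifF //.
  by apply/negbTE/negP => /set_mem [].
rewrite -[RHS](H y) [RHS]integral_mkcond.
apply: eq_integral => x _; rewrite !patchE /=.
have -> : ((x, y) \in cell) = (x \in `[0, K1]%classic).
  by apply/idP/idP => /set_mem; [move=> [? _]; apply/mem_set | move=> ?; apply/mem_set].
by [].
Qed.

Lemma cell_integral_y0 (f : R * R -> R) : continuous f ->
  (forall x, (\int[leb]_(y in `[0%R, K2]) (f (x, y))%:E = 0)%E) ->
  \int[mu]_p f p = 0.
Proof.
move=> cf H; rewrite /Rintegral cell_integral //.
have [i1 _ _] := cell_integrable cf.
have mcell := measurable_cell K1 K2.
rewrite -integral12_prod_meas1; last by apply/(integrable_mkcond _ mcell).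
rewrite integral0_eq // => x _.
rewrite /fubini_F /=.
have [xI|xI] := pselect (`[0, K1]%classic x); last first.
  apply: integral0_eq => y _; rewrite patchE ifF //.
  by apply/negbTE/negP => /set_mem [].
rewrite -[RHS](H x) [RHS]integral_mkcond.
apply: eq_integral => y _; rewrite !patchE /=.
have -> : ((x, y) \in cell) = (y \in `[0, K2]%classic).
  by apply/idP/idP => /set_mem; [move=> [_ ?]; apply/mem_set | move=> ?; apply/mem_set].
by [].
Qed.

End Plane.

(** * Integration by parts against test functions *)

Lemma Lfun2_bounded d (T : measurableType d) (R : realType)
    (mu : {measure set T -> \bar R}) (f : T -> R) :
  measurable_fun setT f -> mu.-integrable setT (EFin \o (fun x => f x ^+ 2)) ->
  f \in Lfun mu 2%:E.
Proof.
move=> mf fi; rewrite inE; apply/andP; split; rewrite inE //=.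
rewrite /finite_norm unlock /Lnorm poweR_lty //.
have /integrableP[_] := fi; apply: le_lt_trans.
rewrite le_eqVlt; apply/orP; left; apply/eqP; apply: eq_integral => x _ /=.
by rewrite powR_mulrn ?normr_ge0 // normrX.
Qed.

Section Weak.
Context {R : realType}.
Local Notation plane := (measurableTypeR R * measurableTypeR R)%type.
Implicit Types (psi : R * R -> R).

Lemma derive_shift (f : R * R -> R) (p v s : R * R) :
  (forall q, f (q + s) = f q) -> 'D_v f (p + s) = 'D_v f p.
Proof.
move=> H.
have E : f \o shift (p + s) = f \o shift p.
  by apply/funext => h /=; rewrite addrA H.
by rewrite /derive E H.
Qed.

Lemma pairD (p q : R * R) : p + q = (p.1 + q.1, p.2 + q.2).
Proof. by []. Qed.

Lemma pairZ (h : R) (p : R * R) : h *: p = (h * p.1, h * p.2).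
Proof. by []. Qed.

(** Lets the integrations by parts be iterated along the word of a higher
    derivative. *)
Lemma test_function_pderive K1 K2 d psi : test_function K1 K2 psi ->
  test_function K1 K2 (pderive [:: d] psi).
Proof.
move=> [sm per]; split.
  by move=> s; have := sm (s ++ [:: d]); rewrite /pderive foldr_cat.
move=> x y; rewrite /pderive /=.
have := @derive_shift psi (x, y) (axis d) (K1, 0).
have := @derive_shift psi (x, y) (axis d) (0, K2).
have A1 : (x, y) + (K1, 0) = (x + K1, y) :> R * R by rewrite pairD /= addr0.
have A2 : (x, y) + (0, K2) = (x, y + K2) :> R * R by rewrite pairD /= addr0.
rewrite A1 A2 => h2 h1; split; [apply: h1 | apply: h2] => -[a b].
  have -> : (a, b) + (K1, 0) = (a + K1, b) :> R * R by rewrite pairD /= addr0.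
  by have [] := per a b.
have -> : (a, b) + (0, K2) = (a, b + K2) :> R * R by rewrite pairD /= addr0.
by have [] := per a b.
Qed.

Lemma partial_x_der psi (x y : R) : derivable psi (x, y) (axis dirx) ->
  is_derive x 1 (fun s => psi (s, y)) ('D_(axis dirx) psi (x, y)).
Proof.
move=> dpsi.
have E : (fun h : R => h^-1 *: (psi (h *: (1 : R) + x, y) - psi (x, y))) =
   (fun h : R => h^-1 *: (psi (h *: axis dirx + (x, y)) - psi (x, y))).
  apply/funext => h; congr (_ *: (psi _ - _)).
  by rewrite pairD pairZ /= mulr0 add0r.
by apply: DeriveDef; [rewrite /derivable E | rewrite /derive E].
Qed.

Lemma partial_y_der psi (x y : R) : derivable psi (x, y) (axis diry) ->
  is_derive y 1 (fun s => psi (x, s)) ('D_(axis diry) psi (x, y)).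
Proof.
move=> dpsi.
have E : (fun h : R => h^-1 *: (psi (x, h *: (1 : R) + y) - psi (x, y))) =
   (fun h : R => h^-1 *: (psi (h *: axis diry + (x, y)) - psi (x, y))).
  apply/funext => h; congr (_ *: (psi _ - _)).
  by rewrite pairD pairZ /= mulr0 add0r.
by apply: DeriveDef; [rewrite /derivable E | rewrite /derive E].
Qed.

Lemma tensor_cont (a b : R -> R) : continuous a -> continuous b ->
  continuous (fun p : R * R => a p.1 * b p.2).
Proof.
move=> ca cb p; apply: cvgM.
  by apply: (@continuous_comp _ _ _ fst a); [exact: cvg_fst|exact: ca].
by apply: (@continuous_comp _ _ _ snd b); [exact: cvg_snd|exact: cb].
Qed.

Lemma pair_cont_x (y : R) : continuous (fun x : R => (x, y)).
Proof.
move=> z; apply/cvg_ballP => e e0; near=> t; split; last exact: ballxx.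
rewrite /=; near: t; exact: (@nbhsx_ballx _ _ (z : R) e e0).
Unshelve. all: by end_near. Qed.

Lemma pair_cont_y (x : R) : continuous (fun y : R => (x, y)).
Proof.
move=> z; apply/cvg_ballP => e e0; near=> t; split; first exact: ballxx.
rewrite /=; near: t; exact: (@nbhsx_ballx _ _ (z : R) e e0).
Unshelve. all: by end_near. Qed.

Lemma integral_der0 (f g : R -> R) (K : R) : 0 < K -> continuous g ->
  (forall x : R, is_derive x 1 f (g x)) -> f K = f 0 ->
  (\int[lebesgue_measure]_(x in `[0%R, K]) (g x)%:E = 0)%E.
Proof.
move=> K0 cg dfg fK.
have cf : continuous f := der_continuous dfg.
rewrite (@continuous_FTC2 _ g f 0 K K0) ?fK ?subee //.
- exact: continuous_subspaceT.
- split; first by move=> x _; case: (dfg x).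
    by apply: cvg_at_right_filter; exact: cf.
  by apply: cvg_at_left_filter; exact: cf.
- by move=> x _; apply: der_derive1.
Qed.

Variables (K1 K2 : R).
Hypotheses (K1_gt0 : 0 < K1) (K2_gt0 : 0 < K2).
Local Notation mu := (cell_measure K1 K2).
Local Notation L2 := (LfunType mu (lee1n 2)).

Lemma cell_RintegralD (f g : R * R -> R) : continuous f -> continuous g ->
  \int[mu]_p (f p + g p) = \int[mu]_p f p + \int[mu]_p g p.
Proof.
move=> cf cg.
have [_ _ fi] := cell_integrable K1_gt0 K2_gt0 cf.
have [_ _ gi] := cell_integrable K1_gt0 K2_gt0 cg.
exact: (RintegralD measurableT fi gi).
Qed.

Section Parts.
Variables (a a' b b' : R -> R).
Hypotheses (da : forall x : R, is_derive x 1 a (a' x)) (db : forall x : R, is_derive x 1 b (b' x)).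
Hypotheses (ca' : continuous a') (cb' : continuous b').
Let ca : continuous a := der_continuous da.
Let cb : continuous b := der_continuous db.

Lemma test_cont psi : test_function K1 K2 psi -> continuous psi.
Proof. by move=> [sm _]; have [] := sm [::]. Qed.

(** The sum of the two integrands is the x-derivative of a(x) b(y) psi, a
    function with the same values at x = 0 and x = K1. *)
Lemma parts_x psi : a K1 = a 0 -> test_function K1 K2 psi ->
  \int[mu]_p (a p.1 * b p.2 * 'D_(axis dirx) psi p) = - \int[mu]_p (a' p.1 * b p.2 * psi p).
Proof.
move=> aK tpsi.
have cpsi := test_cont tpsi.
have cdpsi : continuous ('D_(axis dirx) psi) := test_cont (test_function_pderive dirx tpsi).
have c1 : continuous (fun p : R * R => a p.1 * b p.2 * 'D_(axis dirx) psi p).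
  by move=> p; apply: cvgM; [exact: (tensor_cont ca cb)|exact: cdpsi].
have c2 : continuous (fun p : R * R => a' p.1 * b p.2 * psi p).
  by move=> p; apply: cvgM; [exact: (tensor_cont ca' cb)|exact: cpsi].
apply/eqP; rewrite -addr_eq0 -cell_RintegralD //; apply/eqP.
apply: cell_integral_x0 => // [|y].
  by move=> p; apply: cvgD; [exact: c1|exact: c2].
apply: (@integral_der0 (fun x => a x * b y * psi (x, y))
  (fun x => a x * b y * 'D_(axis dirx) psi (x, y) + a' x * b y * psi (x, y))) => //.
- move=> x.
  have pc : continuous (fun x : R => (x, y)) := @pair_cont_x y.
  apply: (@continuous_comp _ _ _ (fun x : R => (x, y)) (fun p : R * R => a p.1 * b p.2 * 'D_(axis dirx) psi p + a' p.1 * b p.2 * psi p)).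
    exact: pc.
  by apply: cvgD; [exact: c1|exact: c2].
- move=> x; have [sm per] := tpsi.
  have [_ /(_ (x, y) dirx) dpsi] := sm [::].
  apply: (der_eq (derM (derM (da x) (derC (b y) x)) (partial_x_der dpsi))).
  by rewrite mulr0 addr0 addrC.
- have [_ per] := tpsi; rewrite aK; congr (_ * _).
  by have [h _] := per 0 y; rewrite add0r in h.
Qed.

Lemma parts_y psi : b K2 = b 0 -> test_function K1 K2 psi ->
  \int[mu]_p (a p.1 * b p.2 * 'D_(axis diry) psi p) = - \int[mu]_p (a p.1 * b' p.2 * psi p).
Proof.
move=> bK tpsi.
have cpsi := test_cont tpsi.
have cdpsi : continuous ('D_(axis diry) psi) := test_cont (test_function_pderive diry tpsi).
have c1 : continuous (fun p : R * R => a p.1 * b p.2 * 'D_(axis diry) psi p).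
  by move=> p; apply: cvgM; [exact: (tensor_cont ca cb)|exact: cdpsi].
have c2 : continuous (fun p : R * R => a p.1 * b' p.2 * psi p).
  by move=> p; apply: cvgM; [exact: (tensor_cont ca cb')|exact: cpsi].
apply/eqP; rewrite -addr_eq0 -cell_RintegralD //; apply/eqP.
apply: cell_integral_y0 => // [|x].
  by move=> p; apply: cvgD; [exact: c1|exact: c2].
apply: (@integral_der0 (fun y => a x * b y * psi (x, y))
  (fun y => a x * b y * 'D_(axis diry) psi (x, y) + a x * b' y * psi (x, y))) => //.
- move=> y.
  have pc : continuous (fun y : R => (x, y)) := @pair_cont_y x.
  apply: (@continuous_comp _ _ _ (fun y : R => (x, y)) (fun p : R * R => a p.1 * b p.2 * 'D_(axis diry) psi p + a p.1 * b' p.2 * psi p)).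
    exact: pc.
  by apply: cvgD; [exact: c1|exact: c2].
- move=> y; have [sm per] := tpsi.
  have [_ /(_ (x, y) diry) dpsi] := sm [::].
  apply: (der_eq (derM (derM (derC (a x) y) (db y)) (partial_y_der dpsi))).
  by rewrite mul0r add0r addrC.
- have [_ per] := tpsi; rewrite bK; congr (_ * _).
  by have [_ h] := per x 0; rewrite add0r in h.
Qed.

End Parts.

Lemma tensor_L2 (a b : R -> R) : continuous a -> continuous b ->
  exists v : L2, forall p, v p = a p.1 * b p.2.
Proof.
move=> ca cb; have cf := tensor_cont ca cb.
have mf := continuous_plane_measurable cf.
have cf2 : continuous (fun p : R * R => (a p.1 * b p.2) ^+ 2).
  move=> p; apply: (@continuous_comp _ _ _ (fun p : R * R => a p.1 * b p.2) (fun z => z ^+ 2)).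
    exact: cf.
  exact: exprn_continuous.
have [_ _ fi] := cell_integrable K1_gt0 K2_gt0 cf2.
have inL : (fun p : plane => a p.1 * b p.2) \in Lfun mu 2%:E.
  exact: Lfun2_bounded mf fi.
by exists (Lfun_Sub (lee1n 2) inL).
Qed.

End Weak.

(** * Products a(x) b(y) in the domain of the Schroedinger operators *)

Section Eigenvector.
Context {R : realType}.
Local Notation plane := (measurableTypeR R * measurableTypeR R)%type.

(** The values at 0 and K agree, which is what the boundary terms of the
    integrations by parts over one period see. *)
Record C2_periodic (K : R) (a a1 a2 : R -> R) : Prop := {
  C2_der1 : forall x : R, is_derive x 1 a (a1 x) ;
  C2_der2 : forall x : R, is_derive x 1 a1 (a2 x) ;
  C2_cont : continuous a2 ;
  C2_per0 : a K = a 0 ;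
  C2_per1 : a1 K = a1 0 }.

Lemma C2_scale K a a1 a2 c : C2_periodic K a a1 a2 ->
  C2_periodic K (fun x => c * a x) (fun x => c * a1 x) (fun x => c * a2 x).
Proof.
case=> d1 d2 ct p0 p1; split.
- by move=> x; exact: derZ.
- by move=> x; exact: derZ.
- by move=> x; apply: cvgM; [exact: cvg_cst|exact: ct].
- by rewrite p0.
- by rewrite p1.
Qed.

Variables (K1 K2 : R).
Hypotheses (K1_gt0 : 0 < K1) (K2_gt0 : 0 < K2).
Local Notation mu := (cell_measure K1 K2).
Local Notation L2 := (LfunType mu (lee1n 2)).

Section Tensor.
Variables (a a1 a2 b b1 b2 : R -> R).
Hypotheses (Ca : C2_periodic K1 a a1 a2) (Cb : C2_periodic K2 b b1 b2).
Let ca : continuous a := der_continuous (C2_der1 Ca).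
Let ca1 : continuous a1 := der_continuous (C2_der2 Ca).
Let ca2 : continuous a2 := C2_cont Ca.
Let cb : continuous b := der_continuous (C2_der1 Cb).
Let cb1 : continuous b1 := der_continuous (C2_der2 Cb).
Let cb2 : continuous b2 := C2_cont Cb.

Lemma weak_ext s (v w : L2) (f g : R * R -> R) :
  (forall p, v p = f p) -> (forall p, w p = g p) ->
  (forall psi, test_function K1 K2 psi ->
    \int[mu]_p (f p * pderive s psi p) = (-1) ^+ size s * \int[mu]_p (g p * psi p)) ->
  weak_derivative s v w.
Proof.
move=> vf wg H psi tpsi; have := H psi tpsi.
have -> : \int[mu]_p (f p * pderive s psi p) = \int[mu]_p (v p * pderive s psi p).
  by apply: eq_Rintegral => p _; rewrite vf.
have -> // : \int[mu]_p (g p * psi p) = \int[mu]_p (w p * psi p).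
by apply: eq_Rintegral => p _; rewrite wg.
Qed.

Lemma tensor_weak_xx (v w : L2) : (forall p, v p = a p.1 * b p.2) ->
  (forall p, w p = a2 p.1 * b p.2) -> weak_derivative [:: dirx; dirx] v w.
Proof.
move=> vE wE; apply: (weak_ext vE wE) => psi tpsi; rewrite [pderive _ _]/=.
have := parts_x K1_gt0 K2_gt0 (C2_der1 Ca) (C2_der1 Cb) ca1 (C2_per0 Ca) (test_function_pderive dirx tpsi).
rewrite [pderive _ _]/= => ->.
rewrite (parts_x K1_gt0 K2_gt0 (C2_der2 Ca) (C2_der1 Cb) ca2 (C2_per1 Ca) tpsi).
by rewrite /= sqrrN expr1n mul1r opprK.
Qed.

Lemma tensor_weak_yy (v w : L2) : (forall p, v p = a p.1 * b p.2) ->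
  (forall p, w p = a p.1 * b2 p.2) -> weak_derivative [:: diry; diry] v w.
Proof.
move=> vE wE; apply: (weak_ext vE wE) => psi tpsi; rewrite [pderive _ _]/=.
have := parts_y K1_gt0 K2_gt0 (C2_der1 Ca) (C2_der1 Cb) cb1 (C2_per0 Cb) (test_function_pderive diry tpsi).
rewrite [pderive _ _]/= => ->.
rewrite (parts_y K1_gt0 K2_gt0 (C2_der1 Ca) (C2_der2 Cb) cb2 (C2_per1 Cb) tpsi).
by rewrite /= sqrrN expr1n mul1r opprK.
Qed.

Lemma tensor_in_H2 (v : L2) : (forall p, v p = a p.1 * b p.2) -> in_H2 v.
Proof.
move=> vE [|d1 [|d2 [|//]]] _.
- by exists v; apply: (weak_ext vE vE) => psi tpsi; rewrite expr0 mul1r.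
- case: d1.
    have [w wE] := tensor_L2 K1_gt0 K2_gt0 ca1 cb.
    exists w; apply: (weak_ext vE wE) => psi tpsi; rewrite [pderive _ _]/=.
    rewrite (parts_x K1_gt0 K2_gt0 (C2_der1 Ca) (C2_der1 Cb) ca1 (C2_per0 Ca) tpsi).
    by rewrite expr1 mulN1r.
  have [w wE] := tensor_L2 K1_gt0 K2_gt0 ca cb1.
  exists w; apply: (weak_ext vE wE) => psi tpsi; rewrite [pderive _ _]/=.
  rewrite (parts_y K1_gt0 K2_gt0 (C2_der1 Ca) (C2_der1 Cb) cb1 (C2_per0 Cb) tpsi).
  by rewrite expr1 mulN1r.
- case: d1; case: d2.
  + have [w wE] := tensor_L2 K1_gt0 K2_gt0 ca2 cb.
    by exists w; exact: tensor_weak_xx.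
  + have [w wE] := tensor_L2 K1_gt0 K2_gt0 ca1 cb1.
    exists w; apply: (weak_ext vE wE) => psi tpsi; rewrite [pderive _ _]/=.
    have := parts_x K1_gt0 K2_gt0 (C2_der1 Ca) (C2_der1 Cb) ca1 (C2_per0 Ca) (test_function_pderive diry tpsi).
    rewrite [pderive _ _]/= => ->.
    rewrite (parts_y K1_gt0 K2_gt0 (C2_der2 Ca) (C2_der1 Cb) cb1 (C2_per0 Cb) tpsi).
    by rewrite /= sqrrN expr1n mul1r opprK.
  + have [w wE] := tensor_L2 K1_gt0 K2_gt0 ca1 cb1.
    exists w; apply: (weak_ext vE wE) => psi tpsi; rewrite [pderive _ _]/=.
    have := parts_y K1_gt0 K2_gt0 (C2_der1 Ca) (C2_der1 Cb) cb1 (C2_per0 Cb) (test_function_pderive dirx tpsi).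
    rewrite [pderive _ _]/= => ->.
    rewrite (parts_x K1_gt0 K2_gt0 (C2_der1 Ca) (C2_der2 Cb) ca1 (C2_per0 Ca) tpsi).
    by rewrite /= sqrrN expr1n mul1r opprK.
  + have [w wE] := tensor_L2 K1_gt0 K2_gt0 ca cb2.
    by exists w; exact: tensor_weak_yy.
Qed.

Lemma tensor_schroedinger (V : R -> R) (v g : L2) :
  (forall p, v p = a p.1 * b p.2) ->
  (forall p, g p = - (a2 p.1 * b p.2) - a p.1 * b2 p.2 + V p.1 * (a p.1 * b p.2)) ->
  schroedinger V v g.
Proof.
move=> vE gE; split; first exact: tensor_in_H2.
have [vxx vxxE] := tensor_L2 K1_gt0 K2_gt0 ca2 cb.
have [vyy vyyE] := tensor_L2 K1_gt0 K2_gt0 ca cb2.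
exists vxx, vyy; split; [exact: tensor_weak_xx|exact: tensor_weak_yy|].
by apply: aeW => p; rewrite gE vxxE vyyE vE.
Qed.

End Tensor.

Lemma nonzero_near (f : R -> R) (x K : R) : x < K -> continuous f -> f x != 0 ->
  exists2 e : R, x < e <= K & forall z, x <= z <= e -> f z != 0.
Proof.
move=> xK cf fx0.
have /cvgrPdist_lt/(_ `|f x|) := cf x; rewrite normr_gt0 => /(_ fx0)/nbhs_ballP[e /= e0 He].
exists (Num.min K (x + e / 2)); first by rewrite lt_min xK ltrDl divr_gt0 //= ge_min lexx.
move=> z /andP[z0]; rewrite le_min => /andP[_ ze].
have ze2 : `|x - z| < e.
  by rewrite distrC ger0_norm ?subr_ge0 //; move: ze e0; lra.
by apply/eqP => fz; have := He z ze2; rewrite fz subr0 ltxx.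
Qed.

(** If the norm were 0, the product would vanish almost everywhere, hence
    somewhere on a small rectangle at (x, y) on which neither factor
    vanishes. *)
Lemma tensor_norm_gt0 (a b : R -> R) (v : L2) (x y : R) : continuous a -> continuous b ->
  0 <= x < K1 -> 0 <= y < K2 -> a x != 0 -> b y != 0 -> (forall p, v p = a p.1 * b p.2) ->
  0 < fine ('N[mu]_2[EFin \o v])%E.
Proof.
move=> ca cb /andP[x0 xK] /andP[y0 yK] ax by0 vE.
rewrite lt_def fine_ge0 ?Lnorm_ge0 // andbT; apply/negP => /eqP N0.
have := @fine_Lnormr_eq0 _ _ _ mu _ (lee1n 2) v N0.
have [e1 /andP[xe1 e1K] He1] := nonzero_near xK ca ax.
have [e2 /andP[ye2 e2K] He2] := nonzero_near yK cb by0.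
pose B : set plane := `[x, e1] `*` `[y, e2].
have Bc : B `&` cell K1 K2 = B.
  apply/setIidl => -[s t] [/=]; rewrite !in_itv /= => /andP[s0 s1] /andP[t0 t1].
  split; rewrite /= in_itv /=.
    by rewrite (le_trans x0 s0) (le_trans s1 e1K).
  by rewrite (le_trans y0 t0) (le_trans t1 e2K).
case=> Z [mZ Z0 HZ].
have BZ : B `<=` Z.
  move=> [s t] [/=]; rewrite !in_itv /= => sI tI; apply: HZ => /= /(_ I).
  rewrite vE /= => /eqP; rewrite mulf_eq0 => /orP[] h.
    by move: (He1 _ sI); rewrite h.
  by move: (He2 _ tI); rewrite h.
have mB : measurable B by apply: measurableX; exact: measurable_itv.
have muB : mu B = ((e1 - x) * (e2 - y))%:E.
  rewrite (@cell_measureE R K1 K2) Bc.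
  have L (s t : R) : s < t -> (@lebesgue_measure R) `[s, t]%classic = (t - s)%:E.
    by move=> st; rewrite lebesgue_measure_itv /= lte_fin st.
  have -> : ((@lebesgue_measure R) \x (@lebesgue_measure R))%E B =
      (lebesgue_measure `[x, e1]%classic * lebesgue_measure `[y, e2]%classic)%E.
    by apply: product_measure1E; exact: measurable_itv.
  by rewrite !L // -EFinM.
have : (mu B <= mu Z)%E by apply: le_measure => //; rewrite inE.
by rewrite muB Z0 lee_fin leNgt mulr_gt0 ?subr_gt0.
Qed.

End Eigenvector.

(** * Instability from an eigenvector *)

(** The L2 norm of functions vanishes on functions that are null almost
    everywhere, so everything about semigroups holds up to seminorm 0. *)
Record seminorm {R : realType} {V : lmodType R} (N : V -> R) : Prop := {
  seminorm_ge0 : forall v, 0 <= N v ;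
  seminormD : forall u v, N (u + v) <= N u + N v ;
  seminormZ : forall c v, N (c *: v) = `|c| * N v }.

Section Seminorm.
Context {R : realType}.

Lemma euclid_triangle (a b c d : R) : 0 <= a -> 0 <= b -> 0 <= c -> 0 <= d ->
  Num.sqrt ((a + c) ^+ 2 + (b + d) ^+ 2) <=
  Num.sqrt (a ^+ 2 + b ^+ 2) + Num.sqrt (c ^+ 2 + d ^+ 2).
Proof.
move=> a0 b0 c0 d0.
set p := a ^+ 2 + b ^+ 2; set q := c ^+ 2 + d ^+ 2.
have p0 : 0 <= p by rewrite addr_ge0 ?sqr_ge0.
have q0 : 0 <= q by rewrite addr_ge0 ?sqr_ge0.
have cs : a * c + b * d <= Num.sqrt p * Num.sqrt q.
  rewrite -sqrtrM // -[leLHS]ger0_norm ?addr_ge0 ?mulr_ge0 // -sqrtr_sqr.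
  rewrite ler_sqrt ?mulr_ge0 // -subr_ge0.
  by rewrite (_ : _ - _ = (a * d - b * c) ^+ 2) ?sqr_ge0 // /p /q; ring.
rewrite -[leRHS]ger0_norm ?addr_ge0 ?sqrtr_ge0 // -sqrtr_sqr ler_sqrt ?sqr_ge0 //.
rewrite (sqrrD (Num.sqrt p)) !sqr_sqrtr //.
move: cs; rewrite /p /q !sqrrD !mulr2n; move: (Num.sqrt _ * Num.sqrt _) => z.
by lra.
Qed.

Lemma seminorm_pair (U V : lmodType R) (N : U -> R) (M : V -> R) :
  seminorm N -> seminorm M ->
  seminorm (fun v : U * V => Num.sqrt (N v.1 ^+ 2 + M v.2 ^+ 2)).
Proof.
move=> sN sM; split.
- by move=> v; exact: sqrtr_ge0.
- move=> u v; apply: le_trans (euclid_triangle _ _ _ _); try exact: seminorm_ge0.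
  rewrite ler_sqrt ?addr_ge0 ?sqr_ge0 //.
  by apply: lerD; rewrite lerXn2r ?nnegrE ?addr_ge0 ?seminorm_ge0 ?seminormD //;
    apply: seminorm_ge0.
- move=> c v; rewrite /= (seminormZ sN) (seminormZ sM) !exprMn -mulrDr.
  by rewrite sqrtrM ?sqr_ge0 // sqrtr_sqr normr_id.
Qed.

Variables (V : lmodType R) (N : V -> R) (sN : seminorm N).

Lemma seminorm0 : N 0 = 0.
Proof. by rewrite -[0](scale0r 0) (seminormZ sN) normr0 mul0r. Qed.

Lemma seminormN v : N (- v) = N v.
Proof. by rewrite -scaleN1r (seminormZ sN) normrN1 mul1r. Qed.

Lemma seminorm_dist u v : N u <= N v + N (u - v).
Proof. by rewrite -{1}[u](subrK v) addrC (seminormD sN). Qed.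

Lemma seminorm_congr u v : N (u - v) = 0 -> N u <= N v.
Proof. by move=> uv; have := seminorm_dist u v; rewrite uv addr0. Qed.

End Seminorm.

Section Instability.
Context {R : realType} {V : lmodType R}.
Variables (N : V -> R) (A : V -> V -> Prop).
Hypothesis sN : seminorm N.
Variables (v0 : V) (lam : R).
Hypotheses (lam0 : 0 < lam) (Nv0 : 0 < N v0).
Hypothesis Av0 : forall c : R, A (c *: v0) (c *: (lam *: v0)).

Local Notation n := (cnorm N).
Let sn : seminorm n := seminorm_pair sN sN.

Let x0 : V * V := (v0, 0).
Let nx0 : 0 < n x0.
Proof.
rewrite /cnorm /= (seminorm0 sN) expr0n addr0 sqrtr_sqr ger0_norm //.
exact: seminorm_ge0.
Qed.

Let Ax0 c : cgraph A (c *: x0) (c *: (lam *: x0)).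
Proof.
split=> /=; first exact: Av0.
have := Av0 0; rewrite !scale0r !scaler0 //.
Qed.

Lemma eigenvector_spectrally_unstable : spectrally_unstable N A.
Proof.
move=> /(_ (Complex lam 0)) st.
have : resolvent_set N A (Complex lam 0).
  by apply: contrapT => /st /=; rewrite leNgt lam0.
move=> [_ [C /(_ x0 (lam *: x0))]].
have := Ax0 1; rewrite !scale1r => h /(_ h).
have -> : @Defs.cscale R V (Complex lam 0) x0 - lam *: x0 = 0.
  rewrite /Defs.cscale /= !scaler0 !scale0r subr0 addr0.
  by apply/eqP; rewrite subr_eq0; apply/eqP; congr pair; rewrite scaler0.
by rewrite (seminorm0 sn) mulr0 leNgt nx0.
Qed.

Section Semigroup.
Variable S : R -> V * V -> V * V.
Hypotheses (S_semi : C0_semigroup N S) (S_gen : generates N A S).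
Variables (M : R).
Hypothesis M1 : 1 <= M.
Hypothesis S_bnd : forall t, 0 <= t -> forall v, n (S t v) <= M * expR (lam / 2 * t) * n v.

(** One step S h multiplies x0 by r = 1 + lam h up to a defect d, so k steps
    multiply it by r^k up to the sum of the r^(k-1-j) S (j h) d, which the
    growth bound turns into a geometric sum. *)
Lemma semigroup_power_defect h k r s : 0 <= h ->
  r = 1 + lam * h -> s = expR (lam / 2 * h) -> s < r ->
  n (S (k%:R * h) x0 - r ^+ k *: x0) <=
    M * n (S h x0 - r *: x0) * ((r ^+ k - s ^+ k) / (r - s)).
Proof.
move=> h0 rE sE sr; have rs0 : 0 < r - s by rewrite subr_gt0.
have r0 : 0 < r by apply: lt_trans sr; rewrite sE expR_gt0.
elim: k => [|k IH].
  by rewrite mul0r !expr0 scale1r (semigroup_0 S_semi) subrr mul0r mulr0.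
have kh0 : 0 <= k%:R * h by rewrite mulr_ge0.
set d := S h x0 - r *: x0.
have e1 := semigroup_add S_semi kh0 h0 x0.
have e2 := semigroup_linear S_semi kh0 (Complex r 0) x0 d.
have cs (u : V * V) : @Defs.cscale R V (Complex r 0) u = r *: u.
  by rewrite /Defs.cscale /= !scale0r subr0 add0r; case: u.
have e3 : @Defs.cscale R V (Complex r 0) x0 + d = S h x0 by rewrite cs /d addrC subrK.
rewrite e3 cs in e2.
have -> : k.+1%:R * h = k%:R * h + h by rewrite mulrSr mulrDl mul1r.
have b1 : n (S (k%:R * h + h) x0 - r ^+ k.+1 *: x0) <=
    n (r *: (S (k%:R * h) x0 - r ^+ k *: x0) + S (k%:R * h) d).
  apply: (seminorm_congr sn).
  rewrite scalerBr scalerA -exprS; apply/le_anti; rewrite (seminorm_ge0 sn) andbT.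
  rewrite -[leRHS]addr0 -{1}e1 -e2.
  have V3 (a u X w z : V * V) : a - X - (w - X + z) = (a - u) + (u - (w + z)).
    by rewrite [w - X + z]addrAC opprB !addrA !subrK.
  by rewrite (V3 _ (S (k%:R * h) (S h x0))) (seminormD sn).
apply: le_trans b1 _; apply: le_trans (seminormD sn _ _) _.
rewrite (seminormZ sn) (ger0_norm (ltW r0)).
have b2 : n (S (k%:R * h) d) <= M * s ^+ k * n d.
  apply: le_trans (S_bnd kh0 d) _; rewrite le_eqVlt; apply/orP; left; apply/eqP.
  congr (_ * _ * _); rewrite sE -expRM_natl; congr expR; ring.
have b3 : r * n (S (k%:R * h) x0 - r ^+ k *: x0) <= r * (M * n d * ((r ^+ k - s ^+ k) / (r - s))).
  by rewrite ler_pM2l.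
apply: le_trans (lerD b3 b2) _; rewrite le_eqVlt; apply/orP; left; apply/eqP.
rewrite !exprS; field.
by rewrite gt_eqF.
Qed.

(** Divide the bound for k steps by r^k and let k grow: as s < r, the term S
    (k h) x0 disappears and the size of x0 is controlled by the defect of a
    single step. *)
Lemma semigroup_step_defect h : 0 < h -> expR (lam / 2 * h) < 1 + lam * h ->
  n x0 * (1 + lam * h - expR (lam / 2 * h)) <= M * n (S h x0 - (1 + lam * h) *: x0).
Proof.
move=> h0; set r := 1 + lam * h; set s := expR _ => sr.
have s0 : 0 < s := expR_gt0 _.
have r0 : 0 < r := lt_trans s0 sr.
have rs0 : 0 < r - s by rewrite subr_gt0.
have M0 : 0 < M by apply: lt_le_trans M1.
set d := n (S h x0 - _).
have d0 : 0 <= d := seminorm_ge0 sn _.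
have key k : n x0 <= M * n x0 * (s / r) ^+ k + M * d / (r - s).
  have kh0 : 0 <= k%:R * h by rewrite mulr_ge0 // ltW.
  have a1 := semigroup_power_defect k (ltW h0) erefl erefl sr; rewrite -/r -/s -/d in a1.
  have a2 : n (S (k%:R * h) x0) <= M * s ^+ k * n x0.
    apply: le_trans (S_bnd kh0 x0) _; rewrite le_eqVlt; apply/orP; left; apply/eqP.
    congr (_ * _ * _); rewrite /s -expRM_natl; congr expR; ring.
  have a3 : r ^+ k * n x0 <= n (S (k%:R * h) x0) + n (S (k%:R * h) x0 - r ^+ k *: x0).
    have := seminorm_dist sn (r ^+ k *: x0) (S (k%:R * h) x0).
    by rewrite (seminormZ sn) ger0_norm ?exprn_ge0 ?(ltW r0) // -opprB (seminormN sn).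
  have rk : 0 < r ^+ k by rewrite exprn_gt0.
  rewrite -(ler_pM2l rk); apply: le_trans a3 _; apply: le_trans (lerD a2 a1) _.
  have -> : r ^+ k * (M * n x0 * (s / r) ^+ k + M * d / (r - s)) =
     M * s ^+ k * n x0 + M * d * (r ^+ k / (r - s)).
    rewrite expr_div_n; field.
    by rewrite !gt_eqF.
  rewrite lerD2l; apply: ler_wpM2l; first by rewrite mulr_ge0 // ltW.
  by rewrite ler_wpM2r ?invr_ge0 ?(ltW rs0) // gerBl exprn_ge0 // ltW.
have lim : (M * n x0 * (s / r) ^+ k + M * d / (r - s)) @[k --> \oo] --> M * n x0 * 0 + M * d / (r - s).
  apply: cvgD; last exact: cvg_cst.
  apply: cvgM; first exact: cvg_cst.
  by apply: cvg_expr; rewrite ger0_norm ?divr_ge0 ?(ltW s0) ?(ltW r0) // ltr_pdivrMr // mul1r.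
have : n x0 <= M * n x0 * 0 + M * d / (r - s).
  by apply: (cvgr_to_ge (f := fun k : nat => M * n x0 * (s / r) ^+ k + M * d / (r - s)) lim); apply: nearW.
by rewrite mulr0 add0r ler_pdivlMr.
Qed.

(** As x0 lies in the domain of the generator, the defect of the step h is
    o(h), whereas by semigroup_step_defect it is at least of the order of h. *)
Lemma semigroup_growth_contradiction : False.
Proof.
have := Ax0 1; rewrite !scale1r => /(S_gen _ _).1 /cvgrPdist_lt.
have M0 : 0 < M by apply: lt_le_trans M1.
have e0 : 0 < n x0 * lam / (4 * M) by rewrite divr_gt0 ?mulr_gt0.
move=> /(_ _ e0) near_h.
have [h [h0 hl Hh]] : exists h : R, [/\ 0 < h, lam * h <= 2^-1 &
    n (h^-1 *: (S h x0 - x0) - lam *: x0) < n x0 * lam / (4 * M)].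
  near (0 : R)^'+ => h; exists h; split => //.
    rewrite -ler_pdivlMl // mulrC; near: h; apply: nbhs_right_le.
    by rewrite divr_gt0 ?invr_gt0.
  have : `|0 - n (h^-1 *: (S h x0 - x0) - lam *: x0)| < n x0 * lam / (4 * M).
    by near: h; exact: near_h.
  by rewrite sub0r normrN ger0_norm // (seminorm_ge0 sn).
pose s := lam * h / 2.
have s0 : 0 < s by rewrite /s divr_gt0 ?mulr_gt0.
have s14 : s <= 4^-1 by rewrite /s; lra.
(* From expR s <= 1 / (1 - s); the slope 3 / 2 < 2 suffices, since 1 + lam h
   = 1 + 2 s. *)
have Es : expR s <= 1 + 3 / 2 * s.
  have e1 : 1 - s <= expR (- s) by exact: expR_ge1Dx.
  have : expR s * (1 - s) <= 1.
    by rewrite -[leRHS]expR0 -(subrr s) expRD; exact: (ler_wpM2l (expR_ge0 s) e1).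
  move: (expR s) (expR_ge0 s) => e ege0 h1.
  have : (1 - s) * (e - (1 + 3 / 2 * s)) <= 0 by nra.
  have : 0 < 1 - s by lra.
  by move=> h2; rewrite (pmulr_rle0 _ h2); lra.
have sE : lam / 2 * h = s by rewrite /s; field.
have rE : 1 + lam * h = 1 + 2 * s by rewrite /s; field.
have lt_sr : expR (lam / 2 * h) < 1 + lam * h by rewrite sE rE; lra.
have := semigroup_step_defect h0 lt_sr.
have -> : S h x0 - (1 + lam * h) *: x0 = h *: (h^-1 *: (S h x0 - x0) - lam *: x0).
  rewrite scalerBr scalerA divff ?gt_eqF // scale1r scalerA scalerDl scale1r.
  by rewrite opprD addrA [lam * h]mulrC.
rewrite (seminormZ sn) (gtr0_norm h0) leNgt => /negP; apply.
have h1 : M * (h * n (h^-1 *: (S h x0 - x0) - lam *: x0)) < M * (h * (n x0 * lam / (4 * M))).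
  by rewrite !ltr_pM2l.
apply: lt_le_trans h1 _.
have -> : M * (h * (n x0 * lam / (4 * M))) = n x0 * (s / 2).
  by rewrite /s; field; rewrite gt_eqF.
by rewrite ler_pM2l // sE rE; lra.
Unshelve. all: by end_near. Qed.

End Semigroup.

Lemma eigenvector_not_linearly_stable : ~ linearly_stable N A.
Proof.
move=> [S [S_semi S_gen gb]].
have [_ [b [M HM <-]] bl] : exists2 y, [set b%:E | b in [set b : R | exists M : R, forall t, 0 <= t ->
    forall v, n (S t v) <= M * expR (b * t) * n v]] y & (y < (lam / 2)%:E)%E.
  apply/ereal_inf_lt; apply: le_lt_trans gb _.
  by rewrite lte_fin divr_gt0.
rewrite lte_fin in bl.
apply: (@semigroup_growth_contradiction S S_semi S_gen (Num.max M 1)).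
  by rewrite le_max lexx orbT.
move=> t t0 v; apply: le_trans (HM t t0 v) _.
apply: ler_wpM2r; first exact: (seminorm_ge0 sn).
apply: (@le_trans _ _ (Num.max M 1 * expR (b * t))).
  by rewrite ler_wpM2r ?expR_ge0 // le_max lexx.
rewrite ler_wpM2l ?le_max ?ler01 ?orbT // ler_expR ler_wpM2r //.
exact: ltW.
Qed.

Lemma expR_lam_der (t : R) : is_derive t 1 (fun t => expR (lam * t)) (lam * expR (lam * t)).
Proof.
apply: (der_eq (@der_comp _ expR (fun y => lam * y) t _ _ (is_derive_expR _) (derZ lam (derI t)))).
by rewrite mulr1 mulrC.
Qed.

(** The solution expR (lam t) x0, whose integral from 0 is E t x0. *)
Lemma eigenvector_not_stable_solutions : ~ linearly_stable_solutions N A.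
Proof.
pose E (t : R) := lam^-1 * (expR (lam * t) - 1).
have dE (t : R) : is_derive t 1 E (expR (lam * t)).
  apply: (der_eq (derZ lam^-1 (derB (expR_lam_der t) (derC 1 t)))).
  by rewrite subr0 mulKf // gt_eqF.
have sol : linear_solution N A (fun t => expR (lam * t) *: x0).
  exists (fun t => E t *: x0); split.
    by rewrite /E mulr0 expR0 subrr mulr0 scale0r (seminorm0 sn).
  move=> t t0; split.
  - have H : `|expR (lam * s) - expR (lam * t)| * n x0 @[s --> t] -->
        `|expR (lam * t) - expR (lam * t)| * n x0.
      apply: cvgM; last exact: cvg_cst.
      apply: cvg_norm; apply: cvgB; last exact: cvg_cst.
      exact: (der_cont (expR_lam_der t)).
    rewrite subrr normr0 mul0r in H.
    apply: cvg_within_filter; apply: cvg_trans H; apply: near_eq_cvg; near=> s.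
    by rewrite -scalerBl (seminormZ sn).
  - apply: cvg_within_filter.
    have /is_derive1_caratheodory [g [gE cg gt]] := dE t.
    have H : `|g s - expR (lam * t)| * n x0 @[s --> t^'] -->
        `|g t - expR (lam * t)| * n x0.
      apply: cvgM; last exact: cvg_cst.
      apply: cvg_norm; apply: cvgB; last exact: cvg_cst.
      by apply: cvg_within_filter; exact: cg.
    rewrite gt subrr normr0 mul0r in H.
    apply: cvg_trans H; apply: near_eq_cvg; near=> s.
    have st : s - t != 0.
      by rewrite subr_eq0; near: s; exact: nbhs_dnbhs_neq.
    have gs : (s - t)^-1 * (g s * (s - t)) = g s by rewrite mulrC mulfK.
    by rewrite -scalerBl scalerA gE gs -scalerBl (seminormZ sn).
  - have -> : expR (lam * t) *: x0 - expR (lam * 0) *: x0 = E t *: (lam *: x0).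
      rewrite mulr0 expR0 -scalerBl scalerA /E; congr (_ *: _).
      by rewrite mulrAC mulVf ?mul1r // gt_eqF.
    exact: Ax0.
move=> /(_ _ sol (lam / 2)); rewrite divr_gt0 // => /(_ isT) /cvgrPdist_lt /(_ _ nx0) H.
have [t [t0 Ht]] : exists t : R, 0 <= t /\
    `|0 - expR (- (lam / 2 * t)) * n (expR (lam * t) *: x0)| < n x0.
  near (+oo_R) => t; exists t; split; near: t; first by apply: nbhs_pinfty_ge; exact: num_real.
  exact: H.
move: Ht; rewrite sub0r normrN (seminormZ sn) (ger0_norm (expR_ge0 _)) mulrA -expRD.
have -> : - (lam / 2 * t) + lam * t = lam / 2 * t by field.
rewrite ger0_norm ?mulr_ge0 ?expR_ge0 ?(ltW nx0) //.
rewrite ltNge => /negP; apply.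
rewrite -[leLHS]mul1r; apply: ler_wpM2r; first exact: ltW.
by rewrite -expR0 ler_expR mulr_ge0 // divr_ge0 // ltW.
Unshelve. all: by end_near. Qed.

Theorem eigenvector_unstable : spectrally_unstable N A /\ linearly_unstable N A.
Proof.
split; first exact: eigenvector_spectrally_unstable.
split; [exact: eigenvector_not_linearly_stable|exact: eigenvector_not_stable_solutions].
Qed.

End Instability.

(** * From the shooting problem to the torus *)

Section Wave.
Context {R : realType}.

Lemma L2norm_seminorm (K1 K2 : R) : seminorm (@L2norm R K1 K2).
Proof.
have H : seminorm (fun v : LfunType (cell_measure K1 K2) (lee1n 2) =>
    fine ('N[cell_measure K1 K2]_2[EFin \o v])%E).
  split.
  - by move=> v; rewrite fine_ge0 // Lnorm_ge0.
  - by move=> u v; exact: ler_LnormD.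
  - by move=> c v; apply: EFin_inj; rewrite EFinM !finite_norm_fine; exact: LnormZ.
exact: (seminorm_pair H H).
Qed.

Lemma periodic_int (f : R -> R) (T : R) : (forall x, f (x + T) = f x) ->
  forall (z : int) x, f (x + z%:~R * T) = f x.
Proof.
move=> fT.
have N (n : nat) x : f (x + n%:R * T) = f x.
  elim: n => [|n IH]; first by rewrite mul0r addr0.
  by rewrite mulrSr mulrDl mul1r addrA fT IH.
move=> [n|n] x; first by rewrite -pmulrn N.
by rewrite NegzE mulrNz mulNr -[in RHS](subrK (n.+1%:~R * T) x) -pmulrn N.
Qed.

Lemma floor_shift (x T : R) : 0 < T -> exists z : int, 0 <= x + z%:~R * T < T.
Proof.
move=> T0; exists (- Num.floor (x / T)).
have /andP[h1 h2] := mem_rg1_floor (x / T).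
rewrite mulrNz mulNr; apply/andP; split.
  by rewrite subr_ge0 -ler_pdivlMr.
by rewrite ltrBlDl; move: h2; rewrite ltr_pdivrMr // mulrDl mul1r.
Qed.

(** The periodic solution of the shooting problem, translated by x0 and
    multiplied by cos (q y) with q^2 = mu, is an eigenvector on the torus
    with K2 = 2 pi / q for the eigenvalue lam > 0. *)
Theorem wave_unstable (f : R -> R) (omega : R) (phi : R -> R) (h x0 M : R)
    (Vm Vp p p' chi chi' : R -> R) (nu2 m : R) :
  0 < h ->
  (forall x, potential_plus f omega phi x = Vp (x - x0)) ->
  (forall x, potential_minus f omega phi x = Vm (x - x0)) ->
  continuous Vm -> continuous Vp -> 0 <= M ->
  (forall x, `|Vm x| <= M) -> (forall x, `|Vp x| <= M) ->
  (forall x, Vm (- x) = Vm x) -> (forall x, Vm (2 * h - x) = Vm x) ->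
  (forall x, Vp (- x) = Vp x) -> (forall x, Vp (2 * h - x) = Vp x) ->
  (forall x, 0 < p x) -> (forall x : R, is_derive x 1 p (p' x)) ->
  (forall x : R, is_derive x 1 p' (Vp x * p x)) -> p' 0 = 0 -> p' h = 0 ->
  0 < m -> (forall x, m <= chi x) -> (forall x : R, is_derive x 1 chi (chi' x)) ->
  0 < nu2 -> (forall x : R, is_derive x 1 chi' ((Vm x + nu2) * chi x)) ->
  chi' 0 = 0 -> chi' h = 0 ->
  exists K2, [/\ 0 < K2, spectrally_unstable_wave f omega phi (2 * h) K2
    & linearly_unstable_wave f omega phi (2 * h) K2].
Proof.
move=> h0 VpE VmE cVm cVp M0 Vmb Vpb Vme Vmh Vpe Vph p0 dp dp' p'0 p'h m0 chim dchi nu0 dchi' chi'0 chi'h.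
have [lam [mu [Y [lam0 mu0 sY perY [c Yc]]]]] :=
  @shooting R Vm Vp M cVm cVp M0 Vmb Vpb h h0 p p' chi chi' nu2 m Vme Vmh Vpe Vph p0 dp dp' p'0 p'h m0 chim dchi nu0 dchi' chi'0 chi'h.
pose q := Num.sqrt mu.
have q0 : 0 < q by rewrite sqrtr_gt0.
have q2 : q ^+ 2 = mu by rewrite sqr_sqrtr // ltW.
pose K2 := 2 * pi / q.
have K20 : 0 < K2 by rewrite divr_gt0 ?mulr_gt0 ?pi_gt0.
have K10 : 0 < 2 * h by rewrite mulr_gt0.
pose b y : R := cos (q * y); pose b1 y : R := - q * sin (q * y); pose b2 y : R := - mu * b y.
have dq (y : R) : is_derive y 1 (fun y => q * y) q.
  by apply: (der_eq (derZ q (derI y))); rewrite mulr1.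
have Cb : C2_periodic K2 b b1 b2.
  have qK : q * K2 = pi *+ 2 by rewrite /K2 mulrC divfK ?gt_eqF // mulr_natl.
  have db (y : R) : is_derive y 1 b (b1 y).
    by apply: (der_eq (der_comp (g := fun y => q * y) (is_derive_cos _) (dq y))); rewrite /b1; ring.
  split.
  - exact: db.
  - move=> y; apply: (der_eq (derZ (- q) (der_comp (g := fun y => q * y) (is_derive_sin _) (dq y)))).
    by rewrite /b2 /b -q2; ring.
  - by move=> y; apply: cvgM; [exact: cvg_cst|exact: (der_continuous db)].
  - by rewrite /b qK mulr0 cos2pi cos0.
  - by rewrite /b1 qK mulr0 sin2pi sin0.
have cb := der_continuous (C2_der1 Cb).
pose a i x := Y (i, true) (x - x0).
pose a1 i x := Y (i, false) (x - x0).
pose a2 (i : bool) x := if i then (Vm (x - x0) + mu) * a true x - lam * a false x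
  else (Vp (x - x0) + mu) * a false x + lam * a true x.
have shift_der (g : R -> R) (x d : R) : is_derive (x - x0) 1 g d -> is_derive x 1 (fun x => g (x - x0)) d.
  move=> gd; apply: (der_eq (der_comp (g := fun x => x - x0) gd (derB (derI x) (derC x0 x)))).
  by rewrite subr0 mulr1.
have shift_cont (g : R -> R) : continuous g -> continuous (fun x => g (x - x0)).
  move=> cg x; apply: (@continuous_comp _ _ _ (fun x => x - x0) g); last exact: cg.
  exact: (der_cont (derB (derI x) (derC x0 x))).
have da i (x : R) : is_derive x 1 (a i) (a1 i x).
  apply: shift_der; have [h1 _ h3 _] := (systemP Vm Vp lam mu Y).1 sY (x - x0).
  by case: i.
have ca i := der_continuous (da i).
have Ca i : C2_periodic (2 * h) (a i) (a1 i) (a2 i).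
  split.
  - exact: da.
  - move=> x; have [_ h2 _ h4] := (systemP Vm Vp lam mu Y).1 sY (x - x0).
    by case: i; apply: shift_der.
  - have cs V := shift_cont V; move=> x.
    case: i; rewrite /a2.
      apply: cvgB; apply: cvgM; [|exact: ca|exact: cvg_cst|exact: ca].
      by apply: cvgD; [exact: (cs Vm)|exact: cvg_cst].
    apply: cvgD; apply: cvgM; [|exact: ca|exact: cvg_cst|exact: ca].
    by apply: cvgD; [exact: (cs Vp)|exact: cvg_cst].
  - by rewrite /a [2 * h - x0]addrC perY sub0r.
  - by rewrite /a1 [2 * h - x0]addrC perY sub0r.
have [v1 v1E] := tensor_L2 K10 K20 (ca true) cb.
have [v2 v2E] := tensor_L2 K10 K20 (ca false) cb.
have Av s : linearization f omega phi (s *: (v1, v2)) (s *: (lam *: (v1, v2))).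
  split.
    apply: (tensor_schroedinger K10 K20 (C2_scale s (Ca false)) Cb).
      by move=> z; transitivity (s * v2 z) => //; rewrite v2E mulrA.
    move=> z; transitivity (- (s * (lam * v1 z))) => //; rewrite v1E VpE /a2 /b2; ring.
  apply: (tensor_schroedinger K10 K20 (C2_scale s (Ca true)) Cb).
    by move=> z; transitivity (s * v1 z) => //; rewrite v1E mulrA.
  move=> z; transitivity (s * (lam * v2 z)) => //; rewrite v2E VmE /a2 /b2; ring.
have Nv : 0 < L2norm (v1, v2).
  (* The translated solution does not vanish at x0; the point x0 + z * (2 h)
     is congruent to x0 and lies in the cell. *)
  have [z zI] := floor_shift x0 K10.
  have az : a c (x0 + z%:~R * (2 * h)) != 0.
    by rewrite /a [x0 + _]addrC addrK -[_ * _]add0r (periodic_int (perY (c, true))).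
  have bz : b 0 != 0 by rewrite /b mulr0 cos0 oner_eq0.
  have K20' : 0 <= (0 : R) < K2 by apply/andP; split.
  rewrite /L2norm sqrtr_gt0 /=.
  case: c Yc az => _ az.
    have n1 := tensor_norm_gt0 (ca true) cb zI K20' az bz v1E.
    by apply: ltr_pwDl; [exact: exprn_gt0 | exact: sqr_ge0].
  have n2 := tensor_norm_gt0 (ca false) cb zI K20' az bz v2E.
  by apply: ltr_wpDl; [exact: sqr_ge0 | exact: exprn_gt0].
exists K2; split=> //.
  exact: (eigenvector_unstable (L2norm_seminorm _ _) lam0 Nv Av).1.
exact: (eigenvector_unstable (L2norm_seminorm _ _) lam0 Nv Av).2.
Qed.

End Wave.

(** * Standing waves and the function dn *)

Section StandingWave.
Context {R : realType}.

Lemma complex_der (u : R -> R[i]) (g h : R -> R) (t a b : R) :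
  u = (fun s => Complex (g s) (h s)) ->
  is_derive t 1 g a -> is_derive t 1 h b ->
  cderivable u t /\ cderive u t = Complex a b.
Proof.
move=> -> ga hb; split; first by split; [case: ga|case: hb].
by rewrite /cderive /= (der_derive1 ga) (der_derive1 hb).
Qed.

Lemma standing_waveE omega (phi : R -> R) t x y : standing_wave omega phi t x y =
  Complex (cos (- (omega * t)) * phi x) (sin (- (omega * t)) * phi x).
Proof. by rewrite /standing_wave /=; apply/eqP; rewrite eq_complex /=; apply/andP; split; apply/eqP; ring. Qed.

Lemma standing_wave_solution (f : R -> R) omega (phi phi' : R -> R) T K2 :
  (forall x : R, is_derive x 1 phi (phi' x)) ->
  (forall x : R, is_derive x 1 phi' (omega * phi x - f (phi x ^+ 2) * phi x)) ->
  (forall x, phi (x + T) = phi x) ->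
  nls_solution f T K2 (standing_wave omega phi).
Proof.
move=> d1 d2 per; split; first by move=> t x y; rewrite !standing_waveE per.
move=> t x y _.
set c := cos (- (omega * t)); set s := sin (- (omega * t)).
have dm (r : R) : is_derive r 1 (fun r => - (omega * r)) (- omega).
  by apply: (der_eq (derN (derZ omega (derI r)))); rewrite mulr1.
have [ct Ct] : cderivable (fun s => standing_wave omega phi s x y) t /\
    cderive (fun s => standing_wave omega phi s x y) t = Complex (omega * s * phi x) (- (omega * c * phi x)).
  apply: (@complex_der _ (fun r => cos (- (omega * r)) * phi x) (fun r => sin (- (omega * r)) * phi x)).
  - by apply/funext => r; rewrite standing_waveE.
  - apply: (der_eq (derM (der_comp (g := fun r => - (omega * r)) (is_derive_cos _) (dm t)) (derC (phi x) t))).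
    by rewrite /s; ring.
  - apply: (der_eq (derM (der_comp (g := fun r => - (omega * r)) (is_derive_sin _) (dm t)) (derC (phi x) t))).
    by rewrite /c; ring.
have X1 (r : R) : cderivable (fun r => standing_wave omega phi t r y) r /\
    cderive (fun r => standing_wave omega phi t r y) r = Complex (c * phi' r) (s * phi' r).
  apply: complex_der (derZ c (d1 r)) (derZ s (d1 r)).
  by apply/funext => z; rewrite standing_waveE.
have X2 (r : R) : cderivable (cderive (fun r => standing_wave omega phi t r y)) r /\
    cderive (cderive (fun r => standing_wave omega phi t r y)) r =
    Complex (c * (omega * phi r - f (phi r ^+ 2) * phi r)) (s * (omega * phi r - f (phi r ^+ 2) * phi r)).
  apply: complex_der (derZ c (d2 r)) (derZ s (d2 r)).
  by apply/funext => z; rewrite (X1 z).2.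
have Y1 (r : R) : cderivable (fun r => standing_wave omega phi t x r) r /\
    cderive (fun r => standing_wave omega phi t x r) r = Complex 0 0.
  apply: complex_der (derC (c * phi x) r) (derC (s * phi x) r).
  by apply/funext => z; rewrite standing_waveE.
have Y2 (r : R) : cderivable (cderive (fun r => standing_wave omega phi t x r)) r /\
    cderive (cderive (fun r => standing_wave omega phi t x r)) r = Complex 0 0.
  apply: complex_der (derC 0 r) (derC 0 r).
  by apply/funext => z; rewrite (Y1 z).2.
split.
- exact: ct.
- by split=> r; [exact: (X1 r).1|exact: (X2 r).1].
- by split=> r; [exact: (Y1 r).1|exact: (Y2 r).1].
rewrite Ct (X2 x).2 (Y2 y).2 standing_waveE -/c -/s /=.
have -> : (c * phi x) ^+ 2 + (s * phi x) ^+ 2 = phi x ^+ 2.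
  by rewrite !exprMn -mulrDl /c /s cos2Dsin2 mul1r.
by apply/eqP; rewrite eq_complex /=; apply/andP; split; apply/eqP; ring.
Qed.

End StandingWave.

Section DnWave.
Context {R : realType}.
Variables (k al : R).
Hypotheses (k0 : 0 < k) (k1 : k < 1) (al0 : 0 < al).

(** With D = dn (al x), a = al^2 and l = 1 - k^2, one has D'^2 = a (1 - D^2)
    (D^2 - l). Both families of standing waves, and the ground states of
    their operators L_-, are polynomials in D, so that all differential
    equations below reduce to polynomial identities in D. *)
Let a := al ^+ 2.
Let l := 1 - k ^+ 2.
Let a0 : 0 < a. Proof. exact: exprn_gt0. Qed.
Let l0 : 0 < l. Proof. by rewrite subr_gt0 expr_lt1 // ltW. Qed.
Let l1 : l < 1. Proof. by rewrite gtrBl exprn_gt0. Qed.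

Definition dn_wave (x : R) : R := jacobi_dn k (al * x).
Definition dn_wave' (x : R) : R := - al * k ^+ 2 * (jacobi_sn k (al * x) * jacobi_cn k (al * x)).
Local Notation D := dn_wave.
Local Notation E := dn_wave'.

Let dal (x : R) : is_derive x 1 (fun x => al * x) al.
Proof. by apply: (der_eq (derZ al (derI x))); rewrite mulr1. Qed.

Lemma dn_wave_der (x : R) : is_derive x 1 D (E x).
Proof.
apply: (der_eq (der_comp (g := fun x => al * x) (jacobi_dn_der k0 k1 (al * x)) (dal x))).
by rewrite /dn_wave'; ring.
Qed.

Lemma dn_wave_sn2 x : k ^+ 2 * jacobi_sn k (al * x) ^+ 2 = 1 - D x ^+ 2.
Proof. by rewrite /dn_wave jacobi_dn2 //; ring. Qed.

Lemma dn_wave'_der (x : R) : is_derive x 1 E (a * D x * (1 + l - 2 * D x ^+ 2)).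
Proof.
apply: (der_eq (derZ (- al * k ^+ 2) (derM
  (der_comp (g := fun x => al * x) (jacobi_sn_der k0 k1 (al * x)) (dal x))
  (der_comp (g := fun x => al * x) (jacobi_cn_der k0 k1 (al * x)) (dal x))))).
rewrite /dn_wave /=.
transitivity (- al ^+ 2 * jacobi_dn k (al * x) * (k ^+ 2 * jacobi_cn k (al * x) ^+ 2 - k ^+ 2 * jacobi_sn k (al * x) ^+ 2)); first ring.
by rewrite jacobi_cn2 // [k ^+ 2 * (1 - _)]mulrBr dn_wave_sn2 /dn_wave /a /l; ring.
Qed.

Lemma dn_wave'_sqr x : E x ^+ 2 = a * (1 - D x ^+ 2) * (D x ^+ 2 - l).
Proof.
transitivity (a * (k ^+ 2 * jacobi_sn k (al * x) ^+ 2) * (k ^+ 2 * jacobi_cn k (al * x) ^+ 2)).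
  by rewrite /dn_wave' /a; ring.
by rewrite jacobi_cn2 // [k ^+ 2 * (1 - _)]mulrBr dn_wave_sn2 /l; ring.
Qed.

Lemma dn_wave_gt0 x : 0 < D x. Proof. exact: jacobi_dn_gt0. Qed.

Lemma dn_wave_sqr_le1 x : D x ^+ 2 <= 1.
Proof. by rewrite -subr_ge0 -dn_wave_sn2 mulr_ge0 ?sqr_ge0. Qed.

Lemma dn_wave_sqr_ge x : l <= D x ^+ 2.
Proof.
have := dn_wave_sn2 x; rewrite /l.
have : k ^+ 2 * jacobi_sn k (al * x) ^+ 2 <= k ^+ 2 by rewrite ler_piMr ?sqr_ge0 ?sin2_le1.
by lra.
Qed.

Lemma dn_wave_le1 x : D x <= 1.
Proof. by have := dn_wave_sqr_le1 x; rewrite -[X in _ <= X -> _](expr1n _ 2) ler_pXn2r ?nnegrE // ltW // dn_wave_gt0. Qed.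

Lemma dn_wave_ge x : l <= D x.
Proof.
apply: le_trans (dn_wave_sqr_ge x) _; rewrite expr2 ler_piMr ?dn_wave_le1 //.
exact: ltW (dn_wave_gt0 x).
Qed.

Definition half_period : R := ellipticK k / al.
Local Notation h := half_period.

Lemma half_period_gt0 : 0 < h.
Proof. by rewrite divr_gt0 // ellipticK_gt0. Qed.

Let alh : al * (2 * h) = 2 * ellipticK k.
Proof. by rewrite /h; field; rewrite gt_eqF. Qed.

Lemma dn_wave_even x : D (- x) = D x.
Proof. by rewrite /dn_wave mulrN jacobi_dn_even. Qed.

Lemma dn_wave_period x : D (x + 2 * h) = D x.
Proof. by rewrite /dn_wave mulrDr alh jacobi_dn_period. Qed.

Lemma dn_wave_reflect x : D (2 * h - x) = D x.
Proof. by rewrite addrC dn_wave_period dn_wave_even. Qed.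

Lemma dn_wave'0 : E 0 = 0.
Proof.
rewrite /dn_wave' /jacobi_sn mulr0 -{1}(ellipticF0 k) ellipticFK //.
by rewrite sin0 mul0r mulr0.
Qed.

Lemma dn_wave'h : E h = 0.
Proof.
have e : al * h = ellipticK k by rewrite /half_period mulrC divfK ?gt_eqF.
by rewrite /dn_wave' e /jacobi_cn ellipticK_eq_F // ellipticFK // cos_pihalf !mulr0.
Qed.

Lemma dn_wave_sqr_cont : continuous (fun x => D x ^+ 2).
Proof.
apply: (@der_continuous _ _ (fun x => 2 * D x ^+ 1 * E x)) => x.
exact: (derX 2 (dn_wave_der x)).
Qed.

Lemma cnoidal_der (c : R) (x : R) :
  is_derive x 1 (fun x => c + 6 * a * D x ^+ 2) (12 * a * (D x * E x)).
Proof.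
apply: (der_eq (derD (derC c x) (derZ (6 * a) (derX 2 (dn_wave_der x))))).
by rewrite expr1; ring.
Qed.

Lemma cnoidal_der2 (c omega x : R) : omega = 2 * c + 4 * a * (1 + l) ->
  c * (omega - c) = - (12 * a ^+ 2 * l) ->
  is_derive x 1 (fun x => 12 * a * (D x * E x))
    ((omega - (c + 6 * a * D x ^+ 2)) * (c + 6 * a * D x ^+ 2)).
Proof.
move=> h1 h2.
apply: (der_eq (derZ (12 * a) (derM (dn_wave_der x) (dn_wave'_der x)))).
rewrite -[E x * E x]expr2 dn_wave'_sqr.
have -> : (omega - (c + 6 * a * D x ^+ 2)) * (c + 6 * a * D x ^+ 2) =
  c * (omega - c) + 6 * a * (omega - 2 * c) * D x ^+ 2 - 36 * a ^+ 2 * D x ^+ 4 by ring.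
by rewrite h2 h1; ring.
Qed.

(** The wave is p = c + 6 a D^2. Here omega - 2 p is a Lame potential with n
    = 3, and its ground state is D (D^2 + b) with b the larger root of 5 b^2
    + 4 (1 + l) b + 3 l; this root is above - l, which makes D^2 + b
    positive, and gives the positive value nu2 = 5 a (1 + l + 2 b). *)
Theorem cnoidal_unstable (f : R -> R) (c omega : R) (phi : R -> R) :
  omega = 2 * c + 4 * a * (1 + l) -> c * (omega - c) = - (12 * a ^+ 2 * l) ->
  (forall x, 0 < c + 6 * a * D x ^+ 2) ->
  (forall x, potential_plus f omega phi x = omega - (c + 6 * a * D x ^+ 2)) ->
  (forall x, potential_minus f omega phi x = omega - 2 * (c + 6 * a * D x ^+ 2)) ->
  exists K2, [/\ 0 < K2, spectrally_unstable_wave f omega phi (2 * h) K2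
    & linearly_unstable_wave f omega phi (2 * h) K2].
Proof.
move=> h1 h2 p0 hp hm.
have [b [b1 b2 b3]] : exists b, [/\ 5 * b ^+ 2 + 4 * (1 + l) * b + 3 * l = 0,
    0 < l + b & 0 < 1 + l + 2 * b].
  pose d := 4 - 7 * l + 4 * l ^+ 2.
  have d0 : 0 < d.
    have -> : d = (2 * l - 7 / 4) ^+ 2 + 15 / 16 by rewrite /d; field.
    by rewrite ltr_wpDl ?sqr_ge0 // divr_gt0.
  have s0 : 0 < Num.sqrt d by rewrite sqrtr_gt0.
  have s2 : Num.sqrt d ^+ 2 = d by rewrite sqr_sqrtr // ltW.
  exists ((Num.sqrt d - 2 * (1 + l)) / 5); split.
  - transitivity ((Num.sqrt d ^+ 2 - d) / 5); first by rewrite /d; field.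
    by rewrite s2 subrr mul0r.
  - have : 2 - 3 * l < Num.sqrt d.
      have [l2|l2] := leP (2 - 3 * l) 0; first exact: le_lt_trans s0.
      rewrite -(@ltr_pXn2r _ 2) ?nnegrE ?ltW // s2 -subr_gt0.
      have -> : d - (2 - 3 * l) ^+ 2 = 5 * l * (1 - l) by rewrite /d; ring.
      by rewrite !mulr_gt0 // subr_gt0.
    by lra.
  - by move: l0; lra.
have cD2 : continuous (fun x => c + 6 * a * D x ^+ 2) := der_continuous (cnoidal_der c).
have a6 : 0 <= 6 * a by apply: mulr_ge0 => //; exact: ltW.
have bnd x : `|c + 6 * a * D x ^+ 2| <= `|c| + 6 * a.
  rewrite (le_trans (ler_normD _ _)) // lerD2l ger0_norm.
    exact: (ler_piMr a6 (dn_wave_sqr_le1 x)).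
  exact: (mulr_ge0 a6 (sqr_ge0 _)).
have M0 : 0 <= `|omega| + 2 * (`|c| + 6 * a).
  apply: addr_ge0 => //; apply: mulr_ge0 => //; exact: addr_ge0.
pose chi x := D x * (D x ^+ 2 + b).
pose chi' x := E x * (3 * D x ^+ 2 + b).
have dchi (x : R) : is_derive x 1 chi (chi' x).
  apply: (der_eq (derM (dn_wave_der x) (derD (derX 2 (dn_wave_der x)) (derC b x)))).
  by rewrite /chi' expr1; ring.
apply: (@wave_unstable R f omega phi h 0 (`|omega| + 2 * (`|c| + 6 * a))
  (fun x => omega - 2 * (c + 6 * a * D x ^+ 2)) (fun x => omega - (c + 6 * a * D x ^+ 2))
  (fun x => c + 6 * a * D x ^+ 2) (fun x => 12 * a * (D x * E x))
  chi chi' (5 * a * (1 + l + 2 * b)) (l * (l + b))).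
- exact: half_period_gt0.
- by move=> x; rewrite subr0.
- by move=> x; rewrite subr0.
- by move=> x; apply: cvgB; [exact: cvg_cst|apply: cvgM; [exact: cvg_cst|exact: cD2]].
- by move=> x; apply: cvgB; [exact: cvg_cst|exact: cD2].
- exact: M0.
- move=> x; rewrite (le_trans (ler_normB _ _)) // lerD2l normrM ger0_norm //.
  by rewrite ler_pM2l.
- move=> x; rewrite (le_trans (ler_normB _ _)) // lerD2l.
  by apply: le_trans (bnd x) _; rewrite ler_peMl ?ler1n // addr_ge0 // mulr_ge0 // ltW.
- by move=> x; rewrite dn_wave_even.
- by move=> x; rewrite dn_wave_reflect.
- by move=> x; rewrite dn_wave_even.
- by move=> x; rewrite dn_wave_reflect.
- exact: p0.
- exact: cnoidal_der.
- by move=> x; exact: cnoidal_der2.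
- by rewrite dn_wave'0 !mulr0.
- by rewrite dn_wave'h !mulr0.
- exact: mulr_gt0.
- move=> x; apply: ler_pM; [exact: ltW|exact: ltW|exact: dn_wave_ge|].
  by rewrite lerD2r dn_wave_sqr_ge.
- by rewrite !mulr_gt0.
- move=> x; apply: (der_eq (derM (dn_wave'_der x) (derD (derZ 3 (derX 2 (dn_wave_der x))) (derC b x)))).
  transitivity (a * D x * (1 + l - 2 * D x ^+ 2) * (3 * D x ^+ 2 + b) + 6 * D x * E x ^+ 2).
    by rewrite expr1; ring.
  rewrite dn_wave'_sqr /chi h1; apply: subr0_eq.
  transitivity (- 2 * a * D x * (5 * b ^+ 2 + 4 * (1 + l) * b + 3 * l)); first ring.
  by rewrite b1 mulr0.
- by rewrite /chi' dn_wave'0 mul0r.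
- by rewrite /chi' dn_wave'h mul0r.
Qed.

(** The wave is a multiple of D. Here omega - 6 a D^2 is a Lame potential
    with n = 2, and its ground state is D^2 + b with b the larger root of 3
    b^2 + 2 (1 + l) b + l, for the value nu2 = 3 a (1 + l + 2 b). *)
Theorem dnoidal_unstable (f : R -> R) (omega x0 : R) (phi : R -> R) :
  omega = a * (1 + l) ->
  (forall x, potential_plus f omega phi x = omega - 2 * a * D (x - x0) ^+ 2) ->
  (forall x, potential_minus f omega phi x = omega - 6 * a * D (x - x0) ^+ 2) ->
  exists K2, [/\ 0 < K2, spectrally_unstable_wave f omega phi (2 * h) K2
    & linearly_unstable_wave f omega phi (2 * h) K2].
Proof.
move=> h1 hp hm.
have [b [b1 b2 b3]] : exists b, [/\ 3 * b ^+ 2 + 2 * (1 + l) * b + l = 0,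
    0 < l + b & 0 < 1 + l + 2 * b].
  pose d := 1 - l + l ^+ 2.
  have d0 : 0 < d.
    have -> : d = (l - 1 / 2) ^+ 2 + 3 / 4 by rewrite /d; field.
    by rewrite ltr_wpDl ?sqr_ge0 // divr_gt0.
  have s0 : 0 < Num.sqrt d by rewrite sqrtr_gt0.
  have s2 : Num.sqrt d ^+ 2 = d by rewrite sqr_sqrtr // ltW.
  exists ((Num.sqrt d - (1 + l)) / 3); split.
  - transitivity ((Num.sqrt d ^+ 2 - d) / 3); first by rewrite /d; field.
    by rewrite s2 subrr mul0r.
  - have : 1 - 2 * l < Num.sqrt d.
      have [l2|l2] := leP (1 - 2 * l) 0; first exact: le_lt_trans s0.
      rewrite -(@ltr_pXn2r _ 2) ?nnegrE ?ltW // s2 -subr_gt0.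
      have -> : d - (1 - 2 * l) ^+ 2 = 3 * l * (1 - l) by rewrite /d; ring.
      by rewrite !mulr_gt0 // subr_gt0.
    by lra.
  - by move: l0; lra.
have bnd x : `|a * D x ^+ 2| <= a.
  rewrite ger0_norm; first exact: (ler_piMr (ltW a0) (dn_wave_sqr_le1 x)).
  exact: (mulr_ge0 (ltW a0) (sqr_ge0 _)).
have M0 : 0 <= `|omega| + 6 * a by rewrite addr_ge0 // mulr_ge0 // ltW.
have cV (n : R) : continuous (fun x => omega - n * a * D x ^+ 2).
  by move=> x; apply: cvgB; [exact: cvg_cst|apply: cvgM; [exact: cvg_cst|exact: dn_wave_sqr_cont]].
have bV (n : R) x : 0 <= n -> n <= 6 -> `|omega - n * a * D x ^+ 2| <= `|omega| + 6 * a.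
  move=> n0 n6; rewrite (le_trans (ler_normB _ _)) // lerD2l -mulrA normrM (ger0_norm n0).
  by apply: ler_pM.
pose chi x := D x ^+ 2 + b.
pose chi' x := 2 * D x * E x.
have dchi (x : R) : is_derive x 1 chi (chi' x).
  apply: (der_eq (derD (derX 2 (dn_wave_der x)) (derC b x))).
  by rewrite /chi' expr1 addr0.
apply: (@wave_unstable R f omega phi h x0 (`|omega| + 6 * a)
  (fun x => omega - 6 * a * D x ^+ 2) (fun x => omega - 2 * a * D x ^+ 2)
  D E chi chi' (3 * a * (1 + l + 2 * b)) (l + b)).
- exact: half_period_gt0.
- exact: hp.
- exact: hm.
- exact: cV.
- exact: cV.
- exact: M0.
- by move=> x; apply: bV.
- by move=> x; apply: bV; rewrite // ler_nat.
- by move=> x; rewrite dn_wave_even.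
- by move=> x; rewrite dn_wave_reflect.
- by move=> x; rewrite dn_wave_even.
- by move=> x; rewrite dn_wave_reflect.
- exact: dn_wave_gt0.
- exact: dn_wave_der.
- by move=> x; apply: (der_eq (dn_wave'_der x)); rewrite h1; ring.
- exact: dn_wave'0.
- exact: dn_wave'h.
- exact: b2.
- by move=> x; rewrite lerD2r dn_wave_sqr_ge.
- by rewrite !mulr_gt0.
- move=> x; apply: (der_eq (derM (derZ 2 (dn_wave_der x)) (dn_wave'_der x))).
  transitivity (2 * E x ^+ 2 + 2 * a * D x ^+ 2 * (1 + l - 2 * D x ^+ 2)); first by ring.
  rewrite dn_wave'_sqr /chi h1; apply: subr0_eq.
  transitivity (- 2 * a * (3 * b ^+ 2 + 2 * (1 + l) * b + l)); first ring.
  by rewrite b1 mulr0.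
- by rewrite /chi' dn_wave'0 mulr0.
- by rewrite /chi' dn_wave'h mulr0.
Qed.

End DnWave.

(** * The two families of waves *)

Section Waves.
Context {R : realType}.

(** Subtracting the equations of phi0 and phi1 gives 3 omega (phi0 + phi1) =
    2 (phi0^2 + phi0 phi1 + phi1^2), which implies all the relations between
    the parameters. The absolute value of the wave is cc + 6 alpha^2 dn^2,
    where cc is the third root of the cubic. *)
Lemma quadratic_wave (omega c phi0 phi1 alpha kappa : R) :
     0 < phi1 -> phi1 < phi0 ->
     2 / 3 * phi0 ^+ 3 - omega * phi0 ^+ 2 - c = 0 ->
     2 / 3 * phi1 ^+ 3 - omega * phi1 ^+ 2 - c = 0 ->
     alpha = Num.sqrt ((4 * phi0 + 2 * phi1 - 3 * omega) / 12) ->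
     kappa = Num.sqrt ((2 * phi0 - 2 * phi1) / (4 * phi0 + 2 * phi1 - 3 * omega)) ->
     let T := 2 * ellipticK kappa / alpha in
     [/\ 0 < alpha, 0 < kappa < 1, 0 < T
       & forall phi : R -> R,
           (forall x, 0 < phi x) \/ (forall x, phi x < 0) ->
           (forall x, `|phi x|
                      = phi1 + (phi0 - phi1) * jacobi_cn kappa (alpha * x) ^+ 2) ->
           (forall K2, 0 < K2 ->
              nls_solution Num.sqrt T K2 (standing_wave omega phi)) /\
           exists K2, [/\ 0 < K2,
             spectrally_unstable_wave Num.sqrt omega phi T K2
             & linearly_unstable_wave Num.sqrt omega phi T K2]].
Proof.
move=> phi1_gt0 phi01 e0 e1 alphaE kappaE T.
have d0 : 0 < phi0 - phi1 by rewrite subr_gt0.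
have s0 : 0 < phi0 + phi1 by lra.
have P : 3 * omega * (phi0 + phi1) = 2 * (phi0 ^+ 2 + phi0 * phi1 + phi1 ^+ 2).
  apply/eqP; rewrite eq_sym -subr_eq0; apply/eqP/(mulfI (lt0r_neq0 d0)); rewrite mulr0.
  transitivity (3 * ((2 / 3 * phi0 ^+ 3 - omega * phi0 ^+ 2 - c) - (2 / 3 * phi1 ^+ 3 - omega * phi1 ^+ 2 - c))).
    by field.
  by rewrite e0 e1 subrr mulr0.
pose den := 4 * phi0 + 2 * phi1 - 3 * omega.
have den0 : 0 < den.
  rewrite -(pmulr_rgt0 _ s0).
  have -> : (phi0 + phi1) * den = 2 * phi0 ^+ 2 + 4 * phi0 * phi1.
    transitivity (4 * phi0 ^+ 2 + 6 * phi0 * phi1 + 2 * phi1 ^+ 2 - 3 * omega * (phi0 + phi1)).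
      by rewrite /den; ring.
    by rewrite P; ring.
  have phi0_gt0 : 0 < phi0 := lt_trans phi1_gt0 phi01.
  by rewrite addr_gt0 // ?mulr_gt0 // exprn_gt0.
have den1 : 2 * phi0 - 2 * phi1 < den.
  rewrite -subr_gt0 -(pmulr_rgt0 _ s0).
  have -> : (phi0 + phi1) * (den - (2 * phi0 - 2 * phi1)) = 2 * phi1 ^+ 2 + 4 * phi0 * phi1.
    transitivity (2 * phi0 ^+ 2 + 6 * phi0 * phi1 + 4 * phi1 ^+ 2 - 3 * omega * (phi0 + phi1)).
      by rewrite /den; ring.
    by rewrite P; ring.
  have phi0_gt0 : 0 < phi0 := lt_trans phi1_gt0 phi01.
  by rewrite addr_gt0 // ?mulr_gt0 // exprn_gt0.
have alpha0 : 0 < alpha by rewrite alphaE sqrtr_gt0 divr_gt0.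
have alpha2 : alpha ^+ 2 = den / 12 by rewrite alphaE sqr_sqrtr // divr_ge0 // ltW.
have k20 : 0 < (2 * phi0 - 2 * phi1) / den by rewrite divr_gt0 //; lra.
have kappa0 : 0 < kappa by rewrite kappaE sqrtr_gt0.
have kappa2 : kappa ^+ 2 = (2 * phi0 - 2 * phi1) / den by rewrite kappaE sqr_sqrtr // ltW.
have kappa1 : kappa < 1.
  rewrite -(@expr_lt1 _ 2) ?ltW //.
  by rewrite kappa2 ltr_pdivrMr // mul1r.
have TE : T = 2 * half_period kappa alpha by rewrite /T /half_period mulrA.
have T0 : 0 < T by rewrite TE mulr_gt0 // half_period_gt0.
split; [exact: alpha0 | by rewrite kappa0 kappa1 | exact: T0 |].
move=> phi sgn phiE.
pose a := alpha ^+ 2; pose cc := phi0 - 6 * a.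
pose p x := cc + 6 * a * dn_wave kappa alpha x ^+ 2.
have ak : 6 * a * kappa ^+ 2 = phi0 - phi1.
  by rewrite /a alpha2 kappa2; field; rewrite gt_eqF.
have pE x : `|phi x| = p x.
  rewrite phiE jacobi_cn2 // /p /dn_wave jacobi_dn2 // /cc.
  have -> : phi1 = phi0 - 6 * a * kappa ^+ 2 by rewrite ak; ring.
  by ring.
have ka : a * kappa ^+ 2 = (phi0 - phi1) / 6 by rewrite -ak; field.
have a12 : 12 * a = den by rewrite /a alpha2; field.
have h1 : omega = 2 * cc + 4 * a * (1 + (1 - kappa ^+ 2)).
  transitivity (2 * phi0 - 12 * a / 3 - 4 * (a * kappa ^+ 2)); last by rewrite /cc; field.
  by rewrite a12 ka /den; field.
have h2 : cc * (omega - cc) = - (12 * a ^+ 2 * (1 - kappa ^+ 2)).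
  transitivity (- (a * (12 * a)) + 12 * a * (a * kappa ^+ 2)); last ring.
  have aE : a = den / 12 by rewrite -a12; field.
  rewrite ka /cc aE /den; apply: subr0_eq.
  transitivity ((3 * omega * (phi0 + phi1) - 2 * (phi0 ^+ 2 + phi0 * phi1 + phi1 ^+ 2)) / 6); first by field.
  by rewrite P subrr mul0r.
have p_gt0 x : 0 < p x.
  rewrite -pE normr_gt0; case: sgn => s; first exact: lt0r_neq0.
  exact: ltr0_neq0.
have sq x : Num.sqrt (phi x ^+ 2) = p x by rewrite sqrtr_sqr pE.
have phi2 x : phi x ^+ 2 = p x ^+ 2 by rewrite -pE real_normK ?num_real.
split.
  move=> K2 _; rewrite TE.
  have dp (x : R) : is_derive x 1 p (12 * a * (dn_wave kappa alpha x * dn_wave' kappa alpha x)).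
    exact: cnoidal_der.
  have dp' (x : R) : is_derive x 1 (fun x => 12 * a * (dn_wave kappa alpha x * dn_wave' kappa alpha x)) ((omega - p x) * p x).
    exact: cnoidal_der2.
  have pT x : p (x + 2 * half_period kappa alpha) = p x by rewrite /p dn_wave_period.
  case: sgn => s.
    have -> : phi = p by apply/funext => x; rewrite -pE ger0_norm // ltW.
    apply: standing_wave_solution dp _ pT => x.
    by apply: (der_eq (dp' x)); rewrite sqrtr_sqr gtr0_norm //; ring.
  have -> : phi = (fun x => - p x) by apply/funext => x; rewrite -pE ltr0_norm // opprK.
  apply: standing_wave_solution (fun x => derN (dp x)) _ _ => x; last by rewrite pT.
  by apply: (der_eq (derN (dp' x))); rewrite sqrrN sqrtr_sqr gtr0_norm //; ring.
rewrite TE; apply: (cnoidal_unstable kappa0 kappa1 alpha0 h1 h2 p_gt0) => x.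
  by rewrite /potential_plus sq.
rewrite /potential_minus sq -/(p x).
have phi2_gt0 : 0 < phi x ^+ 2 by rewrite phi2 exprn_gt0.
rewrite (der_derive1 (is_derive1_sqrt phi2_gt0)) sq phi2; field.
by rewrite gt_eqF.
Qed.

(** Subtracting the equations of phi0 and phi1 gives phi0^2 + phi1^2 = 2
    omega, that is omega = alpha^2 (2 - kappa^2), and phi^2 = 2 alpha^2 dn^2. *)
Lemma cubic_wave (omega c phi0 phi1 alpha kappa : R) :
     0 < phi1 -> phi1 < phi0 ->
     1 / 2 * phi0 ^+ 4 - omega * phi0 ^+ 2 - c = 0 ->
     1 / 2 * phi1 ^+ 4 - omega * phi1 ^+ 2 - c = 0 ->
     kappa = Num.sqrt ((phi0 ^+ 2 - phi1 ^+ 2) / phi0 ^+ 2) ->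
     alpha = phi0 / Num.sqrt 2 ->
     let T := 2 * ellipticK kappa / alpha in
     [/\ kappa ^+ 2 = (2 * phi0 ^+ 2 - 2 * omega) / phi0 ^+ 2,
         0 < kappa < 1, 0 < T
       & forall (phi : R -> R) (x0 : R),
           (forall x, phi x = - phi0 * jacobi_dn kappa (alpha * (x - x0))) \/
           (forall x, phi x = phi0 * jacobi_dn kappa (alpha * (x - x0))) ->
           (forall K2, 0 < K2 ->
              nls_solution (fun z => z) T K2 (standing_wave omega phi)) /\
           exists K2, [/\ 0 < K2,
             spectrally_unstable_wave (fun z => z) omega phi T K2
             & linearly_unstable_wave (fun z => z) omega phi T K2]].
Proof.
move=> phi1_gt0 phi01 e0 e1 kappaE alphaE T.
have phi0_gt0 : 0 < phi0 := lt_trans phi1_gt0 phi01.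
have sq0 : 0 < phi0 ^+ 2 by rewrite exprn_gt0.
have sq1 : 0 < phi1 ^+ 2 by rewrite exprn_gt0.
have d0 : 0 < phi0 ^+ 2 - phi1 ^+ 2 by rewrite subr_gt0 ltr_pXn2r ?nnegrE ?ltW.
have P : phi0 ^+ 2 + phi1 ^+ 2 = 2 * omega.
  apply/eqP; rewrite -subr_eq0; apply/eqP/(mulfI (lt0r_neq0 d0)); rewrite mulr0.
  transitivity (2 * ((1 / 2 * phi0 ^+ 4 - omega * phi0 ^+ 2 - c) - (1 / 2 * phi1 ^+ 4 - omega * phi1 ^+ 2 - c))).
    by field.
  by rewrite e0 e1 subrr mulr0.
have k20 : 0 < (phi0 ^+ 2 - phi1 ^+ 2) / phi0 ^+ 2 by rewrite divr_gt0.
have kappa0 : 0 < kappa by rewrite kappaE sqrtr_gt0.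
have kappa2 : kappa ^+ 2 = (phi0 ^+ 2 - phi1 ^+ 2) / phi0 ^+ 2 by rewrite kappaE sqr_sqrtr // ltW.
have kappa1 : kappa < 1.
  rewrite -(@expr_lt1 _ 2) ?ltW //.
  by rewrite kappa2 ltr_pdivrMr // mul1r gtrBl.
have alpha0 : 0 < alpha by rewrite alphaE divr_gt0 // sqrtr_gt0.
have alpha2 : phi0 ^+ 2 = 2 * alpha ^+ 2.
  by rewrite alphaE expr_div_n sqr_sqrtr //; field.
have TE : T = 2 * half_period kappa alpha by rewrite /T /half_period mulrA.
have T0 : 0 < T by rewrite TE mulr_gt0 // half_period_gt0.
split; [|by rewrite kappa0 kappa1|exact: T0|].
  by rewrite kappa2; congr (_ / _); rewrite -P; ring.
move=> phi x0 phiE.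
have h1 : omega = alpha ^+ 2 * (1 + (1 - kappa ^+ 2)).
  have -> : alpha ^+ 2 = phi0 ^+ 2 / 2 by rewrite alpha2; field.
  transitivity ((phi0 ^+ 2 + phi1 ^+ 2) / 2); first by rewrite P; field.
  by rewrite kappa2; field; rewrite gt_eqF.
have phi2 x : phi x ^+ 2 = 2 * alpha ^+ 2 * dn_wave kappa alpha (x - x0) ^+ 2.
  by rewrite -alpha2 -exprMn /dn_wave; case: phiE => ->; rewrite ?mulNr ?sqrrN.
split.
  move=> K2 _; rewrite TE.
  have [s phiS] : exists s, phi = fun x => s * dn_wave kappa alpha (1 * x + - x0).
    by case: phiE => H; [exists (- phi0)|exists phi0]; apply/funext => x; rewrite H mul1r.
  have d1 (x : R) : is_derive x 1 phi (s * (1 * dn_wave' kappa alpha (1 * x + - x0))).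
    rewrite phiS.
    have H := @der_affine R (dn_wave kappa alpha) x _ 1 (- x0) (dn_wave_der alpha kappa0 kappa1 (1 * x + - x0)).
    exact: (derZ s H).
  apply: standing_wave_solution d1 _ _ => x.
    have H := @der_affine R (dn_wave' kappa alpha) x _ 1 (- x0) (dn_wave'_der alpha kappa0 kappa1 (1 * x + - x0)).
    apply: (der_eq (derZ s (derZ 1 H))).
    by rewrite phi2 h1 {1}phiS [in RHS]phiS !mul1r; ring.
  rewrite phiS !mul1r addrAC dn_wave_period //.
rewrite TE; apply: (dnoidal_unstable kappa0 kappa1 alpha0 (x0 := x0) h1) => x.
  by rewrite /potential_plus phi2.
rewrite /potential_minus phi2 (der_derive1 (derI _)); ring.
Qed.

End Waves.

Unset Implicit Arguments.

Theorem theorem3 (R : realType) :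
  (forall omega c phi0 phi1 alpha kappa : R,
     0 < omega -> - (omega ^+ 3 / 3) < c -> c < 0 ->
     0 < phi1 -> phi1 < phi0 ->
     2 / 3 * phi0 ^+ 3 - omega * phi0 ^+ 2 - c = 0 ->
     2 / 3 * phi1 ^+ 3 - omega * phi1 ^+ 2 - c = 0 ->
     alpha = Num.sqrt ((4 * phi0 + 2 * phi1 - 3 * omega) / 12) ->
     kappa = Num.sqrt ((2 * phi0 - 2 * phi1) / (4 * phi0 + 2 * phi1 - 3 * omega)) ->
     let T := 2 * ellipticK kappa / alpha in
     [/\ 0 < alpha, 0 < kappa < 1, 0 < T
       & forall phi : R -> R,
           (forall x, 0 < phi x) \/ (forall x, phi x < 0) ->
           (forall x, `|phi x|
                      = phi1 + (phi0 - phi1) * jacobi_cn kappa (alpha * x) ^+ 2) ->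
           (forall K2, 0 < K2 ->
              nls_solution Num.sqrt T K2 (standing_wave omega phi)) /\
           exists K2, [/\ 0 < K2,
             spectrally_unstable_wave Num.sqrt omega phi T K2
             & linearly_unstable_wave Num.sqrt omega phi T K2]])
  /\
  (forall omega c phi0 phi1 alpha kappa : R,
     0 < omega -> - (omega ^+ 2 / 2) < c -> c < 0 ->
     0 < phi1 -> phi1 < phi0 ->
     1 / 2 * phi0 ^+ 4 - omega * phi0 ^+ 2 - c = 0 ->
     1 / 2 * phi1 ^+ 4 - omega * phi1 ^+ 2 - c = 0 ->
     kappa = Num.sqrt ((phi0 ^+ 2 - phi1 ^+ 2) / phi0 ^+ 2) ->
     alpha = phi0 / Num.sqrt 2 ->
     let T := 2 * ellipticK kappa / alpha in
     [/\ kappa ^+ 2 = (2 * phi0 ^+ 2 - 2 * omega) / phi0 ^+ 2,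
         0 < kappa < 1, 0 < T
       & forall (phi : R -> R) (x0 : R),
           (forall x, phi x = - phi0 * jacobi_dn kappa (alpha * (x - x0))) \/
           (forall x, phi x = phi0 * jacobi_dn kappa (alpha * (x - x0))) ->
           (forall K2, 0 < K2 ->
              nls_solution (fun z => z) T K2 (standing_wave omega phi)) /\
           exists K2, [/\ 0 < K2,
             spectrally_unstable_wave (fun z => z) omega phi T K2
             & linearly_unstable_wave (fun z => z) omega phi T K2]]).
Proof.
split=> omega c phi0 phi1 alpha kappa _ _ _; [exact: quadratic_wave|exact: cubic_wave].
Qed.
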